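(* Consider the system $$\mathfrak r^1_t+V^1\mathfrak r^1_x=0,\qquad \mathfrak r^2_t+V^2\mathfrak r^2_x=0,\qquad \mathfrak r^3_t+V^3\mathfrak r^3_x=0$$ for unknown functions $\mathfrak r^1,\mathfrak r^2,\mathfrak r^3$ of $(t,x)$, where $V^1=\mathfrak r^1+\mathfrak r^2+1$, $V^2=\mathfrak r^1+\mathfrak r^2-1$, $V^3=\mathfrak r^1+\mathfrak r^2$. The space of conserved currents of conservation laws of this system of order not greater than one with $(t,x)$-independent densities is spanned, up to equivalence of conserved currents, by the conserved currents $$\mathrm C_0=\left(\Big(\frac1{\mathfrak r^1_x}-\frac1{\mathfrak r^2_x}\Big)e^{\mathfrak r^1-\mathfrak r^2},\ \Big(\frac{V^1}{\mathfrak r^1_x}-\frac{V^2}{\mathfrak r^2_x}\Big)e^{\mathfrak r^1-\mathfrak r^2}\right),$$ $$\mathrm C_1(\Omega)=\left(e^{\mathfrak r^1-\mathfrak r^2}\Omega,\ (\mathfrak r^1+\mathfrak r^2)e^{\mathfrak r^1-\mathfrak r^2}\Omega\right),$$ where $\Omega$ runs through the set of smooth functions of $\omega^0=\mathfrak r^3$ and $\omega^1=\mathfrak r^3_xe^{\mathfrak r^2-\mathfrak r^1}$, together with the conserved currents $$\mathrm{EHC}(\Psi)=\big(\Psi_{\mathfrak r^1}-\Psi_{\mathfrak r^2},\ (\mathfrak r^1+\mathfrak r^2+1)\Psi_{\mathfrak r^1}-(\mathfrak r^1+\mathfrak r^2-1)\Psi_{\mathfrak r^2}\big),$$ where $\Psi=\Psi(\mathfrak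 r^1,\mathfrak r^2)$ runs through the solution set of the equation $2\Psi_{\mathfrak r^1\mathfrak r^2}=\Psi_{\mathfrak r^2}-\Psi_{\mathfrak r^1}$.
   Context: A conserved current of the system is a pair $(\rho,\sigma)$ of differential functions (density and flux) with $\mathrm D_t\rho+\mathrm D_x\sigma=0$ on all solutions of the system, where $\mathrm D_t,\mathrm D_x$ are the total derivative operators. Two conserved currents are equivalent if they differ by a trivial one (a sum of a null divergence and a pair vanishing on solutions); conservation laws are the equivalence classes. Here one considers conserved currents whose density is a smooth function $\rho=\rho(\mathfrak r^1,\mathfrak r^2,\mathfrak r^3,\mathfrak r^1_x,\mathfrak r^2_x,\mathfrak r^3_x)$ of the dependent variables and their first-order $x$-derivatives, not involving $(t,x)$ explicitly (locally, in a domain where the involved expressions are defined). *)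

(* Defs.v *)
(* Stdlib real numbers + Coquelicot. *)
From Stdlib Require Export Reals Arith.
From Coquelicot Require Export Coquelicot.
Open Scope R_scope.

Inductive ivar := vt | vx.
Inductive dvar := r1 | r2 | r3.

(* Coordinates on the infinite jet space J^oo(t,x | r^1,r^2,r^3);
   [der i a b] stands for d^(a+b) r^i / dt^a dx^b. *)
Inductive coord :=
  | ind (v : ivar)
  | der (i : dvar) (a b : nat).

Definition coord_eq_dec (c d : coord) : {c = d} + {c <> d}.
Proof. decide equality; solve [apply Nat.eq_dec | decide equality]. Defined.

Definition ord (c : coord) : nat :=
  match c with ind _ => 0 | der _ a b => a + b end.

Definition jet := coord -> R.

Definition upd (z : jet) (c : coord) (s : R) : jet :=
  fun d => if coord_eq_dec d c then s else z d.

(* Inverse-limit topology of J^oo: the basic neighbourhoods are the preimages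
   of boxes in the finite-order jet spaces J^n. *)
Definition jet_locally (z : jet) (P : jet -> Prop) : Prop :=
  exists (n : nat) (e : posreal), forall w : jet,
    (forall c, (ord c <= n)%nat -> Rabs (w c - z c) < e) -> P w.

Definition jet_open (U : jet -> Prop) : Prop :=
  forall z, U z -> jet_locally z U.

Definition pder (c : coord) (F : jet -> R) (z : jet) : R :=
  Derive (fun s => F (upd z c s)) (z c).

(* Class C^n at z; the analogue on J^oo of Coquelicot's [ex_diff_n]. *)
Fixpoint jet_ex_diff_n (F : jet -> R) (n : nat) (z : jet) : Prop :=
  filterlim F (jet_locally z) (locally (F z)) /\
  match n with
  | O => True
  | S m => forall c, ex_derive (fun s => F (upd z c s)) (z c) /\
                     jet_ex_diff_n (pder c F) m z
  end.

Definition differential_function (k : nat) (U : jet -> Prop) (F : jet -> R) : Prop :=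
  jet_open U /\
  (forall z w, U z -> U w ->
     (forall c, (ord c <= k)%nat -> z c = w c) -> F z = F w) /\
  (forall z, U z -> forall n, jet_ex_diff_n F n z).

Definition sum_dvar (g : dvar -> R) : R := g r1 + g r2 + g r3.

(* Total derivatives of a differential function of order at most k; the value
   does not depend on the choice of the order bound k. The summation index m is
   the order a + b of the coordinate [der i a b]. *)
Definition Dt (k : nat) (F : jet -> R) (z : jet) : R :=
  pder (ind vt) F z +
  sum_dvar (fun i => sum_f_R0 (fun m => sum_f_R0 (fun a =>
    z (der i (S a) (m - a)) * pder (der i a (m - a)) F z) m) k).

Definition Dx (k : nat) (F : jet -> R) (z : jet) : R :=
  pder (ind vx) F z +
  sum_dvar (fun i => sum_f_R0 (fun m => sum_f_R0 (fun a =>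
    z (der i a (S (m - a))) * pder (der i a (m - a)) F z) m) k).

Definition smooth2 (V : R * R -> Prop) (f : R -> R -> R) : Prop :=
  open V /\ forall a b, V (a, b) -> forall n, ex_diff_n f n a b.

Definition u (i : dvar) (z : jet) : R := z (der i 0 0).
Definition ux (i : dvar) (z : jet) : R := z (der i 0 1).
Definition ut (i : dvar) (z : jet) : R := z (der i 1 0).

Definition V (i : dvar) (z : jet) : R :=
  match i with
  | r1 => u r1 z + u r2 z + 1
  | r2 => u r1 z + u r2 z - 1
  | r3 => u r1 z + u r2 z
  end.

(* Prolongation at (t,x) of the functions r^i = f i (t,x); the first argument
   of [f i] is t. *)
Definition prolong (f : dvar -> R -> R -> R) (t x : R) : jet :=
  fun c => match c with
           | ind vt => t
           | ind vx => x
           | der i a b => partial_derive a b (f i) t x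
           end.

Definition is_solution (O : R * R -> Prop) (f : dvar -> R -> R -> R) : Prop :=
  forall i, smooth2 O (f i) /\
    forall t x, O (t, x) ->
      ut i (prolong f t x) + V i (prolong f t x) * ux i (prolong f t x) = 0.

Definition vanishes_on_solutions (U : jet -> Prop) (F : jet -> R) : Prop :=
  forall O f, is_solution O f ->
  forall t x, O (t, x) -> U (prolong f t x) -> F (prolong f t x) = 0.

(* Pairs (density, flux). *)
Definition current := ((jet -> R) * (jet -> R))%type.

Definition cur_add (C C' : current) : current :=
  (fun z => fst C z + fst C' z, fun z => snd C z + snd C' z).
Definition cur_scal (a : R) (C : current) : current :=
  (fun z => a * fst C z, fun z => a * snd C z).
Definition cur_sub (C C' : current) : current := cur_add C (cur_scal (-1) C').

Definition current_on (k : nat) (U : jet -> Prop) (C : current) : Prop :=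
  differential_function k U (fst C) /\ differential_function k U (snd C).

Definition conserved_current (U : jet -> Prop) (C : current) : Prop :=
  exists k, current_on k U C /\
    vanishes_on_solutions U (fun z => Dt k (fst C) z + Dx k (snd C) z).

Definition null_divergence (U : jet -> Prop) (C : current) : Prop :=
  exists k, current_on k U C /\
    forall z, U z -> Dt k (fst C) z + Dx k (snd C) z = 0.

Definition current_vanishing_on_solutions (U : jet -> Prop) (C : current) : Prop :=
  (exists k, current_on k U C) /\
  vanishes_on_solutions U (fst C) /\ vanishes_on_solutions U (snd C).

Definition trivial_current (U : jet -> Prop) (C : current) : Prop :=
  exists N Z, null_divergence U N /\ current_vanishing_on_solutions U Z /\
    forall z, U z -> fst C z = fst N z + fst Z z /\ snd C z = snd N z + snd Z z.

Definition equivalent_currents (U : jet -> Prop) (C C' : current) : Prop :=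
  trivial_current U (cur_sub C C').

(* rho = rho(r^1,r^2,r^3,r^1_x,r^2_x,r^3_x) on U. *)
Definition first_order_tx_independent (U : jet -> Prop) (rho : jet -> R) : Prop :=
  forall z w, U z -> U w ->
    (forall i, u i z = u i w /\ ux i z = ux i w) -> rho z = rho w.

Definition cur_C0 : current :=
  (fun z => (1 / ux r1 z - 1 / ux r2 z) * exp (u r1 z - u r2 z),
   fun z => (V r1 z / ux r1 z - V r2 z / ux r2 z) * exp (u r1 z - u r2 z)).

Definition cur_C0_domain (z : jet) : Prop := ux r1 z <> 0 /\ ux r2 z <> 0.

Definition omega0 (z : jet) : R := u r3 z.
Definition omega1 (z : jet) : R := ux r3 z * exp (u r2 z - u r1 z).

Definition cur_C1 (Omega : R -> R -> R) : current :=
  (fun z => exp (u r1 z - u r2 z) * Omega (omega0 z) (omega1 z),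
   fun z => (u r1 z + u r2 z) * exp (u r1 z - u r2 z) * Omega (omega0 z) (omega1 z)).

Definition cur_C1_domain (D : R * R -> Prop) (z : jet) : Prop := D (omega0 z, omega1 z).

Definition cur_EHC (Psi : R -> R -> R) : current :=
  (fun z => partial_derive 1 0 Psi (u r1 z) (u r2 z)
            - partial_derive 0 1 Psi (u r1 z) (u r2 z),
   fun z => (u r1 z + u r2 z + 1) * partial_derive 1 0 Psi (u r1 z) (u r2 z)
            - (u r1 z + u r2 z - 1) * partial_derive 0 1 Psi (u r1 z) (u r2 z)).

Definition cur_EHC_domain (D : R * R -> Prop) (z : jet) : Prop := D (u r1 z, u r2 z).

Definition Psi_equation (D : R * R -> Prop) (Psi : R -> R -> R) : Prop :=
  forall a b, D (a, b) ->
    2 * partial_derive 1 1 Psi a b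
    = partial_derive 0 1 Psi a b - partial_derive 1 0 Psi a b.

(* c C_0 + C_1(Omega) + EHC(Psi). As C_1 and EHC are linear in their arguments,
   every finite linear combination of the spanning currents has this form. *)
Definition combination (c : R) (Omega Psi : R -> R -> R) : current :=
  cur_add (cur_scal c cur_C0) (cur_add (cur_C1 Omega) (cur_EHC Psi)).

(* Main.v *)
(* Local solvability (Cauchy-Kovalevskaya, with Lax's majorant sum of (lam t + x)^N / (N + 1)^2) realizes every finite
   jet on the equation manifold, so a conserved current satisfies D_t rho + D_x sigma = 0 at all points of that manifold.
   Restricting sigma to it gives a function S of t, x and the x-derivatives; comparing coefficients of the highest
   derivatives, S depends on t, x, r, r_x only, and S_{r^i_x} = V^i rho_{r^i_x}. Hence rho is a sum of functions of
   (r, r^i_x), i = 1, 2, 3. The remaining determining equation, differentiated twice with respect to the r^i_x, shows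
   that (r^1_x)^3 rho_{r^1_x r^1_x} = - (r^2_x)^3 rho_{r^2_x r^2_x} = 2 c e^{r^1 - r^2} with c constant, which accounts
   for C_0, and that rho_{r^3_x r^3_x} is transported along omega^0, omega^1 = const, which accounts for C_1. What is
   left is b_i r^i_x + h with b_i dr^i closed, i.e. a null divergence, and h = h(r^1, r^2), S = S(r^1, r^2), whence
   Psi_{r^1} - Psi_{r^2} = h and (r^1 + r^2) h + Psi_{r^1} + Psi_{r^2} = S define Psi. Near a point off the equation
   manifold every current is trivial. *)

From Stdlib Require Import Lra Lia List Classical FunctionalExtensionality.
Require Import Defs.
Import ListNotations.

Open Scope R_scope.

(** * Chain rule on jet space *)

(** The hypothesis speaks of solutions only, on an arbitrary open set of an infinite-dimensional
    space. Therefore the flux is composed with the retraction [proj] onto the equation manifold,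
    which is compatible with D_x, and the analysis takes place in a box, where a function with
    vanishing partial derivatives really loses the corresponding variables. The differences V^i -
    V^j are nonzero constants and all V^i have the same gradient in r; this is why only the
    exponential of r^1 - r^2 occurs. Omega is not found by integrating rho_{r^3_x r^3_x} twice. It
    is read off from the part of rho free of r^1_x, r^2_x, at the values of r^1, r^2 in the centre
    of the box. This absorbs the part affine in r^3_x as well, so that the remainder h vanishes on
    that slice. Since h_{r^3} e^{r^2 - r^1} turns out not to depend on r^1, r^2, h is then free of
    r^3 everywhere. The flux may still contain an additive function of t, which is a null divergence
    and is split off as [t_part]. *)

Notation DF := differential_function.

Lemma upd_same z c s : upd z c s c = s.
Proof. unfold upd; destruct (coord_eq_dec c c); congruence. Qed.

Lemma upd_other z c s d : d <> c -> upd z c s d = z d.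
Proof. unfold upd; destruct (coord_eq_dec d c); congruence. Qed.

Lemma upd_id z c : upd z c (z c) = z.
Proof.
  extensionality d; unfold upd; destruct (coord_eq_dec d c); congruence.
Qed.

Lemma upd_upd z c s s' : upd (upd z c s) c s' = upd z c s'.
Proof. extensionality d; unfold upd; destruct (coord_eq_dec d c); congruence. Qed.

Lemma upd_comm z c d s s' :
  c <> d -> upd (upd z c s) d s' = upd (upd z d s') c s.
Proof.
  intros H; extensionality e; unfold upd.
  destruct (coord_eq_dec e c), (coord_eq_dec e d); congruence.
Qed.

Lemma jet_locally_mono z (P Q : jet -> Prop) :
  (forall w, P w -> Q w) -> jet_locally z P -> jet_locally z Q.
Proof. intros H [n [e He]]; exists n, e; auto. Qed.

Lemma jet_locally_and z (P Q : jet -> Prop) :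
  jet_locally z P -> jet_locally z Q -> jet_locally z (fun w => P w /\ Q w).
Proof.
  intros [n [e He]] [m [e' He']].
  exists (Nat.max n m), (mkposreal _ (Rmin_stable_in_posreal e e')); simpl.
  intros w Hw; split; [apply He | apply He']; intros c Hc;
    (eapply Rlt_le_trans; [apply Hw; lia | ]);
    [apply Rmin_l | apply Rmin_r].
Qed.

Lemma jet_locally_true z : jet_locally z (fun _ => True).
Proof. exists 0%nat, (mkposreal 1 Rlt_0_1); auto. Qed.

Global Instance jet_locally_filter z : Filter (jet_locally z).
Proof.
  constructor.
  - apply jet_locally_true.
  - intros P Q; apply jet_locally_and.
  - intros P Q; apply jet_locally_mono.
Qed.

Lemma jet_locally_self z P : jet_locally z P -> P z.
Proof.
  intros [n [e He]]; apply He; intros c _.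
  rewrite Rminus_diag, Rabs_R0; apply cond_pos.
Qed.

Lemma jet_locally_coord z c (e : posreal) :
  jet_locally z (fun w => Rabs (w c - z c) < e).
Proof. exists (ord c), e; auto. Qed.

Lemma jet_locally_finite z (l : list coord) (e : posreal) :
  jet_locally z (fun w => forall c, In c l -> Rabs (w c - z c) < e).
Proof.
  induction l as [|c l IH].
  - apply (jet_locally_mono z (fun _ => True)); [easy | apply jet_locally_true].
  - refine (jet_locally_mono _ _ _ _ (jet_locally_and _ _ _ (jet_locally_coord z c e) IH)).
    intros w [H1 H2] d [<-|Hd]; auto.
Qed.

Definition jcont (F : jet -> R) (z : jet) : Prop :=
  filterlim F (jet_locally z) (locally (F z)).

Lemma jcont_eps F z :
  jcont F z <->
  forall e : posreal, jet_locally z (fun w => Rabs (F w - F z) < e).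
Proof.
  unfold jcont; rewrite filterlim_locally; split; intros H e; exact (H e).
Qed.

Lemma jcont_coord c z : jcont (fun w => w c) z.
Proof. apply jcont_eps; intros e; apply jet_locally_coord. Qed.

Lemma jcont_const a z : jcont (fun _ => a) z.
Proof. apply filterlim_const. Qed.

Lemma jcont_plus F G z : jcont F z -> jcont G z -> jcont (fun w => F w + G w) z.
Proof. intros HF HG; eapply filterlim_comp_2; [exact HF | exact HG | apply (filterlim_plus (F z) (G z))]. Qed.

Lemma jcont_mult F G z : jcont F z -> jcont G z -> jcont (fun w => F w * G w) z.
Proof. intros HF HG; eapply filterlim_comp_2; [exact HF | exact HG | apply (filterlim_mult (F z) (G z))]. Qed.

Lemma jcont_ext_loc F G z :
  jet_locally z (fun w => F w = G w) -> jcont F z -> jcont G z.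
Proof.
  intros HE HF; unfold jcont; rewrite <- (jet_locally_self _ _ HE).
  exact (filterlim_ext_loc _ _ HE HF).
Qed.

Lemma upd_locally z c (P : jet -> Prop) :
  jet_locally z P -> locally (z c) (fun s => P (upd z c s)).
Proof.
  intros [n [e He]]; exists e; intros s Hs; apply He; intros d _.
  unfold upd; destruct (coord_eq_dec d c) as [->|].
  - exact Hs.
  - rewrite Rminus_diag, Rabs_R0; apply cond_pos.
Qed.

Lemma jet_open_and U W : jet_open U -> jet_open W -> jet_open (fun z => U z /\ W z).
Proof. intros HU HW z [H1 H2]; apply jet_locally_and; auto. Qed.

Lemma jet_open_true : jet_open (fun _ => True).
Proof. intros z _; apply jet_locally_true. Qed.

Lemma jet_open_preimage (P : R -> Prop) F W :
  jet_open W -> (forall z, W z -> jcont F z) -> open P ->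
  jet_open (fun z => W z /\ P (F z)).
Proof.
  intros HW HF HP z [Hz HPz]; apply jet_locally_and; [auto|].
  exact (HF z Hz _ (HP _ HPz)).
Qed.

Definition is_pder (c : coord) (F : jet -> R) (z : jet) (l : R) : Prop :=
  is_derive (fun s => F (upd z c s)) (z c) l.

Lemma is_pder_unique c F z l : is_pder c F z l -> pder c F z = l.
Proof. apply is_derive_unique. Qed.

Lemma pder_ext_loc c F G z :
  jet_locally z (fun w => F w = G w) -> pder c F z = pder c G z.
Proof.
  intros H; apply Derive_ext_loc; exact (upd_locally z c _ H).
Qed.

Lemma jet_ex_diff_n_ext U F G n :
  jet_open U -> (forall z, U z -> F z = G z) ->
  forall z, U z -> jet_ex_diff_n F n z -> jet_ex_diff_n G n z.
Proof.
  intros HU; revert F G; induction n as [|n IH]; intros F G H z Hz [HF HD];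
    (assert (HE : jet_locally z (fun w => F w = G w))
      by (apply (jet_locally_mono z U); auto)); (split; [exact (jcont_ext_loc _ _ _ HE HF)|]).
  - exact I.
  - intros c; destruct (HD c) as [H1 H2]; split.
    + refine (ex_derive_ext_loc _ _ _ _ H1); exact (upd_locally z c _ HE).
    + refine (IH _ _ _ z Hz H2); intros w Hw; apply pder_ext_loc.
      apply (jet_locally_mono w U); auto.
Qed.

(** Only first derivatives have to be computed: if they fall back into the family, induction on n
    does the rest. A derivative need only agree on U with a member, whence the passage through
    [jet_ex_diff_n_ext]. The smoothness proofs for constants, coordinates, exp and inverses are
    instances. *)
Lemma smooth_of_stable_family U (P : (jet -> R) -> Prop) :
  jet_open U ->
  (forall F, P F -> forall z, U z -> jcont F z) ->
  (forall F, P F -> forall c, exists G, P G /\ forall z, U z -> is_pder c F z (G z)) ->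
  forall F, P F -> forall z, U z -> forall n, jet_ex_diff_n F n z.
Proof.
  intros HU Hc Hd F HF z Hz n; revert F HF z Hz.
  induction n as [|n IH]; intros F HF z Hz; (split; [exact (Hc F HF z Hz)|]).
  - exact I.
  - intros c; destruct (Hd F HF c) as [G [HG HFG]]; split.
    + exists (G z); exact (HFG z Hz).
    + refine (jet_ex_diff_n_ext U G _ n HU _ z Hz (IH G HG z Hz)).
      intros w Hw; symmetry; apply is_pder_unique; auto.
Qed.

Section DFbasics.
Context {k : nat} {U : jet -> Prop} {F : jet -> R} (HF : DF k U F).

Lemma DF_open : jet_open U.
Proof. apply HF. Qed.

Lemma DF_dep z w :
  U z -> U w -> (forall c, (ord c <= k)%nat -> z c = w c) -> F z = F w.
Proof. apply HF. Qed.

Lemma DF_cont z : U z -> jcont F z.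
Proof. intros Hz; destruct HF as [_ [_ H]]; apply (H z Hz 0%nat). Qed.

Lemma DF_is_pder c z : U z -> is_pder c F z (pder c F z).
Proof.
  intros Hz; destruct HF as [_ [_ H]]; destruct (H z Hz 1%nat) as [_ HD].
  apply Derive_correct; apply HD.
Qed.

Lemma DF_pder_high c z : U z -> (k < ord c)%nat -> pder c F z = 0.
Proof.
  intros Hz Hc; apply is_pder_unique.
  apply (is_derive_ext_loc (fun _ => F z)); [|exact (is_derive_const (F z) (z c))].
  apply (filter_imp (fun s => U (upd z c s))).
  - intros s Hs; apply DF_dep; auto; intros d Hd.
    rewrite upd_other; [easy|intros ->; lia].
  - apply upd_locally; apply DF_open; exact Hz.
Qed.

Lemma DF_pder c : DF k U (pder c F).
Proof.
  split; [apply DF_open|split].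
  - intros z w Hz Hw H; destruct (le_lt_dec (ord c) k) as [Hc|Hc].
    + unfold pder; rewrite <- (H c Hc); apply Derive_ext_loc.
      apply (filter_imp (fun s => U (upd z c s) /\ U (upd w c s))).
      * intros s [H1 H2]; apply DF_dep; auto; intros d Hd.
        unfold upd; destruct (coord_eq_dec d c); auto.
      * apply filter_and; [|rewrite (H c Hc)];
          apply upd_locally; apply DF_open; assumption.
    + rewrite !DF_pder_high; auto.
  - intros z Hz n; destruct HF as [_ [_ H]]; destruct (H z Hz (S n)) as [_ HD]; apply HD.
Qed.

Lemma DF_mono m : (k <= m)%nat -> DF m U F.
Proof.
  intros Hm; split; [apply DF_open|split; [|apply HF]].
  intros z w Hz Hw H; apply DF_dep; auto; intros c Hc; apply H; lia.
Qed.

Lemma DF_sub (W : jet -> Prop) : jet_open W -> (forall z, W z -> U z) -> DF k W F.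
Proof.
  intros HW H; split; [exact HW|split].
  - intros z w Hz Hw; apply DF_dep; auto.
  - intros z Hz; apply HF; auto.
Qed.

Lemma DF_ext G : (forall z, U z -> F z = G z) -> DF k U G.
Proof.
  intros HE; split; [apply DF_open|split].
  - intros z w Hz Hw H; rewrite <- !HE; auto; apply DF_dep; auto.
  - intros z Hz n; apply (jet_ex_diff_n_ext U F G n DF_open HE z Hz); apply HF; auto.
Qed.
End DFbasics.

(** * Finite sums over the coordinates of bounded order *)

Definition lsum (f : coord -> R) (l : list coord) : R :=
  fold_right (fun c s => f c + s) 0 l.

Lemma lsum_ext f g l : (forall c, In c l -> f c = g c) -> lsum f l = lsum g l.
Proof.
  induction l as [|c l IH]; intros H; simpl; [easy|].
  rewrite (H c (or_introl eq_refl)), IH; [easy|]; intros d Hd; apply H; right; auto.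
Qed.

Lemma lsum_zero f l : (forall c, In c l -> f c = 0) -> lsum f l = 0.
Proof.
  induction l as [|c l IH]; intros H; simpl; [easy|].
  rewrite (H c (or_introl eq_refl)), IH; [ring|]; intros d Hd; apply H; right; auto.
Qed.

Lemma lsum_cons f c l : lsum f (c :: l) = f c + lsum f l.
Proof. reflexivity. Qed.

Lemma lsum_app f l l' : lsum f (l ++ l') = lsum f l + lsum f l'.
Proof. induction l as [|c l IH]; simpl; [ring|rewrite IH; ring]. Qed.

Lemma lsum_minus f g l : lsum f l - lsum g l = lsum (fun c => f c - g c) l.
Proof. induction l as [|c l IH]; simpl; [ring|rewrite <- IH; ring]. Qed.

Lemma lsum_single f l c :
  NoDup l -> In c l -> (forall d, d <> c -> f d = 0) -> lsum f l = f c.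
Proof.
  induction l as [|d l IH]; intros HN Hc H; [easy|]; simpl.
  inversion_clear HN as [|? ? Hd HN'].
  destruct (coord_eq_dec d c) as [->|Hdc].
  - rewrite lsum_zero; [ring|]; intros e He; apply H; intros ->; auto.
  - rewrite (H d Hdc), IH; auto; [ring|]; destruct Hc; congruence.
Qed.

(** Enumerated by order m and then by the number a of t-derivatives, as in the sums defining [Dt]
    and [Dx], so that both become sums over one list without repetitions. *)
Definition coords_of (i : dvar) (k : nat) : list coord :=
  flat_map (fun m => map (fun a => der i a (m - a)) (seq 0 (S m))) (seq 0 (S k)).

Arguments coords_of : simpl never.

Definition coords (k : nat) : list coord :=
  ind vt :: ind vx :: coords_of r1 k ++ coords_of r2 k ++ coords_of r3 k.

Lemma in_coords_of i k c :
  In c (coords_of i k) <-> exists a b, c = der i a b /\ (a + b <= k)%nat.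
Proof.
  unfold coords_of; rewrite in_flat_map; split.
  - intros [m [Hm Hc]]; apply in_seq in Hm; apply in_map_iff in Hc.
    destruct Hc as [a [<- Ha]]; apply in_seq in Ha.
    exists a, (m - a)%nat; split; [easy|lia].
  - intros [a [b [-> H]]]; exists (a + b)%nat; rewrite in_seq, in_map_iff; split; [lia|].
    exists a; rewrite in_seq; split; [f_equal|]; lia.
Qed.

Lemma in_coords k c : In c (coords k) <-> (ord c <= k)%nat.
Proof.
  unfold coords; cbn [In]; rewrite !in_app_iff, !in_coords_of; split.
  - intros [<-|[<-|[H|[H|H]]]]; simpl; try lia;
      destruct H as [a [b [-> H]]]; exact H.
  - destruct c as [[]|[] a b]; simpl; intros H; auto;
      right; right; [left|right;left|right;right]; exists a, b; auto.
Qed.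

Lemma NoDup_flat_map {A B} (f : A -> list B) l :
  NoDup l -> (forall a, In a l -> NoDup (f a)) ->
  (forall a a' b, In b (f a) -> In b (f a') -> a = a') -> NoDup (flat_map f l).
Proof.
  intros HN Hf Hd; induction HN as [|a l Ha HN IH]; simpl; [constructor|].
  apply NoDup_app; [apply Hf; left; auto|apply IH; intros; apply Hf; right; auto|].
  intros b Hb Hb'; apply in_flat_map in Hb'; destruct Hb' as [a' [Ha' Hb']].
  rewrite (Hd a a' b Hb Hb') in Ha; auto.
Qed.

Lemma NoDup_coords k : NoDup (coords k).
Proof.
  assert (Hi : forall i, NoDup (coords_of i k)).
  { intros i; apply NoDup_flat_map; [apply seq_NoDup| |].
    - intros m _; apply NoDup_map_NoDup_ForallPairs; [|apply seq_NoDup].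
      intros a a' Ha Ha' E; congruence.
    - intros m m' c H H'; apply in_map_iff in H, H'.
      destruct H as [a [<- Ha]], H' as [a' [E Ha']].
      apply in_seq in Ha, Ha'; injection E; intros; lia. }
  assert (Hij : forall i j c, i <> j -> In c (coords_of i k) -> ~ In c (coords_of j k)).
  { intros i j c H Hc Hc'; apply in_coords_of in Hc, Hc'.
    destruct Hc as [a [b [-> _]]], Hc' as [a' [b' [E _]]]; congruence. }
  unfold coords; constructor; [|constructor].
  - cbn [In]; rewrite !in_app_iff, !in_coords_of.
    intros [E|[[a [b [E _]]]|[[a [b [E _]]]|[a [b [E _]]]]]]; discriminate.
  - rewrite !in_app_iff, !in_coords_of.
    intros [[a [b [E _]]]|[[a [b [E _]]]|[a [b [E _]]]]]; discriminate.
  - apply NoDup_app; [apply Hi| |].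
    + apply NoDup_app; [apply Hi|apply Hi|]; intros c; apply Hij; discriminate.
    + intros c Hc; rewrite in_app_iff; intros [H|H]; revert H; apply (Hij r1); auto; discriminate.
Qed.

Lemma lsum_map_seq f (g : nat -> coord) n :
  lsum f (map g (seq 0 (S n))) = sum_f_R0 (fun a => f (g a)) n.
Proof.
  induction n as [|n IH]; [simpl; ring|].
  rewrite seq_S, map_app, lsum_app, IH; simpl; ring.
Qed.

Lemma lsum_flat_map_seq f (g : nat -> list coord) n :
  lsum f (flat_map g (seq 0 (S n))) = sum_f_R0 (fun m => lsum f (g m)) n.
Proof.
  induction n as [|n IH]; [simpl; rewrite lsum_app; simpl; ring|].
  rewrite seq_S, flat_map_app, lsum_app, IH; simpl; rewrite lsum_app; simpl; ring.
Qed.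

Lemma lsum_coords f k :
  lsum f (coords k) =
  f (ind vt) + f (ind vx) +
  sum_dvar (fun i => sum_f_R0 (fun m => sum_f_R0 (fun a => f (der i a (m - a))) m) k).
Proof.
  assert (H : forall i, lsum f (coords_of i k) =
    sum_f_R0 (fun m => sum_f_R0 (fun a => f (der i a (m - a))) m) k).
  { intros i; unfold coords_of; rewrite lsum_flat_map_seq.
    apply sum_eq; intros m _; apply (lsum_map_seq f (fun a => der i a (m - a))). }
  unfold coords, sum_dvar; rewrite !lsum_cons, !lsum_app, !H; ring.
Qed.

(* Components of the vector field of the total derivative D_t, resp. D_x. *)
Definition dtc (z : jet) (c : coord) : R :=
  match c with ind vt => 1 | ind vx => 0 | der i a b => z (der i (S a) b) end.
Definition dxc (z : jet) (c : coord) : R :=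
  match c with ind vt => 0 | ind vx => 1 | der i a b => z (der i a (S b)) end.

Lemma Dt_lsum k F z : Dt k F z = lsum (fun c => dtc z c * pder c F z) (coords k).
Proof. rewrite lsum_coords; unfold Dt; simpl; ring. Qed.

Lemma Dx_lsum k F z : Dx k F z = lsum (fun c => dxc z c * pder c F z) (coords k).
Proof. rewrite lsum_coords; unfold Dx; simpl; ring. Qed.

(** Interpolates between z and w by exchanging one coordinate after another, so that increments can
    be controlled by partial derivatives alone. *)
Definition mix (l : list coord) (w z : jet) : jet :=
  fun d => if in_dec coord_eq_dec d l then w d else z d.

Lemma mix_cons c l w z : mix (c :: l) w z = upd (mix l w z) c (w c).
Proof.
  extensionality d; unfold mix, upd.
  destruct (coord_eq_dec d c) as [->|H].
  - destruct (in_dec coord_eq_dec c (c :: l)) as [|n]; [easy|destruct n; left; auto].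
  - destruct (in_dec coord_eq_dec d (c :: l)) as [[|]|n], (in_dec coord_eq_dec d l);
      try easy; [congruence|destruct n; right; auto].
Qed.

Lemma mix_self l z : mix l z z = z.
Proof. extensionality d; unfold mix; destruct in_dec; auto. Qed.

Lemma mix_notin c l w z : ~ In c l -> mix l w z c = z c.
Proof. unfold mix; destruct in_dec; easy. Qed.

Lemma mix_in c l w z : In c l -> mix l w z c = w c.
Proof. unfold mix; destruct in_dec; easy. Qed.

Lemma pder_mvt F z c s :
  (forall t, Rmin (z c) s <= t <= Rmax (z c) s ->
     is_pder c F (upd z c t) (pder c F (upd z c t))) ->
  exists t, Rmin (z c) s <= t <= Rmax (z c) s /\
    F (upd z c s) - F z = pder c F (upd z c t) * (s - z c).
Proof.
  intros H.
  destruct (MVT_gen (fun t => F (upd z c t)) (z c) s (fun t => pder c F (upd z c t)))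
    as [t [Ht HE]].
  - intros t Ht; assert (Ht' : Rmin (z c) s <= t <= Rmax (z c) s) by lra.
    specialize (H t Ht'); unfold is_pder in H; rewrite upd_same in H.
    refine (is_derive_ext _ _ _ _ _ H); intros u; now rewrite upd_upd.
  - intros t Ht; specialize (H t Ht); unfold is_pder in H; rewrite upd_same in H.
    apply continuity_pt_filterlim.
    apply (ex_derive_continuous (fun t => F (upd z c t))); eexists.
    refine (is_derive_ext _ _ _ _ _ H); intros u; now rewrite upd_upd.
  - exists t; split; [exact Ht|]; rewrite upd_id in HE; exact HE.
Qed.

Lemma is_derive_eps (f : R -> R) x l :
  is_derive f x l <->
  forall e : posreal, locally x (fun y => Rabs (f y - f x - (y - x) * l) <= e * Rabs (y - x)).
Proof.
  split.
  - intros [_ H] e; exact (H x (fun P HP => HP) e).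
  - intros H; split; [apply is_linear_scal_l|].
    intros y Hy; rewrite <- (is_filter_lim_locally_unique _ _ Hy); exact H.
Qed.

(* The typical D is the increment of a function in a single coordinate g, r being a partial derivative at an
   intermediate point. *)
Lemma is_derive_increment (D g : R -> R) s0 v q :
  is_derive g s0 v -> D s0 = 0 ->
  (forall e : posreal, locally s0 (fun s => exists r, D s = r * (g s - g s0) /\ Rabs (r - q) <= e)) ->
  is_derive D s0 (v * q).
Proof.
  intros Hg HD Hq; apply is_derive_eps; intros e.
  set (K := Rabs v + 1 + Rabs q).
  assert (HK : 0 < K) by (unfold K; generalize (Rabs_pos v) (Rabs_pos q); lra).
  assert (He : 0 < Rmin 1 (e / K)).
  { apply Rmin_pos; [lra|apply Rdiv_lt_0_compat; [apply cond_pos|exact HK]]. }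
  set (h := mkposreal _ He).
  apply (filter_imp (fun s =>
    (exists r, D s = r * (g s - g s0) /\ Rabs (r - q) <= h) /\
    Rabs (g s - g s0 - (s - s0) * v) <= h * Rabs (s - s0))).
  2:{ apply filter_and; [apply Hq|exact (proj1 (is_derive_eps _ _ _) Hg h)]. }
  intros s [[r [E Hr]] Hs]; rewrite HD, E.
  set (G := g s - g s0) in *; set (d := s - s0) in *.
  replace (r * G - 0 - d * (v * q)) with ((r - q) * G + q * (G - d * v)) by ring.
  assert (HG : Rabs G <= (Rabs v + 1) * Rabs d).
  { replace G with ((G - d * v) + d * v) by ring.
    eapply Rle_trans; [apply Rabs_triang|]; rewrite Rabs_mult.
    assert (h * Rabs d <= 1 * Rabs d).
    { apply Rmult_le_compat_r; [apply Rabs_pos|apply Rmin_l]. }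
    lra. }
  eapply Rle_trans; [apply Rabs_triang|]; rewrite !Rabs_mult.
  apply Rle_trans with (h * ((Rabs v + 1) * Rabs d) + Rabs q * (h * Rabs d)).
  { apply Rplus_le_compat.
    - apply Rmult_le_compat; auto using Rabs_pos.
    - apply Rmult_le_compat_l; auto using Rabs_pos. }
  replace (h * ((Rabs v + 1) * Rabs d) + Rabs q * (h * Rabs d))
    with (h * K * Rabs d) by (unfold K; ring).
  apply Rmult_le_compat_r; [apply Rabs_pos|].
  apply Rle_trans with (e / K * K); [|right; field; lra].
  apply Rmult_le_compat_r; [lra|apply Rmin_r].
Qed.

Lemma locally_list (P : R -> coord -> Prop) (s0 : R) (l : list coord) :
  (forall c, In c l -> locally s0 (fun s => P s c)) ->
  locally s0 (fun s => forall c, In c l -> P s c).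
Proof.
  induction l as [|c l IH]; intros H; [apply filter_forall; easy|].
  refine (filter_imp _ _ _ (filter_and _ _ (H c (or_introl eq_refl)) (IH _))).
  - intros s [H1 H2] d [<-|Hd]; auto.
  - intros d Hd; apply H; right; auto.
Qed.

(** Telescoping the increment of F over [mix] leaves increments in one coordinate each, to which the
    mean value theorem applies; continuity of the partial derivatives moves them to g s0. The curve
    has to be differentiable only in the coordinates of order at most k, since the others are frozen
    at g s0. *)
Lemma chain_rule k U F (g : R -> jet) s0 (v : coord -> R) :
  DF k U F -> locally s0 (fun s => U (g s)) ->
  (forall c, (ord c <= k)%nat -> is_derive (fun s => g s c) s0 (v c)) ->
  is_derive (fun s => F (g s)) s0 (lsum (fun c => v c * pder c F (g s0)) (coords k)).
Proof.
  intros HF HU Hg; set (z := g s0).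
  assert (Hz : U z) by exact (locally_singleton _ _ HU).
  (* The intermediate points of the mean value theorem are no farther from z than g s in each
     coordinate of l and equal z elsewhere, so they enter every neighbourhood of z. *)
  assert (near : forall l (P : jet -> Prop), incl l (coords k) -> jet_locally z P ->
    locally s0 (fun s => forall w, (forall d, In d l -> Rabs (w d - z d) <= Rabs (g s d - z d)) ->
      (forall d, ~ In d l -> w d = z d) -> P w)).
  { intros l P Hl [n [e He]].
    apply (filter_imp (fun s => forall d, In d l -> Rabs (g s d - z d) < e)).
    - intros s Hs w Hw Hw'; apply He; intros d _.
      destruct (in_dec coord_eq_dec d l) as [Hd|Hd].
      + eapply Rle_lt_trans; [apply Hw|apply Hs]; auto.
      + rewrite Hw', Rminus_diag, Rabs_R0; auto; apply cond_pos.
    - apply locally_list; intros c Hc.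
      assert (Hcont : continuous (fun s => g s c) s0).
      { apply (ex_derive_continuous (fun s => g s c)); exists (v c).
        apply Hg, in_coords, Hl, Hc. }
      exact (Hcont _ (locally_ball (g s0 c) e)). }
  assert (main : forall l, NoDup l -> incl l (coords k) ->
    is_derive (fun s => F (mix l (g s) z)) s0 (lsum (fun c => v c * pder c F z) l)).
  { induction l as [|c l IH]; intros HN Hl.
    - apply (is_derive_ext (fun _ => F z)); [|apply (is_derive_const (F z))].
      intros s; f_equal.
    - inversion_clear HN as [|? ? Hc HN'].
      assert (Hl' : incl l (coords k)) by (intros d Hd; apply Hl; right; auto).
      simpl; rewrite Rplus_comm.
      apply (is_derive_ext (fun s => F (mix l (g s) z) +
        (F (upd (mix l (g s) z) c (g s c)) - F (mix l (g s) z)))).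
      { intros s; rewrite mix_cons; simpl; ring. }
      apply (is_derive_plus (fun s => F (mix l (g s) z))); [apply IH; auto|].
      apply (is_derive_increment _ (fun s => g s c)).
      + apply Hg, in_coords, Hl; left; auto.
      + change (g s0) with z; rewrite !mix_self, upd_id; ring.
      + intros e.
        assert (Hloc : jet_locally z (fun w => U w /\ Rabs (pder c F w - pder c F z) < e)).
        { apply jet_locally_and; [apply (DF_open HF); auto|].
          apply jcont_eps; apply (DF_cont (DF_pder HF c)); auto. }
        refine (filter_imp _ _ _ (near (c :: l) _ Hl Hloc)).
        intros s Hs; set (w := mix l (g s) z).
        assert (Hwc : w c = z c) by (apply mix_notin; auto).
        assert (Hin : forall t, Rmin (w c) (g s c) <= t <= Rmax (w c) (g s c) ->
          U (upd w c t) /\ Rabs (pder c F (upd w c t) - pder c F z) < e).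
        { intros t Ht; apply Hs.
          - intros d Hd; destruct (coord_eq_dec d c) as [->|Hdc].
            + rewrite upd_same; rewrite Hwc in Ht.
              revert Ht; unfold Rmin, Rmax, Rabs.
              destruct (Rle_dec (z c) (g s c)), (Rcase_abs (t - z c)), (Rcase_abs (g s c - z c)); lra.
            + destruct Hd as [|Hd]; [congruence|].
              rewrite upd_other by auto; unfold w; rewrite mix_in by auto; apply Rle_refl.
          - intros d Hd; rewrite upd_other by (intros ->; apply Hd; left; auto).
            apply mix_notin; intros H; apply Hd; right; auto. }
        destruct (pder_mvt F w c (g s c)) as [t [Ht E]].
        { intros t Ht; apply (DF_is_pder HF); apply Hin; auto. }
        exists (pder c F (upd w c t)); split.
        * rewrite E, Hwc; reflexivity.
        * apply Rlt_le, Hin; auto. }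
  specialize (main (coords k) (NoDup_coords k) (incl_refl _)).
  refine (is_derive_ext_loc _ _ _ _ _ main).
  refine (filter_imp _ _ _ (filter_and _ _ HU
    (near (coords k) U (incl_refl _) (DF_open HF z Hz)))).
  intros s [H1 H2]; apply (DF_dep HF); auto.
  - apply H2; intros d Hd; [rewrite mix_in by auto; apply Rle_refl|apply mix_notin; auto].
  - intros c Hc; apply mix_in, in_coords, Hc.
Qed.

(** * Calculus of differential functions *)

Lemma is_pder_const c a z : is_pder c (fun _ => a) z 0.
Proof. exact (is_derive_const a (z c)). Qed.

Lemma is_pder_coord c d z : is_pder c (fun w => w d) z (if coord_eq_dec d c then 1 else 0).
Proof.
  unfold is_pder, upd; destruct (coord_eq_dec d c).
  - exact (is_derive_id (z c)).
  - exact (is_derive_const (z d) (z c)).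
Qed.

Lemma is_pder_plus c F G z l l' :
  is_pder c F z l -> is_pder c G z l' -> is_pder c (fun w => F w + G w) z (l + l').
Proof. exact (is_derive_plus _ _ _ l l'). Qed.

Lemma is_pder_minus c F G z l l' :
  is_pder c F z l -> is_pder c G z l' -> is_pder c (fun w => F w - G w) z (l - l').
Proof. exact (is_derive_minus _ _ _ l l'). Qed.

Lemma is_pder_opp c F z l : is_pder c F z l -> is_pder c (fun w => - F w) z (- l).
Proof. exact (is_derive_opp _ _ l). Qed.

Lemma is_pder_mult c F G z l l' :
  is_pder c F z l -> is_pder c G z l' ->
  is_pder c (fun w => F w * G w) z (l * G z + F z * l').
Proof.
  intros H H'; generalize (is_derive_mult _ _ _ l l' H H' Rmult_comm).
  cbn beta; rewrite upd_id; exact (fun h => h).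
Qed.

Lemma is_pder_exp c F z l :
  is_pder c F z l -> is_pder c (fun w => exp (F w)) z (l * exp (F z)).
Proof.
  intros H; refine (is_derive_comp exp _ _ (exp (F z)) l _ H).
  rewrite upd_id; apply is_derive_exp.
Qed.

Lemma is_pder_inv c F z l :
  is_pder c F z l -> F z <> 0 -> is_pder c (fun w => / F w) z (- l / (F z) ^ 2).
Proof.
  intros H H0; generalize (is_derive_inv _ _ l H); rewrite upd_id; intros K; exact (K H0).
Qed.

Lemma is_pder_eq c F z l l' : is_pder c F z l -> l = l' -> is_pder c F z l'.
Proof. intros H <-; exact H. Qed.

Lemma is_pder_open_eq U c F G z l l' :
  jet_open U -> (forall w, U w -> F w = G w) -> U z ->
  is_pder c F z l -> is_pder c G z l' -> l = l'.
Proof.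
  intros HU HE Hz H H'; rewrite <- (is_pder_unique _ _ _ _ H), <- (is_pder_unique _ _ _ _ H').
  apply pder_ext_loc; apply (jet_locally_mono z U); auto.
Qed.

(** Shaped to be stable under partial derivatives: the chain rule turns [sc_comp] into a finite sum
    of products of [sc_base] and [sc_comp] terms, with [sc_zero] for the empty sum. Sums, products
    and composites of differential functions are then smooth at one stroke. *)
Inductive smooth_closure (m : nat) (W : jet -> Prop) : (jet -> R) -> Prop :=
  | sc_base F : DF m W F -> smooth_closure m W F
  | sc_zero : smooth_closure m W (fun _ => 0)
  | sc_plus F G : smooth_closure m W F -> smooth_closure m W G ->
      smooth_closure m W (fun z => F z + G z)
  | sc_mult F G : smooth_closure m W F -> smooth_closure m W G ->
      smooth_closure m W (fun z => F z * G z)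
  | sc_comp k U F (Phi : jet -> jet) :
      DF k U F -> (forall z, W z -> U (Phi z)) ->
      (forall c, (ord c <= k)%nat -> DF m W (fun z => Phi z c)) ->
      smooth_closure m W (fun z => F (Phi z)).

Lemma jcont_comp k U F m W (Phi : jet -> jet) :
  DF k U F -> (forall z, W z -> U (Phi z)) ->
  (forall c, (ord c <= k)%nat -> DF m W (fun z => Phi z c)) -> jet_open W ->
  forall z, W z -> jcont (fun w => F (Phi w)) z.
Proof.
  intros HF HU HPhi HW z Hz; apply jcont_eps; intros e.
  destruct (jet_locally_and (Phi z) _ _ (DF_open HF _ (HU z Hz))
    (proj1 (jcont_eps F (Phi z)) (DF_cont HF _ (HU z Hz)) e)) as [n [d Hd]].
  assert (H : jet_locally z (fun w => forall c, In c (coords k) -> Rabs (Phi w c - Phi z c) < d)).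
  { assert (Hl : forall l, incl l (coords k) ->
      jet_locally z (fun w => forall c, In c l -> Rabs (Phi w c - Phi z c) < d)).
    { induction l as [|c l IH]; intros Hl.
      - apply (jet_locally_mono z (fun _ => True)); [easy|apply jet_locally_true].
      - refine (jet_locally_mono _ _ _ _ (jet_locally_and _ _ _
          (proj1 (jcont_eps _ z) (DF_cont (HPhi c _) z Hz) d) (IH _))).
        + intros w [H1 H2] c' [<-|Hc']; auto.
        + apply in_coords, Hl; left; auto.
        + intros x Hx; apply Hl; right; auto. }
    apply Hl, incl_refl. }
  refine (jet_locally_mono _ _ _ _ (jet_locally_and _ _ _ (HW z Hz) H)).
  intros w [Hw Hc].
  (* The neighbourhood of Phi z may restrict coordinates beyond order k, about which nothing is
     known for Phi; they are frozen at Phi z, which does not change F. *)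
  destruct (Hd (mix (coords k) (Phi w) (Phi z))) as [H1 H2].
  { intros c _; destruct (in_dec coord_eq_dec c (coords k)) as [Hi|Hi].
    - rewrite mix_in; auto.
    - rewrite mix_notin, Rminus_diag, Rabs_R0; auto; apply cond_pos. }
  replace (F (Phi w)) with (F (mix (coords k) (Phi w) (Phi z))); [exact H2|].
  apply (DF_dep HF); auto; intros c Hi; apply mix_in, in_coords, Hi.
Qed.

Lemma is_pder_comp k U F m W (Phi : jet -> jet) c z :
  DF k U F -> (forall z, W z -> U (Phi z)) ->
  (forall c, (ord c <= k)%nat -> DF m W (fun z => Phi z c)) -> jet_open W -> W z ->
  is_pder c (fun w => F (Phi w)) z
    (lsum (fun d => pder c (fun w => Phi w d) z * pder d F (Phi z)) (coords k)).
Proof.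
  intros HF HU HPhi HW Hz.
  generalize (chain_rule k U F (fun s => Phi (upd z c s)) (z c)
    (fun d => pder c (fun w => Phi w d) z) HF); cbn beta; rewrite upd_id; intros H; apply H.
  - refine (filter_imp _ _ _ (upd_locally z c W (HW z Hz))); intros s Hs; auto.
  - intros d Hd; apply (DF_is_pder (HPhi d Hd)); exact Hz.
Qed.

Lemma smooth_closure_dep m W F :
  smooth_closure m W F -> forall z w, W z -> W w ->
  (forall c, (ord c <= m)%nat -> z c = w c) -> F z = F w.
Proof.
  induction 1 as [F HF| |F G _ IHF _ IHG|F G _ IHF _ IHG|k U F Phi HF HU HPhi];
    intros z w Hz Hw H.
  - apply (DF_dep HF); auto.
  - easy.
  - rewrite (IHF z w), (IHG z w); auto.
  - rewrite (IHF z w), (IHG z w); auto.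
  - apply (DF_dep HF); auto; intros c Hc; apply (DF_dep (HPhi c Hc)); auto.
Qed.

Lemma smooth_closure_cont m W F :
  jet_open W -> smooth_closure m W F -> forall z, W z -> jcont F z.
Proof.
  intros HW; induction 1 as [F HF| |F G _ IHF _ IHG|F G _ IHF _ IHG|k U F Phi HF HU HPhi];
    intros z Hz.
  - apply (DF_cont HF); auto.
  - apply jcont_const.
  - apply jcont_plus; auto.
  - apply jcont_mult; auto.
  - apply (jcont_comp k U F m W); auto.
Qed.

Lemma smooth_closure_pder m W F :
  jet_open W -> smooth_closure m W F -> forall c,
  exists G, smooth_closure m W G /\ forall z, W z -> is_pder c F z (G z).
Proof.
  intros HW; induction 1 as [F HF| |F G HF IHF HG IHG|F G HF IHF HG IHG|k U F Phi HF HU HPhi];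
    intros c.
  - exists (pder c F); split; [apply sc_base, DF_pder, HF|]; intros z Hz; apply (DF_is_pder HF); auto.
  - exists (fun _ => 0); split; [apply sc_zero|]; intros; apply is_pder_const.
  - destruct (IHF c) as [F' [HF' HFF']], (IHG c) as [G' [HG' HGG']].
    exists (fun z => F' z + G' z); split; [apply sc_plus; auto|]; intros; apply is_pder_plus; auto.
  - destruct (IHF c) as [F' [HF' HFF']], (IHG c) as [G' [HG' HGG']].
    exists (fun z => F' z * G z + F z * G' z); split.
    + apply sc_plus; apply sc_mult; auto.
    + intros; apply is_pder_mult; auto.
  - exists (fun z => lsum (fun d => pder c (fun w => Phi w d) z * pder d F (Phi z)) (coords k)).
    split.
    + assert (Hl : forall l, incl l (coords k) -> smooth_closure m W
        (fun z => lsum (fun d => pder c (fun w => Phi w d) z * pder d F (Phi z)) l)).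
      { induction l as [|d l IH]; intros Hl; [apply sc_zero|].
        apply (sc_plus m W (fun z => pder c (fun w => Phi w d) z * pder d F (Phi z))).
        - apply sc_mult.
          + apply sc_base, DF_pder, HPhi, in_coords, Hl; left; auto.
          + apply (sc_comp m W k U (pder d F)); auto; apply DF_pder, HF.
        - apply IH; intros x Hx; apply Hl; right; auto. }
      apply Hl, incl_refl.
    + intros z Hz; apply (is_pder_comp k U F m W); auto.
Qed.

Lemma smooth_closure_DF m W F : jet_open W -> smooth_closure m W F -> DF m W F.
Proof.
  intros HW HF; split; [exact HW|split].
  - apply smooth_closure_dep, HF.
  - revert F HF; apply smooth_of_stable_family; auto.
    + intros F HF; apply (smooth_closure_cont m W F); auto.
    + intros F HF; apply (smooth_closure_pder m W F); auto.
Qed.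

Lemma DF_plus m W F G : DF m W F -> DF m W G -> DF m W (fun z => F z + G z).
Proof.
  intros HF HG; apply smooth_closure_DF; [apply (DF_open HF)|].
  apply sc_plus; apply sc_base; auto.
Qed.

Lemma DF_mult m W F G : DF m W F -> DF m W G -> DF m W (fun z => F z * G z).
Proof.
  intros HF HG; apply smooth_closure_DF; [apply (DF_open HF)|].
  apply sc_mult; apply sc_base; auto.
Qed.

Lemma DF_comp m W k U F (Phi : jet -> jet) :
  DF k U F -> jet_open W -> (forall z, W z -> U (Phi z)) ->
  (forall c, (ord c <= k)%nat -> DF m W (fun z => Phi z c)) -> DF m W (fun z => F (Phi z)).
Proof.
  intros HF HW HU HPhi; apply smooth_closure_DF; [exact HW|].
  apply (sc_comp m W k U); auto.
Qed.

Lemma DF_const m W a : jet_open W -> DF m W (fun _ => a).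
Proof.
  intros HW; split; [exact HW|split; [easy|]].
  apply (smooth_of_stable_family W (fun F => exists b, F = fun _ => b)); auto.
  - intros F [b ->] z _; apply jcont_const.
  - intros F [b ->] c; exists (fun _ => 0); split; [eauto|]; intros; apply is_pder_const.
  - eauto.
Qed.

Lemma DF_coord m W c : jet_open W -> (ord c <= m)%nat -> DF m W (fun z => z c).
Proof.
  intros HW Hc; split; [exact HW|split; [auto|]].
  apply (smooth_of_stable_family W
    (fun F => F = (fun z => z c) \/ exists b, F = fun _ => b)); auto.
  - intros F [->|[b ->]] z _; [apply jcont_coord|apply jcont_const].
  - intros F [->|[b ->]] d.
    + exists (fun _ => if coord_eq_dec c d then 1 else 0); split; [eauto|].
      intros; apply is_pder_coord.
    + exists (fun _ => 0); split; [eauto|]; intros; apply is_pder_const.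
Qed.

Lemma DF_opp m W F : DF m W F -> DF m W (fun z => - F z).
Proof.
  intros HF; apply (DF_ext (F := fun z => -1 * F z)); [|intros; ring].
  apply DF_mult; [apply DF_const, (DF_open HF)|auto].
Qed.

Lemma DF_minus m W F G : DF m W F -> DF m W G -> DF m W (fun z => F z - G z).
Proof. intros HF HG; apply (DF_plus m W F); auto; apply DF_opp; auto. Qed.

Lemma DF_exp m W F : DF m W F -> DF m W (fun z => exp (F z)).
Proof.
  intros HF.
  (* The inner map is the jet with all coordinates equal to F z; the slot of t, of order 0, serves
     as the real variable of exp. *)
  apply (DF_comp m W 0 (fun _ => True) (fun z => exp (z (ind vt))) (fun z _ => F z)); auto;
    [|apply (DF_open HF)].
  split; [apply jet_open_true|split].
  - intros z w _ _ H; rewrite (H (ind vt)); auto.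
  - apply (smooth_of_stable_family (fun _ => True)
      (fun F => exists a, F = fun z => a * exp (z (ind vt)))).
    + apply jet_open_true.
    + intros _ [a ->] z _; apply jcont_mult; [apply jcont_const|].
      apply (filterlim_comp _ _ _ (fun z : jet => z (ind vt)) exp _ (locally (z (ind vt)))).
      * apply jcont_coord.
      * apply (ex_derive_continuous exp); eexists; apply is_derive_exp.
    + intros _ [a ->] c.
      exists (fun z => (a * if coord_eq_dec (ind vt) c then 1 else 0) * exp (z (ind vt))).
      split; [eauto|]; intros z _; eapply is_pder_eq.
      * apply (is_pder_mult c (fun _ => a)); [apply is_pder_const|apply is_pder_exp, is_pder_coord].
      * cbv beta; ring.
    + exists 1; extensionality z; ring.
Qed.

Lemma DF_inv m W F : DF m W F -> (forall z, W z -> F z <> 0) -> DF m W (fun z => / F z).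
Proof.
  intros HF H0; set (D := fun z : jet => z (ind vt) <> 0).
  assert (HD : jet_open D).
  { intros z Hz; apply (jcont_coord (ind vt) z (fun x => x <> 0)).
    exists (mkposreal _ (Rabs_pos_lt _ Hz)); intros y Hy ->.
    revert Hy; unfold ball; simpl; unfold AbsRing_ball, abs, minus, plus, opp; simpl.
    rewrite Rplus_0_l, Rabs_Ropp; lra. }
  apply (DF_comp m W 0 D (fun z => / z (ind vt)) (fun z _ => F z)); auto;
    [|apply (DF_open HF)].
  split; [exact HD|split].
  - intros z w _ _ H; rewrite (H (ind vt)); auto.
  (* Multiples of powers of 1/t form a stable family: the derivative of the n-th power is -n times
     the next one. *)
  - apply (smooth_of_stable_family D (fun F => exists a n, F = fun z => a * (/ z (ind vt)) ^ n)).
    + exact HD.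
    + intros _ [a [n ->]] z Hz; apply jcont_mult; [apply jcont_const|].
      induction n as [|n IH]; [apply jcont_const|].
      apply (jcont_mult (fun z => / z (ind vt))); [|exact IH].
      apply (filterlim_comp _ _ _ (fun z : jet => z (ind vt)) Rinv _ (locally (z (ind vt)))).
      * apply jcont_coord.
      * apply (ex_derive_continuous Rinv); eexists; apply is_derive_inv; [apply is_derive_id|exact Hz].
    + intros _ [a [n ->]] c; set (d := if coord_eq_dec (ind vt) c then 1 else 0).
      assert (H : forall n z, D z -> is_pder c (fun z => (/ z (ind vt)) ^ n) z
        (- INR n * d * (/ z (ind vt)) ^ S n)).
      { clear n; induction n as [|n IH]; intros z Hz.
        - eapply is_pder_eq; [apply (is_pder_const c 1)|simpl; ring].
        - eapply is_pder_eq.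
          + apply (is_pder_mult c (fun z => / z (ind vt)) (fun z => (/ z (ind vt)) ^ n)).
            * apply is_pder_inv; [apply is_pder_coord|exact Hz].
            * apply IH; exact Hz.
          + fold d; rewrite S_INR; simpl; field; exact Hz. }
      exists (fun z => (a * - INR n * d) * (/ z (ind vt)) ^ S n); split; [eauto|].
      intros z Hz; eapply is_pder_eq.
      * apply (is_pder_mult c (fun _ => a)); [apply is_pder_const|apply H; exact Hz].
      * cbv beta; ring.
    + exists 1, 1%nat; extensionality z; ring.
Qed.

(** * Functions of two real variables as differential functions *)

Lemma smooth2_partial D f :
  smooth2 D f ->
  smooth2 D (fun a b => Derive (fun s => f s b) a) /\
  smooth2 D (fun a b => Derive (fun s => f a s) b).
Proof.
  intros [HD H]; split; split; auto; intros a b Hab n; apply (H a b Hab (S n)).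
Qed.

Lemma open_locally_2d (D : R * R -> Prop) a b :
  open D -> D (a, b) -> locally_2d (fun u v => D (u, v)) a b.
Proof.
  intros HD H; apply locally_2d_locally.
  refine (filter_imp _ _ _ (HD _ H)); intros [u v]; auto.
Qed.

Lemma open_of_locally_2d (D : R * R -> Prop) :
  (forall a b, D (a, b) -> locally_2d (fun u v => D (u, v)) a b) -> open D.
Proof.
  intros H [a b] Hab; generalize (proj1 (locally_2d_locally _ _ _) (H a b Hab)).
  apply filter_imp; intros [u v]; auto.
Qed.

Lemma smooth2_const D a : open D -> smooth2 D (fun _ _ => a).
Proof.
  intros HD; split; auto; intros x y _ n; revert a; induction n as [|n IH]; intros a.
  - split; [apply continuity_2d_pt_const|exact I].
  - split; [apply continuity_2d_pt_const|]; split; [apply ex_derive_const|].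
    split; [apply ex_derive_const|].
    split; (eapply ex_diff_n_ext_loc; [|apply (IH 0)]);
      apply locally_2d_forall; intros; symmetry; apply Derive_const.
Qed.

Section TwoCoordinates.
Context (c1 c2 : coord) (Hc : c1 <> c2) (D : R * R -> Prop).

Lemma is_pder_two_coords c f z :
  smooth2 D f -> D (z c1, z c2) ->
  is_pder c (fun w => f (w c1) (w c2)) z
    (if coord_eq_dec c1 c then Derive (fun s => f s (z c2)) (z c1)
     else if coord_eq_dec c2 c then Derive (fun s => f (z c1) s) (z c2) else 0).
Proof.
  intros [HD H] Hz; destruct (H _ _ Hz 1%nat) as [_ [H1 [H2 _]]]; unfold is_pder, upd.
  destruct (coord_eq_dec c1 c) as [<-|n1].
  - destruct (coord_eq_dec c2 c1) as [E|_]; [congruence|]; apply Derive_correct; exact H1.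
  - destruct (coord_eq_dec c2 c) as [<-|n2].
    + apply Derive_correct; exact H2.
    + apply (is_derive_const (f (z c1) (z c2))).
Qed.

Lemma jet_open_two_coords : open D -> jet_open (fun z => D (z c1, z c2)).
Proof.
  intros HD z Hz; destruct (open_locally_2d D _ _ HD Hz) as [e He].
  refine (jet_locally_mono _ _ _ _ (jet_locally_finite z [c1; c2] e)).
  intros w Hw; apply He; apply Hw; simpl; auto.
Qed.

Lemma DF_two_coords k f :
  smooth2 D f -> (ord c1 <= k)%nat -> (ord c2 <= k)%nat ->
  DF k (fun z => D (z c1, z c2)) (fun z => f (z c1) (z c2)).
Proof.
  intros Hf Hk1 Hk2; assert (HD := proj1 Hf).
  split; [apply jet_open_two_coords, HD|split].
  - intros z w _ _ H; rewrite (H c1), (H c2); auto.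
  - apply (smooth_of_stable_family _
      (fun F => exists g, smooth2 D g /\ F = fun z => g (z c1) (z c2))).
    + apply jet_open_two_coords, HD.
    + intros _ [g [[_ Hg] ->]] z Hz; apply jcont_eps; intros e.
      destruct (Hg _ _ Hz 0%nat) as [Hcont _]; destruct (Hcont e) as [d Hd].
      refine (jet_locally_mono _ _ _ _ (jet_locally_finite z [c1; c2] d)).
      intros w Hw; apply Hd; apply Hw; simpl; auto.
    + intros _ [g [Hg ->]] c; destruct (smooth2_partial D g Hg) as [H1 H2].
      exists (fun z => if coord_eq_dec c1 c then Derive (fun s => g s (z c2)) (z c1)
        else if coord_eq_dec c2 c then Derive (fun s => g (z c1) s) (z c2) else 0); split.
      * destruct (coord_eq_dec c1 c); [eauto|]; destruct (coord_eq_dec c2 c); [eauto|].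
        exists (fun _ _ => 0); split; auto; apply smooth2_const, HD.
      * intros z Hz; apply is_pder_two_coords; auto.
    + eauto.
Qed.
End TwoCoordinates.

(* Carries two values in the coordinates r^1, r^2, so that a function of two variables becomes a
   differential function of order 0. *)
Definition pair_jet (a b : R) : jet :=
  fun c => if coord_eq_dec c (der r1 0 0) then a
           else if coord_eq_dec c (der r2 0 0) then b else 0.

Lemma DF_comp2 m W D f G H :
  smooth2 D f -> DF m W G -> DF m W H -> (forall z, W z -> D (G z, H z)) ->
  DF m W (fun z => f (G z) (H z)).
Proof.
  intros Hf HG HH HD.
  apply (DF_comp m W 0 _ _ (fun z => pair_jet (G z) (H z))
    (DF_two_coords (der r1 0 0) (der r2 0 0) ltac:(discriminate) D 0 f Hf (le_n 0) (le_n 0))).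
  - apply (DF_open HG).
  - exact HD.
  - intros c _; unfold pair_jet.
    destruct (coord_eq_dec c (der r1 0 0)); [exact HG|].
    destruct (coord_eq_dec c (der r2 0 0)); [exact HH|].
    apply DF_const, (DF_open HG).
Qed.

(** An instance of [chain_rule] along the curve in which G and H occupy the two slots of
    [pair_jet]. *)
Lemma is_pder_comp2 c D f G H z l l' :
  smooth2 D f -> D (G z, H z) -> is_pder c G z l -> is_pder c H z l' ->
  is_pder c (fun w => f (G w) (H w)) z
    (Derive (fun s => f s (H z)) (G z) * l + Derive (fun s => f (G z) s) (H z) * l').
Proof.
  intros Hf HD HG HH.
  set (g := fun s => pair_jet (G (upd z c s)) (H (upd z c s))).
  set (v := pair_jet l l').
  assert (Hgv : forall d, is_derive (fun s => g s d) (z c) (v d)).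
  { intros d; unfold g, v, pair_jet.
    destruct (coord_eq_dec d (der r1 0 0)); [exact HG|].
    destruct (coord_eq_dec d (der r2 0 0)); [exact HH|].
    apply (is_derive_const 0). }
  assert (Hf' := DF_two_coords (der r1 0 0) (der r2 0 0) ltac:(discriminate) D 0 f Hf (le_n 0) (le_n 0)).
  assert (Hgz : g (z c) = pair_jet (G z) (H z)) by (unfold g; rewrite upd_id; auto).
  generalize (chain_rule 0 _ _ g (z c) v Hf'); cbv beta; intros K.
  assert (HP : forall d, pder d (fun w => f (w (der r1 0 0)) (w (der r2 0 0))) (g (z c)) =
     if coord_eq_dec (der r1 0 0) d then Derive (fun s => f s (H z)) (G z)
     else if coord_eq_dec (der r2 0 0) d then Derive (fun s => f (G z) s) (H z) else 0).
  { intros d; apply is_pder_unique; rewrite Hgz.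
    apply (is_pder_two_coords (der r1 0 0) (der r2 0 0) ltac:(discriminate) D d f
      (pair_jet (G z) (H z))); auto. }
  rewrite (lsum_ext _ (fun d => v d * if coord_eq_dec (der r1 0 0) d then Derive (fun s => f s (H z)) (G z)
     else if coord_eq_dec (der r2 0 0) d then Derive (fun s => f (G z) s) (H z) else 0)) in K
    by (intros d _; rewrite HP; auto).
  eapply is_pder_eq; [apply K|].
  - assert (HC : continuous (fun s => g s (der r1 0 0)) (z c)).
    { apply (ex_derive_continuous (fun s => g s (der r1 0 0))); eexists; apply Hgv. }
    assert (HC' : continuous (fun s => g s (der r2 0 0)) (z c)).
    { apply (ex_derive_continuous (fun s => g s (der r2 0 0))); eexists; apply Hgv. }
    assert (HDz : D (g (z c) (der r1 0 0), g (z c) (der r2 0 0))) by (rewrite Hgz; exact HD).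
    destruct (open_locally_2d D _ _ (proj1 Hf) HDz) as [e He].
    assert (N1 : locally (z c) (fun s => Rabs (g s (der r1 0 0) - g (z c) (der r1 0 0)) < e))
      by exact (HC _ (locally_ball (g (z c) (der r1 0 0)) e)).
    assert (N2 : locally (z c) (fun s => Rabs (g s (der r2 0 0) - g (z c) (der r2 0 0)) < e))
      by exact (HC' _ (locally_ball (g (z c) (der r2 0 0)) e)).
    refine (filter_imp _ _ _ (filter_and _ _ N1 N2)).
    intros s [H1 H2]; apply He; assumption.
  - intros d _; apply Hgv.
  - unfold coords, coords_of, lsum; simpl; unfold v, pair_jet; simpl; ring.
Qed.

(** * Restriction to coordinate planes and symmetry of second derivatives *)

Lemma upd_locally_2d z c d (P : jet -> Prop) :
  jet_locally z P -> locally_2d (fun a b => P (upd (upd z c a) d b)) (z c) (z d).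
Proof.
  intros [n [e He]]; exists e; intros a b Ha Hb; apply He; intros x _; unfold upd.
  destruct (coord_eq_dec x d) as [->|]; [exact Hb|].
  destruct (coord_eq_dec x c) as [->|]; [exact Ha|].
  rewrite Rminus_diag, Rabs_R0; apply cond_pos.
Qed.

Lemma pder_upd2_r F z c d a b :
  Derive (fun t => F (upd (upd z c a) d t)) b = pder d F (upd (upd z c a) d b).
Proof.
  unfold pder; rewrite upd_same; apply Derive_ext; intros t; now rewrite upd_upd.
Qed.

Lemma pder_upd2_l F z c d a b :
  c <> d -> Derive (fun t => F (upd (upd z c t) d b)) a = pder c F (upd (upd z c a) d b).
Proof.
  intros H; unfold pder; rewrite upd_other, upd_same by auto; apply Derive_ext; intros t.
  rewrite (upd_comm z c d), (upd_comm z c d), upd_upd by auto; auto.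
Qed.

Lemma ex_derive_upd2_r k U F z c d a b :
  DF k U F -> U (upd (upd z c a) d b) -> ex_derive (fun t => F (upd (upd z c a) d t)) b.
Proof.
  intros HF HU; assert (H := DF_is_pder HF d _ HU); unfold is_pder in H; rewrite upd_same in H.
  eexists; refine (is_derive_ext _ _ _ _ _ H); intros t; cbv beta; now rewrite upd_upd.
Qed.

Lemma ex_derive_upd2_l k U F z c d a b :
  c <> d ->
  DF k U F -> U (upd (upd z c a) d b) -> ex_derive (fun t => F (upd (upd z c t) d b)) a.
Proof.
  intros Hcd HF HU; rewrite upd_comm in HU by auto.
  apply (ex_derive_ext (fun t => F (upd (upd z d b) c t))).
  - intros t; rewrite (upd_comm z c d); auto.
  - apply (ex_derive_upd2_r k U); auto.
Qed.

Lemma continuity_2d_upd2 F z c d :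
  c <> d -> jcont F z -> continuity_2d_pt (fun a b => F (upd (upd z c a) d b)) (z c) (z d).
Proof.
  intros Hcd H e; rewrite (upd_id z c), upd_id.
  apply (upd_locally_2d z c d (fun w => Rabs (F w - F z) < e)), jcont_eps, H.
Qed.

Lemma pder_comm k U F c d z :
  DF k U F -> U z -> pder c (pder d F) z = pder d (pder c F) z.
Proof.
  intros HF Hz; destruct (coord_eq_dec c d) as [->|Hcd]; [easy|].
  generalize (Schwarz (fun a b => F (upd (upd z c a) d b)) (z c) (z d)); cbv beta; intros H.
  assert (E1 : Derive (fun a => Derive (fun b => F (upd (upd z c a) d b)) (z d)) (z c)
    = pder c (pder d F) z).
  { apply Derive_ext; intros a; rewrite pder_upd2_r; f_equal.
    rewrite <- (upd_other z c a d) at 1 by auto; apply upd_id. }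
  assert (E2 : Derive (fun b => Derive (fun a => F (upd (upd z c a) d b)) (z c)) (z d)
    = pder d (pder c F) z).
  { apply Derive_ext; intros b; rewrite pder_upd2_l by auto; f_equal; now rewrite upd_id. }
  rewrite <- E1, <- E2; apply H.
  - generalize (upd_locally_2d z c d U (DF_open HF z Hz)).
    apply locally_2d_impl, locally_2d_forall; intros a b Hab.
    split; [apply (ex_derive_upd2_l k U); auto|].
    split; [apply (ex_derive_upd2_r k U); auto|]; split.
    + apply (ex_derive_ext (fun a => pder d F (upd (upd z c a) d b))).
      * intros t; symmetry; apply pder_upd2_r.
      * apply (ex_derive_upd2_l k U (pder d F)); auto; apply DF_pder, HF.
    + apply (ex_derive_ext (fun b => pder c F (upd (upd z c a) d b))).
      * intros t; symmetry; apply pder_upd2_l; auto.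
      * apply (ex_derive_upd2_r k U (pder c F)); auto; apply DF_pder, HF.
  - apply (continuity_2d_pt_ext (fun a b => pder c (pder d F) (upd (upd z c a) d b))).
    + intros a b; rewrite <- pder_upd2_l by auto; apply Derive_ext; intros t.
      symmetry; apply pder_upd2_r.
    + apply continuity_2d_upd2; auto.
      apply (DF_cont (DF_pder (DF_pder HF d) c) z Hz).
  - apply (continuity_2d_pt_ext (fun a b => pder d (pder c F) (upd (upd z c a) d b))).
    + intros a b; rewrite <- pder_upd2_r by auto; apply Derive_ext; intros t.
      symmetry; apply pder_upd2_l; auto.
    + apply continuity_2d_upd2; auto.
      apply (DF_cont (DF_pder (DF_pder HF c) d) z Hz).
Qed.

(** The passage opposite to [DF_two_coords]. Together the two give [smooth2] the closure properties
    of differential functions; this one also yields smoothness of Omega and of the remaining density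
    and flux as functions of two variables. *)
Lemma smooth2_slice k U F z c d (D : R * R -> Prop) :
  c <> d -> open D -> (forall a b, D (a, b) -> U (upd (upd z c a) d b)) -> DF k U F ->
  smooth2 D (fun a b => F (upd (upd z c a) d b)).
Proof.
  intros Hcd HD HU HF; split; [exact HD|].
  intros a b Hab n; revert F HF; induction n as [|n IH]; intros F HF;
  (assert (HC : continuity_2d_pt (fun a b => F (upd (upd z c a) d b)) a b) by
   (generalize (continuity_2d_upd2 F (upd (upd z c a) d b) c d Hcd (DF_cont HF _ (HU a b Hab)));
    rewrite upd_same, upd_other, upd_same by auto; apply continuity_2d_pt_ext; intros s t;
    f_equal; extensionality x; unfold upd;
    destruct (coord_eq_dec x d), (coord_eq_dec x c); congruence)); (split; [exact HC|]).
  - exact I.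
  - split; [apply (ex_derive_upd2_l k U); auto|].
    split; [apply (ex_derive_upd2_r k U); auto|]; split.
    + apply (ex_diff_n_ext_loc (fun a b => pder c F (upd (upd z c a) d b))).
      * apply locally_2d_forall; intros; symmetry; apply pder_upd2_l; auto.
      * apply IH, DF_pder, HF.
    + apply (ex_diff_n_ext_loc (fun a b => pder d F (upd (upd z c a) d b))).
      * apply locally_2d_forall; intros; symmetry; apply pder_upd2_r; auto.
      * apply IH, DF_pder, HF.
Qed.

(** * Boxes, on which vanishing partial derivatives mean independence *)

Definition box (n : nat) (e : posreal) (z0 z : jet) : Prop :=
  forall c, (ord c <= n)%nat -> Rabs (z c - z0 c) < e.

Lemma box_center n e z : box n e z z.
Proof. intros c _; rewrite Rminus_diag, Rabs_R0; apply cond_pos. Qed.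

Lemma jet_open_box n e z0 : jet_open (box n e z0).
Proof.
  intros z Hz.
  assert (H : forall l, incl l (coords n) ->
    jet_locally z (fun w => forall c, In c l -> Rabs (w c - z0 c) < e)).
  { induction l as [|c l IH]; intros Hl.
    - apply (jet_locally_mono z (fun _ => True)); [easy|apply jet_locally_true].
    - assert (Hc : 0 < e - Rabs (z c - z0 c)).
      { enough (Rabs (z c - z0 c) < e) by lra; apply Hz, in_coords, Hl; left; auto. }
      refine (jet_locally_mono _ _ _ _ (jet_locally_and _ _ _
        (jet_locally_coord z c (mkposreal _ Hc)) (IH _))).
      + simpl; intros w [H1 H2] d [<-|Hd]; auto.
        replace (w c - z0 c) with ((w c - z c) + (z c - z0 c)) by ring.
        eapply Rle_lt_trans; [apply Rabs_triang|lra].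
      + intros d Hd; apply Hl; right; auto. }
  refine (jet_locally_mono _ _ _ _ (H (coords n) (incl_refl _))).
  intros w Hw c Hc; apply Hw, in_coords, Hc.
Qed.

Lemma between_ball x a b t e :
  Rabs (a - x) < e -> Rabs (b - x) < e -> Rmin a b <= t <= Rmax a b -> Rabs (t - x) < e.
Proof.
  intros Ha Hb Ht; apply Rabs_def2 in Ha, Hb; apply Rabs_def1;
    revert Ht; unfold Rmin, Rmax; destruct (Rle_dec a b); lra.
Qed.

Lemma box_upd n e z0 z c s :
  box n e z0 z -> Rabs (s - z0 c) < e -> box n e z0 (upd z c s).
Proof.
  intros Hz Hs d Hd; unfold upd; destruct (coord_eq_dec d c) as [->|]; auto.
Qed.

(** Coordinates are exchanged one at a time through [mix], and every intermediate point stays in the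
    box; in a general open set such a path may leave the domain. [k <= n] makes the box restrict all
    coordinates that F sees. *)
Lemma box_dep k n e z0 F (L : coord -> Prop) :
  DF k (box n e z0) F -> (k <= n)%nat ->
  (forall c z, box n e z0 z -> ~ L c -> pder c F z = 0) ->
  forall z w, box n e z0 z -> box n e z0 w -> (forall c, L c -> z c = w c) -> F z = F w.
Proof.
  intros HF Hkn HL z w Hz Hw Hzw.
  assert (Hmix : forall l, box n e z0 (mix l w z)).
  { intros l c Hc; unfold mix; destruct in_dec; auto. }
  assert (H : forall l, incl l (coords k) -> F (mix l w z) = F z).
  { induction l as [|c l IH]; intros Hl; [f_equal|].
    rewrite mix_cons, <- IH by (intros d Hd; apply Hl; right; auto).
    destruct (classic (L c)) as [Hc|Hc].
    - f_equal; rewrite <- (upd_id (mix l w z) c) at 2; f_equal.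
      unfold mix; destruct in_dec; auto; symmetry; auto.
    - assert (Hoc : (ord c <= n)%nat).
      { apply Nat.le_trans with k; auto; apply in_coords, Hl; left; auto. }
      assert (Ht : forall t, Rmin (mix l w z c) (w c) <= t <= Rmax (mix l w z c) (w c) ->
        box n e z0 (upd (mix l w z) c t)).
      { intros t Ht; apply box_upd; auto.
        refine (between_ball _ _ _ _ _ _ _ Ht); [apply Hmix|apply Hw]; auto. }
      destruct (pder_mvt F (mix l w z) c (w c)) as [t [Htt E]].
      + intros t Htt; apply (DF_is_pder HF); auto.
      + rewrite HL in E by auto; lra. }
  rewrite <- (H (coords k) (incl_refl _)); apply (DF_dep HF); auto.
  intros c Hc; apply mix_in, in_coords, Hc.
Qed.

Lemma box_upd_inv k n e z0 F c :
  DF k (box n e z0) F -> (k <= n)%nat -> (forall z, box n e z0 z -> pder c F z = 0) ->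
  forall z s, box n e z0 z -> box n e z0 (upd z c s) -> F (upd z c s) = F z.
Proof.
  intros HF Hkn H z s Hz Hs.
  apply (box_dep k n e z0 F (fun d => d <> c)); auto.
  - intros d w Hw Hd; replace d with c; auto; apply NNPP; auto.
  - intros d Hd; apply upd_other; auto.
Qed.

(** * The equation manifold *)

(** Cauchy product: the coefficients of the product of two double power series. *)
Definition conv2 (a b : nat -> nat -> R) (m n : nat) : R :=
  sum_f_R0 (fun j => sum_f_R0 (fun l => a j l * b (m - j)%nat (n - l)%nat) n) m.

(** Coefficients of the t-derivative of a double power series; [shift_x] does the same for x. *)
Definition shift_t (a : nat -> nat -> R) (m n : nat) : R := INR (S m) * a (S m) n.
Definition shift_x (a : nat -> nat -> R) (m n : nat) : R := INR (S n) * a m (S n).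

(** Splits n + 1 = l + (n + 1 - l) under the sum. This is the Leibniz rule for one index, from which
    both product rules for [conv2] follow. *)
Lemma sum_leibniz (P : nat -> nat -> R) n :
  INR (S n) * sum_f_R0 (fun l => P l (S n - l)%nat) (S n) =
  sum_f_R0 (fun l => INR (S l) * P (S l) (n - l)%nat) n +
  sum_f_R0 (fun l => INR (S (n - l)) * P l (S (n - l))) n.
Proof.
  rewrite scal_sum.
  rewrite (sum_eq _ (fun l => INR l * P l (S n - l)%nat + INR (S n - l) * P l (S n - l)%nat)).
  2:{ intros l Hl; rewrite minus_INR by auto; ring. }
  rewrite plus_sum; f_equal.
  - rewrite decomp_sum by lia; simpl pred.
    replace (INR 0) with 0 by reflexivity; rewrite Rmult_0_l, Rplus_0_l.
    apply sum_eq; intros l Hl; reflexivity.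
  - rewrite tech5, Nat.sub_diag; replace (INR 0) with 0 by reflexivity.
    rewrite Rmult_0_l, Rplus_0_r; apply sum_eq; intros l Hl.
    now rewrite Nat.sub_succ_l.
Qed.

Lemma shift_t_conv2 a b m n :
  shift_t (conv2 a b) m n = conv2 (shift_t a) b m n + conv2 a (shift_t b) m n.
Proof.
  unfold shift_t, conv2.
  rewrite (sum_leibniz (fun j i => sum_f_R0 (fun l => a j l * b i (n - l)%nat) n)).
  f_equal; apply sum_eq; intros j Hj; rewrite scal_sum; apply sum_eq; intros l Hl; ring.
Qed.

Lemma shift_x_conv2 a b m n :
  shift_x (conv2 a b) m n = conv2 (shift_x a) b m n + conv2 a (shift_x b) m n.
Proof.
  unfold shift_x, conv2; rewrite scal_sum, <- plus_sum; apply sum_eq; intros j Hj.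
  rewrite Rmult_comm, (sum_leibniz (fun l i => a j l * b (m - j)%nat i)).
  f_equal; apply sum_eq; intros l Hl; ring.
Qed.

Lemma conv2_ext a a' b b' m n :
  (forall j l, (j <= m)%nat -> (l <= n)%nat -> a j l = a' j l) ->
  (forall j l, (j <= m)%nat -> (l <= n)%nat -> b j l = b' j l) ->
  conv2 a b m n = conv2 a' b' m n.
Proof.
  intros Ha Hb; apply sum_eq; intros j Hj; apply sum_eq; intros l Hl.
  rewrite Ha, Hb by lia; reflexivity.
Qed.

(* V^i = r^1 + r^2 + [speed_offset i] *)
Definition speed_offset (i : dvar) : R := match i with r1 => 1 | r2 => -1 | r3 => 0 end.

Definition speed_coef (c : dvar -> nat -> nat -> R) (i : dvar) (m n : nat) : R :=
  c r1 m n + c r2 m n + match m, n with O, O => speed_offset i | _, _ => 0 end.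

(** The system r^i_t = - V^i r^i_x coefficient by coefficient; row m + 1 is determined by the rows
    up to m. *)
Definition recursion (c : dvar -> nat -> nat -> R) : Prop :=
  forall i m n, shift_t (c i) m n = - conv2 (speed_coef c i) (shift_x (c i)) m n.

(** The convolution for row [S a'] needs all rows up to [a'], so the recursion carries the table
    built so far. Entries in rows beyond a are meaningless; [ck] reads row m from the table with a =
    m. *)
Fixpoint ck_rows (d : dvar -> nat -> R) (a : nat) : dvar -> nat -> nat -> R :=
  match a with
  | O => fun i _ n => d i n
  | S a' => fun i m n =>
      if (m <=? a')%nat then ck_rows d a' i m n
      else - conv2 (speed_coef (ck_rows d a') i) (shift_x (ck_rows d a' i)) a' n / INR (S a')
  end.

(* Taylor coefficients at t = 0 of the formal solution with initial data of Taylor coefficients d. *)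
Definition ck (d : dvar -> nat -> R) (i : dvar) (m n : nat) : R := ck_rows d m i m n.

Lemma ck_rows_stable d a i m n : (m <= a)%nat -> ck_rows d a i m n = ck d i m n.
Proof.
  induction a as [|a IH]; intros H.
  - now replace m with 0%nat by lia.
  - cbn [ck_rows]; destruct (Nat.leb_spec m a); [auto|].
    assert (m = S a) by lia; subst m; unfold ck; cbn [ck_rows].
    destruct (Nat.leb_spec (S a) a); [lia|reflexivity].
Qed.

Lemma ck_0 d i n : ck d i 0 n = d i n.
Proof. reflexivity. Qed.

Lemma ck_recursion d : recursion (ck d).
Proof.
  intros i m n; unfold shift_t at 1; unfold ck at 1; cbn [ck_rows].
  destruct (Nat.leb_spec (S m) m); [lia|].
  rewrite (conv2_ext _ (speed_coef (ck d) i) _ (shift_x (ck d i))).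
  - field; apply not_0_INR; lia.
  - intros j l Hj Hl; unfold speed_coef; rewrite !ck_rows_stable; auto.
  - intros j l Hj Hl; unfold shift_x; rewrite ck_rows_stable; auto.
Qed.

Lemma ck_S d i m n :
  ck d i (S m) n = - conv2 (speed_coef (ck d) i) (shift_x (ck d i)) m n / INR (S m).
Proof.
  rewrite <- ck_recursion; unfold shift_t; field; apply not_0_INR; lia.
Qed.

Lemma recursion_unique c :
  recursion c -> forall i m n, c i m n = ck (fun i n => c i 0%nat n) i m n.
Proof.
  intros Hc i m; revert i; induction m as [m IH] using (well_founded_induction lt_wf).
  intros i n; destruct m as [|m]; [reflexivity|].
  rewrite ck_S; replace (c i (S m) n) with (shift_t (c i) m n / INR (S m))
    by (unfold shift_t; field; apply not_0_INR; lia).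
  rewrite Hc; do 2 f_equal; apply conv2_ext; intros j l Hj Hl; unfold speed_coef, shift_x.
  - rewrite !(IH j) by lia; reflexivity.
  - rewrite !(IH j) by lia; reflexivity.
Qed.

(** Each t-derivative is traded for at most one x-derivative, so no initial data beyond order m + n
    enter. Hence [proj] does not raise the order. *)
Lemma ck_dep d d' i m n :
  (forall i l, (l <= m + n)%nat -> d i l = d' i l) -> ck d i m n = ck d' i m n.
Proof.
  revert i n; induction m as [m IH] using (well_founded_induction lt_wf).
  intros i n H; destruct m as [|m]; [apply H; auto|].
  rewrite !ck_S; do 2 f_equal; apply conv2_ext; intros j l Hj Hl;
    unfold speed_coef, shift_x.
  - rewrite !(IH j) by (lia || (intros; apply H; lia)); reflexivity.
  - rewrite !(IH j) by (lia || (intros; apply H; lia)); reflexivity.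
Qed.

Definition taylor (z : jet) (i : dvar) (m n : nat) : R :=
  z (der i m n) / (INR (fact m) * INR (fact n)).

Definition initial_data (z : jet) (i : dvar) (n : nat) : R := taylor z i 0 n.

(* The jet with the same t, x and x-derivatives in which the other derivatives are expressed through the equations. *)
Definition proj (z : jet) : jet := fun c =>
  match c with
  | ind v => z (ind v)
  | der i m n => INR (fact m) * INR (fact n) * ck (initial_data z) i m n
  end.

Lemma fact_ne_0 m : INR (fact m) <> 0.
Proof. apply INR_fact_neq_0. Qed.

Lemma proj_x z i n : proj z (der i 0 n) = z (der i 0 n).
Proof.
  unfold proj; rewrite ck_0; unfold initial_data, taylor; simpl; field; apply fact_ne_0.
Qed.

Lemma proj_dep z w :
  (forall v, z (ind v) = w (ind v)) -> forall k,
  (forall i n, (n <= k)%nat -> z (der i 0 n) = w (der i 0 n)) ->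
  forall c, (ord c <= k)%nat -> proj z c = proj w c.
Proof.
  intros Hv k Hx [v|i m n] Hc; simpl; [apply Hv|]; f_equal; apply ck_dep.
  intros j l Hl; unfold initial_data, taylor; rewrite Hx; auto; simpl in Hc; lia.
Qed.

Lemma proj_of_recursion w : recursion (taylor w) -> forall c, w c = proj w c.
Proof.
  intros H [v|i m n]; [reflexivity|]; simpl.
  generalize (recursion_unique _ H i m n); intros E.
  change (fun i n => taylor w i 0 n) with (initial_data w) in E; rewrite <- E.
  unfold taylor; field; split; apply fact_ne_0.
Qed.

Lemma DF_sum m W (f : nat -> jet -> R) n :
  (forall j, (j <= n)%nat -> DF m W (f j)) -> DF m W (fun z => sum_f_R0 (fun j => f j z) n).
Proof.
  induction n as [|n IH]; intros H; [apply (H 0%nat); auto|].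
  apply (DF_plus m W (fun z => sum_f_R0 (fun j => f j z) n)); [apply IH|]; auto.
Qed.

Lemma DF_proj m W c : jet_open W -> (ord c <= m)%nat -> DF m W (fun z => proj z c).
Proof.
  intros HW; destruct c as [v|i a b]; [apply DF_coord; auto|].
  intros H; apply DF_mult; [apply DF_const; auto|].
  assert (K : forall a i b, (a + b <= m)%nat -> DF m W (fun z => ck (initial_data z) i a b)).
  2:{ apply K, H. }
  clear a i b H; induction a as [a IH] using (well_founded_induction lt_wf); intros i b H.
  destruct a as [|a].
  - apply (DF_mult m W (fun z => z (der i 0 b))); [apply DF_coord; auto|apply DF_const; auto].
  - apply (DF_ext (F := fun z => - conv2 (speed_coef (ck (initial_data z)) i)
        (shift_x (ck (initial_data z) i)) a b * / INR (S a))).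
    2:{ intros z _; rewrite ck_S; reflexivity. }
    apply DF_mult; [apply DF_opp|apply DF_const; auto].
    apply DF_sum; intros j Hj; apply DF_sum; intros l Hl; apply DF_mult.
    + unfold speed_coef; apply DF_plus; [apply DF_plus; apply IH; lia|].
      destruct j, l; apply DF_const; auto.
    + unfold shift_x; apply DF_mult; [apply DF_const; auto|apply IH; lia].
Qed.

Lemma is_derive_sum (f : nat -> R -> R) (l : nat -> R) s n :
  (forall j, (j <= n)%nat -> is_derive (f j) s (l j)) ->
  is_derive (fun s => sum_f_R0 (fun j => f j s) n) s (sum_f_R0 l n).
Proof.
  induction n as [|n IH]; intros H; [apply (H 0%nat); auto|].
  apply (is_derive_plus (fun s => sum_f_R0 (fun j => f j s) n)); [apply IH|]; auto.
Qed.

Lemma is_derive_conv2 (a b : R -> nat -> nat -> R) (a' b' : nat -> nat -> R) s m n :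
  (forall j l, (j <= m)%nat -> is_derive (fun s => a s j l) s (a' j l)) ->
  (forall j l, (j <= m)%nat -> is_derive (fun s => b s j l) s (b' j l)) ->
  is_derive (fun s => conv2 (a s) (b s) m n) s (conv2 a' (b s) m n + conv2 (a s) b' m n).
Proof.
  intros Ha Hb; unfold conv2; rewrite <- plus_sum.
  apply is_derive_sum; intros j Hj; rewrite <- plus_sum.
  apply is_derive_sum; intros l Hl.
  apply (is_derive_mult (fun s => a s j l) (fun s => b s (m - j)%nat (n - l)%nat));
    [apply Ha; auto|apply Hb; lia|apply Rmult_comm].
Qed.

(** A straight line with the velocity of D_x at z. It is no integral curve of D_x, but contact of
    first order at s = 0 is all that the chain rule uses. *)
Definition x_line (z : jet) (s : R) : jet := fun c => z c + s * dxc z c.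

Lemma x_line_0 z : x_line z 0 = z.
Proof. extensionality c; unfold x_line; ring. Qed.

Lemma is_derive_x_line z c : is_derive (fun s => x_line z s c) 0 (dxc z c).
Proof. unfold x_line; auto_derive; auto; ring. Qed.

Ltac eqR := match goal with |- @eq _ ?a ?b => change (@eq R a b) end.

(** Along the line the initial data move by [shift_x]. The recursion is built from convolutions and
    x-shifts, and [shift_x] acts on them as a derivation, so every row moves in the same way. This
    is the tangency of D_x to the equation manifold. *)
Lemma is_derive_ck_x_line z i m n :
  is_derive (fun s => ck (initial_data (x_line z s)) i m n) 0 (shift_x (ck (initial_data z) i) m n).
Proof.
  revert i n; induction m as [m IH] using (well_founded_induction lt_wf); intros i n.
  destruct m as [|m].
  - unfold shift_x; rewrite ck_0.
    apply (is_derive_ext (fun s => x_line z s (der i 0 n) * / (INR (fact 0) * INR (fact n)))).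
    { intros s; reflexivity. }
    replace (INR (S n) * initial_data z i (S n))
      with (dxc z (der i 0 n) * / (INR (fact 0) * INR (fact n))).
    + apply (is_derive_ext (fun s => / (INR (fact 0) * INR (fact n)) * x_line z s (der i 0 n))).
      { intros s; apply Rmult_comm. }
      rewrite (Rmult_comm (dxc _ _)); exact (is_derive_scal _ _ _ _ (is_derive_x_line z _)).
    + unfold initial_data, taylor, dxc; rewrite fact_simpl, mult_INR; simpl (fact 0).
      field; split; [apply fact_ne_0|split; [apply not_0_INR; lia|exact R1_neq_R0]].
  - apply (is_derive_ext (fun s => - / INR (S m) *
      (conv2 (speed_coef (ck (initial_data (x_line z s))) i)
        (shift_x (ck (initial_data (x_line z s)) i)) m n))).
    { intros s; rewrite ck_S; eqR; field; apply not_0_INR; lia. }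
    unfold shift_x at 2; rewrite ck_S.
    replace (INR (S n) * (- conv2 (speed_coef (ck (initial_data z)) i)
      (shift_x (ck (initial_data z) i)) m (S n) / INR (S m))) with
      (- / INR (S m) * shift_x (conv2 (speed_coef (ck (initial_data z)) i)
      (shift_x (ck (initial_data z) i))) m n) by (unfold shift_x at 1; field; apply not_0_INR; lia).
    refine (is_derive_scal _ _ _ _ _).
    rewrite shift_x_conv2, <- (x_line_0 z) at 1.
    generalize (is_derive_conv2 (fun s => speed_coef (ck (initial_data (x_line z s))) i)
      (fun s => shift_x (ck (initial_data (x_line z s)) i))
      (shift_x (speed_coef (ck (initial_data z)) i))
      (shift_x (shift_x (ck (initial_data z) i))) 0 m n); rewrite x_line_0.
    intros K; apply K.
    + intros j l Hj; unfold speed_coef, shift_x.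
      replace (INR (S l) * (ck (initial_data z) r1 j (S l) + ck (initial_data z) r2 j (S l) +
        match j, S l with O, O => speed_offset i | _, _ => 0 end)) with
        (INR (S l) * ck (initial_data z) r1 j (S l) + INR (S l) * ck (initial_data z) r2 j (S l) + 0)
        by (destruct j; ring).
      apply (is_derive_plus (fun s => ck (initial_data (x_line z s)) r1 j l +
        ck (initial_data (x_line z s)) r2 j l)).
      * apply (is_derive_plus (fun s => ck (initial_data (x_line z s)) r1 j l)); apply IH; lia.
      * apply (is_derive_const (match j, l with O, O => speed_offset i | _, _ => 0 end)).
    + intros j l Hj; unfold shift_x.
      apply (is_derive_scal (fun s => ck (initial_data (x_line z s)) i j (S l))); apply IH; lia.
Qed.

Lemma is_derive_proj_x_line z c :
  is_derive (fun s => proj (x_line z s) c) 0 (dxc (proj z) c).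
Proof.
  destruct c as [v|i m n].
  - replace (dxc (proj z) (ind v)) with (dxc z (ind v)) by (destruct v; reflexivity).
    apply (is_derive_x_line z (ind v)).
  - replace (dxc (proj z) (der i m n)) with
      (INR (fact m) * INR (fact n) * shift_x (ck (initial_data z) i) m n).
    + apply (is_derive_scal (fun s => ck (initial_data (x_line z s)) i m n)); apply is_derive_ck_x_line.
    + change (dxc (proj z) (der i m n)) with (proj z (der i m (S n))); unfold proj, shift_x; rewrite fact_simpl, mult_INR; ring.
Qed.

Lemma curve_locally (g : R -> jet) s0 W :
  jet_open W -> W (g s0) -> (forall c, continuous (fun s => g s c) s0) ->
  locally s0 (fun s => W (g s)).
Proof.
  intros HW H Hg; destruct (HW _ H) as [n [e He]].
  refine (filter_imp _ _ _ (locally_list (fun s c => Rabs (g s c - g s0 c) < e) s0 (coords n) _)).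
  - intros s Hs; apply He; intros c Hc; apply Hs, in_coords, Hc.
  - intros c _; exact (Hg c _ (locally_ball (g s0 c) e)).
Qed.

(** Both sides are the derivative at 0 of s -> F (proj (x_line z s)): once the chain rule is applied
    to the composite along the line, once to F along the projected line. *)
Lemma Dx_proj k U W F z :
  DF k U F -> jet_open W -> (forall z, W z -> U (proj z)) -> W z ->
  Dx k (fun w => F (proj w)) z = Dx k F (proj z).
Proof.
  intros HF HW HU Hz; rewrite !Dx_lsum.
  assert (HFp : DF k W (fun w => F (proj w))).
  { apply (DF_comp k W k U); auto; intros c Hc; apply DF_proj; auto. }
  assert (HWl : locally 0 (fun s => W (x_line z s))).
  { apply curve_locally; auto; [rewrite x_line_0; auto|].
    intros c; apply (ex_derive_continuous (fun s => x_line z s c)).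
    eexists; apply is_derive_x_line. }
  assert (H1 := chain_rule k W _ (x_line z) 0 (dxc z) HFp HWl (fun c _ => is_derive_x_line z c)).
  assert (H2 := chain_rule k U F (fun s => proj (x_line z s)) 0 (dxc (proj z)) HF
    (filter_imp _ _ (fun s => HU _) HWl) (fun c _ => is_derive_proj_x_line z c)).
  cbv beta in H1, H2; rewrite x_line_0 in H1, H2.
  rewrite <- (is_derive_unique _ _ _ H1); apply is_derive_unique; exact H2.
Qed.

(** * Jets of solutions *)

Lemma smooth2_mult D f g : smooth2 D f -> smooth2 D g -> smooth2 D (fun a b => f a b * g a b).
Proof.
  intros Hf Hg; assert (Hne : der r1 0 0 <> der r2 0 0) by discriminate.
  exact (smooth2_slice 0 _ _ (fun _ => 0) _ _ D Hne (proj1 Hf) (fun _ _ H => H)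
    (DF_mult _ _ _ _ (DF_two_coords _ _ Hne D 0 f Hf (le_n 0) (le_n 0))
      (DF_two_coords _ _ Hne D 0 g Hg (le_n 0) (le_n 0)))).
Qed.

Lemma smooth2_plus D f g : smooth2 D f -> smooth2 D g -> smooth2 D (fun a b => f a b + g a b).
Proof.
  intros Hf Hg; assert (Hne : der r1 0 0 <> der r2 0 0) by discriminate.
  exact (smooth2_slice 0 _ _ (fun _ => 0) _ _ D Hne (proj1 Hf) (fun _ _ H => H)
    (DF_plus _ _ _ _ (DF_two_coords _ _ Hne D 0 f Hf (le_n 0) (le_n 0))
      (DF_two_coords _ _ Hne D 0 g Hg (le_n 0) (le_n 0)))).
Qed.

Lemma smooth2_ex_derive D f a b :
  smooth2 D f -> D (a, b) ->
  ex_derive (fun s => f s b) a /\ ex_derive (fun s => f a s) b.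
Proof. intros [_ H] Hab; destruct (H a b Hab 1%nat) as [_ [H1 [H2 _]]]; auto. Qed.

Definition d_t (f : R -> R -> R) (t x : R) : R := Derive (fun s => f s x) t.
Definition d_x (f : R -> R -> R) (t x : R) : R := Derive (fun s => f t s) x.

Definition taylor2 (f : R -> R -> R) (t x : R) (m n : nat) : R :=
  partial_derive m n f t x / (INR (fact m) * INR (fact n)).

Lemma partial_derive_d_x m n f t x :
  partial_derive m n (d_x f) t x = partial_derive m (S n) f t x.
Proof.
  transitivity (partial_derive m n (partial_derive 0 1 f) t x); [reflexivity|].
  rewrite partial_derive_add_zero by auto; f_equal; lia.
Qed.

Lemma locally_of_2d (P : R -> R -> Prop) t x :
  locally_2d P t x -> locally t (fun s => P s x).
Proof.
  intros [e He]; exists e; intros s Hs; apply He; [exact Hs|].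
  rewrite Rminus_diag, Rabs_R0; apply cond_pos.
Qed.

(** [partial_derive] takes the x-derivatives first, so an inner t-derivative has to be moved past
    them, which uses smoothness near the point; for [d_x] no exchange occurs. *)
Lemma partial_derive_d_t D m n f t x :
  smooth2 D f -> D (t, x) ->
  partial_derive m n (d_t f) t x = partial_derive (S m) n f t x.
Proof.
  intros [HD Hf] Htx; unfold partial_derive.
  rewrite <- (Nat.add_1_r m), <- Derive_n_comp; apply Derive_n_ext_loc.
  generalize (locally_of_2d _ _ _ (open_locally_2d D t x HD Htx)); apply filter_imp.
  intros s Hs; symmetry.
  apply (Derive_partial_derive_aux1 n f s x).
  generalize (open_locally_2d D s x HD Hs).
  apply locally_2d_impl, locally_2d_forall; auto.
Qed.

Lemma taylor2_d_x f t x m n : taylor2 (d_x f) t x m n = shift_x (taylor2 f t x) m n.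
Proof.
  unfold taylor2, shift_x; rewrite partial_derive_d_x, fact_simpl, mult_INR.
  field; repeat split; try apply fact_ne_0; apply not_0_INR; lia.
Qed.

Lemma taylor2_d_t D f t x m n :
  smooth2 D f -> D (t, x) -> taylor2 (d_t f) t x m n = shift_t (taylor2 f t x) m n.
Proof.
  intros Hf H; unfold taylor2, shift_t; rewrite (partial_derive_d_t D), fact_simpl, mult_INR; auto.
  field; repeat split; try apply fact_ne_0; apply not_0_INR; lia.
Qed.

Lemma taylor2_ext D f g t x m n :
  open D -> (forall a b, D (a, b) -> f a b = g a b) -> D (t, x) ->
  taylor2 f t x m n = taylor2 g t x m n.
Proof.
  intros HD H Htx; unfold taylor2; f_equal; apply partial_derive_ext_loc.
  generalize (open_locally_2d D t x HD Htx).
  apply locally_2d_impl, locally_2d_forall; auto.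
Qed.

Lemma taylor2_opp f t x m n : taylor2 (fun a b => - f a b) t x m n = - taylor2 f t x m n.
Proof.
  unfold taylor2, partial_derive.
  rewrite (Derive_n_ext _ (fun a => - Derive_n (fun b => f a b) n x))
    by (intros; apply Derive_n_opp).
  rewrite Derive_n_opp; field; split; apply fact_ne_0.
Qed.

Lemma taylor2_plus D f g t x m n :
  smooth2 D f -> smooth2 D g -> D (t, x) ->
  taylor2 (fun a b => f a b + g a b) t x m n = taylor2 f t x m n + taylor2 g t x m n.
Proof.
  intros Hf Hg H; revert f g Hf Hg n; induction m as [|m IH]; intros f g Hf Hg n.
  - revert f g Hf Hg; induction n as [|n IH]; intros f g Hf Hg.
    + unfold taylor2, partial_derive; simpl; field.
    + assert (E : forall h, taylor2 h t x 0 (S n) = taylor2 (d_x h) t x 0 n / INR (S n)).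
      { intros h; rewrite taylor2_d_x; unfold shift_x; field; apply not_0_INR; lia. }
      rewrite !E, (taylor2_ext D _ (fun a b => d_x f a b + d_x g a b)), IH; auto.
      * field; apply not_0_INR; lia.
      * apply (smooth2_partial D f Hf).
      * apply (smooth2_partial D g Hg).
      * apply Hf.
      * intros a b Hab; apply (Derive_plus (fun s => f a s) (fun s => g a s));
          [exact (proj2 (smooth2_ex_derive D f a b Hf Hab))|exact (proj2 (smooth2_ex_derive D g a b Hg Hab))].
  - assert (E : forall h, smooth2 D h -> taylor2 h t x (S m) n = taylor2 (d_t h) t x m n / INR (S m)).
    { intros h Hh; rewrite (taylor2_d_t D) by auto; unfold shift_t; field; apply not_0_INR; lia. }
    rewrite !E, (taylor2_ext D _ (fun a b => d_t f a b + d_t g a b)), IH; auto.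
    + field; apply not_0_INR; lia.
    + apply (smooth2_partial D f Hf).
    + apply (smooth2_partial D g Hg).
    + apply Hf.
    + intros a b Hab; apply (Derive_plus (fun s => f s b) (fun s => g s b));
          [exact (proj1 (smooth2_ex_derive D f a b Hf Hab))|exact (proj1 (smooth2_ex_derive D g a b Hg Hab))].
    + apply smooth2_plus; auto.
Qed.

Lemma taylor2_mult D f g t x m n :
  smooth2 D f -> smooth2 D g -> D (t, x) ->
  taylor2 (fun a b => f a b * g a b) t x m n = conv2 (taylor2 f t x) (taylor2 g t x) m n.
Proof.
  intros Hf Hg H; revert f g Hf Hg n; induction m as [|m IH]; intros f g Hf Hg n.
  - revert f g Hf Hg; induction n as [|n IH]; intros f g Hf Hg.
    + unfold taylor2, partial_derive, conv2; simpl; field.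
    + assert (E : taylor2 (fun a b => f a b * g a b) t x 0 (S n) =
        taylor2 (fun a b => d_x f a b * g a b + f a b * d_x g a b) t x 0 n / INR (S n)).
      { rewrite <- (taylor2_ext D (d_x (fun a b => f a b * g a b))
          (fun a b => d_x f a b * g a b + f a b * d_x g a b)).
        - rewrite taylor2_d_x; unfold shift_x; field; apply not_0_INR; lia.
        - apply Hf.
        - intros a b Hab; apply (Derive_mult (fun s => f a s) (fun s => g a s));
          [exact (proj2 (smooth2_ex_derive D f a b Hf Hab))|exact (proj2 (smooth2_ex_derive D g a b Hg Hab))].
        - auto. }
      assert (Hfx : smooth2 D (d_x f)) by apply (smooth2_partial D f Hf).
      assert (Hgx : smooth2 D (d_x g)) by apply (smooth2_partial D g Hg).
      rewrite E, (taylor2_plus D), !IH by (auto using smooth2_mult).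
      rewrite (conv2_ext (taylor2 (d_x f) t x) (shift_x (taylor2 f t x)) _ (taylor2 g t x))
        by (intros; solve [reflexivity|apply taylor2_d_x]).
      rewrite (conv2_ext (taylor2 f t x) (taylor2 f t x) _ (shift_x (taylor2 g t x)))
        by (intros; solve [reflexivity|apply taylor2_d_x]).
      rewrite <- shift_x_conv2; unfold shift_x; field; apply not_0_INR; lia.
  - assert (E : taylor2 (fun a b => f a b * g a b) t x (S m) n =
        taylor2 (fun a b => d_t f a b * g a b + f a b * d_t g a b) t x m n / INR (S m)).
    { rewrite <- (taylor2_ext D (d_t (fun a b => f a b * g a b))
        (fun a b => d_t f a b * g a b + f a b * d_t g a b)).
      - rewrite (taylor2_d_t D) by (auto using smooth2_mult).
        unfold shift_t; field; apply not_0_INR; lia.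
      - apply Hf.
      - intros a b Hab; apply (Derive_mult (fun s => f s b) (fun s => g s b));
          [exact (proj1 (smooth2_ex_derive D f a b Hf Hab))|exact (proj1 (smooth2_ex_derive D g a b Hg Hab))].
      - auto. }
    assert (Hft : smooth2 D (d_t f)) by apply (smooth2_partial D f Hf).
    assert (Hgt : smooth2 D (d_t g)) by apply (smooth2_partial D g Hg).
    rewrite E, (taylor2_plus D), !IH by (auto using smooth2_mult).
    rewrite (conv2_ext (taylor2 (d_t f) t x) (shift_t (taylor2 f t x)) _ (taylor2 g t x))
      by (intros; solve [reflexivity|apply (taylor2_d_t D); auto]).
    rewrite (conv2_ext (taylor2 f t x) (taylor2 f t x) _ (shift_t (taylor2 g t x)))
      by (intros; solve [reflexivity|apply (taylor2_d_t D); auto]).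
    rewrite <- shift_t_conv2; unfold shift_t; field; apply not_0_INR; lia.
Qed.

Lemma taylor2_const a t x m n :
  taylor2 (fun _ _ => a) t x m n = match m, n with O, O => a | _, _ => 0 end.
Proof.
  unfold taylor2, partial_derive; destruct n as [|n].
  - destruct m as [|m]; simpl Derive_n at 2; [simpl; field|].
    rewrite Derive_n_const; unfold Rdiv; ring.
  - rewrite (Derive_n_ext _ (fun _ => 0)) by (intros; apply Derive_n_const).
    destruct m; [simpl|rewrite Derive_n_const]; unfold Rdiv; ring.
Qed.

(** The Taylor coefficients of a solution satisfy [recursion], the product V^i r^i_x becoming a
    convolution, and the recursion has a single solution for given initial data. *)
Lemma prolong_proj O f t x :
  is_solution O f -> O (t, x) -> forall c, prolong f t x c = proj (prolong f t x) c.
Proof.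
  intros Hs HO; apply proj_of_recursion; intros i m n.
  assert (Hf : forall i, smooth2 O (f i)) by (intros j; apply Hs).
  assert (Hopen : open O) by apply (Hf r1).
  change (taylor (prolong f t x)) with (fun i => taylor2 (f i) t x); cbv beta.
  rewrite <- (taylor2_d_t O) by auto.
  set (v := fun a b => (f r1 a b + f r2 a b) + speed_offset i).
  assert (Hv : smooth2 O v).
  { apply smooth2_plus; [apply smooth2_plus; auto|apply smooth2_const; auto]. }
  assert (Hfx : smooth2 O (d_x (f i))) by apply (smooth2_partial O _ (Hf i)).
  rewrite (taylor2_ext O _ (fun a b => - (v a b * d_x (f i) a b))); auto.
  2:{ intros a b Hab; destruct (Hs i) as [_ E]; specialize (E a b Hab).
      apply Rminus_diag_uniq; rewrite <- E.
      destruct i; unfold v, u, ut, ux, V, u, d_t, d_x, prolong, partial_derive; simpl; ring. }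
  rewrite taylor2_opp, (taylor2_mult O) by auto; f_equal; apply conv2_ext; intros j l _ _.
  - unfold v; rewrite (taylor2_plus O (fun a b => f r1 a b + f r2 a b)), (taylor2_plus O (f r1))
      by (auto using smooth2_plus, smooth2_const).
    rewrite taylor2_const; reflexivity.
  - apply taylor2_d_x.
Qed.

(** * Majorants for the formal solution *)

(** With this decay a series reproduces itself under multiplication up to a constant, which is the
    content of [conv_weight]. *)
Definition weight (N : nat) : R := / (INR N + 1) ^ 2.

Lemma INR_pos1 N : 0 < INR N + 1.
Proof. generalize (pos_INR N); lra. Qed.

Lemma sum_weight N : sum_f_R0 weight N <= 2 - / (INR N + 1).
Proof.
  induction N as [|N IH]; [unfold weight; simpl; lra|].
  rewrite tech5; unfold weight at 2; rewrite S_INR.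
  apply Rle_trans with (2 - / (INR N + 1) + / (INR N + 1 + 1) ^ 2).
  { apply Rplus_le_compat_r, IH. }
  assert (H := INR_pos1 N); set (x := INR N + 1) in *.
  assert (E : 2 - / (x + 1) - (2 - / x + / (x + 1) ^ 2) = / (x * (x + 1) ^ 2)) by (field; lra).
  assert (0 < / (x * (x + 1) ^ 2)).
  { apply Rinv_0_lt_compat, Rmult_lt_0_compat; [lra|apply pow_lt; lra]. }
  lra.
Qed.

Lemma sum_rev (g : nat -> R) n : sum_f_R0 (fun l => g (n - l)%nat) n = sum_f_R0 g n.
Proof.
  induction n as [|n IH]; [reflexivity|].
  rewrite decomp_sum by lia; simpl pred; rewrite tech5, <- IH, Nat.sub_0_r, Rplus_comm.
  f_equal.
Qed.

(** With p = 1/(l + 1) and q = 1/(N - l + 2) one has p + q = (N + 3) p q, so p^2 q^2 is at most 2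
    (p^2 + q^2) / (N + 2)^2. The factor N - l + 1 is bounded by N + 1, and each of the two remaining
    sums of weights by 2, whence 8 = 2 (2 + 2). *)
Lemma conv_weight N :
  sum_f_R0 (fun l => weight l * (INR (S (N - l)) * weight (S (N - l)))) N
  <= 8 * (INR (S N) * weight (S N)).
Proof.
  apply Rle_trans with (sum_f_R0 (fun l => (weight l + weight (N - l)) *
    (2 * INR (S N) * weight (S N))) N).
  - apply sum_Rle; intros l Hl; unfold weight; rewrite !S_INR, minus_INR by auto.
    assert (Hl' := le_INR _ _ Hl); assert (H0 := pos_INR l).
    set (a := INR l) in *; set (n := INR N) in *.
    assert (Ha : 0 < a + 1) by lra; assert (Hb : 0 < n - a + 1 + 1) by lra.
    assert (Hc : 0 < n - a + 1) by lra; assert (Hn : 0 < n + 1 + 1) by lra.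
    assert (I1 : 0 < / (a + 1)) by (apply Rinv_0_lt_compat; lra).
    assert (I2 : 0 < / (n - a + 1 + 1)) by (apply Rinv_0_lt_compat; lra).
    assert (I3 : 0 < / (n + 1 + 1)) by (apply Rinv_0_lt_compat; lra).
    assert (I4 : / (n - a + 1 + 1) <= / (n - a + 1)) by (apply Rinv_le_contravar; lra).
    rewrite <- !pow_inv.
    set (p := / (a + 1)) in *; set (q := / (n - a + 1 + 1)) in *;
    set (r := / (n + 1 + 1)) in *; set (s := / (n - a + 1)) in *.
    assert (E : p * q <= r * (p + q)).
    { apply Rle_trans with (/ (n + 1 + 1 + 1) * (p + q)).
      - right; unfold p, q; field; lra.
      - apply Rmult_le_compat_r; [lra|unfold r; apply Rinv_le_contravar; lra]. }
    assert (Hpq : 0 < p * q) by (apply Rmult_lt_0_compat; auto).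
    assert (E2 : (p * q) ^ 2 <= (r * (p + q)) ^ 2) by (apply pow_incr; lra).
    assert (E3 : (p + q) ^ 2 <= 2 * (p ^ 2 + s ^ 2)).
    { assert (q ^ 2 <= s ^ 2) by (apply pow_incr; lra).
      generalize (pow2_ge_0 (p - q)); nra. }
    assert (E4 : (p * q) ^ 2 <= r ^ 2 * (2 * (p ^ 2 + s ^ 2))).
    { eapply Rle_trans; [exact E2|]; rewrite Rpow_mult_distr.
      apply Rmult_le_compat_l; [apply pow2_ge_0|exact E3]. }
    replace (p ^ 2 * ((n - a + 1) * q ^ 2)) with ((n - a + 1) * (p * q) ^ 2) by ring.
    apply Rle_trans with ((n + 1) * (r ^ 2 * (2 * (p ^ 2 + s ^ 2)))).
    + apply Rmult_le_compat; [lra|apply pow2_ge_0|lra|exact E4].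
    + right; ring.
  - rewrite <- scal_sum, plus_sum, (sum_rev weight).
    assert (H := sum_weight N); assert (H1 := INR_pos1 N).
    assert (0 < / (INR N + 1)) by (apply Rinv_0_lt_compat; auto).
    assert (0 <= INR (S N) * weight (S N)).
    { apply Rmult_le_pos; [apply pos_INR|]; unfold weight; left.
      apply Rinv_0_lt_compat, pow_lt, INR_pos1. }
    nra.
Qed.

(* Taylor coefficients of G(lam t + x), where G has Taylor coefficients [G N]. *)
Definition spread (lam : R) (G : nat -> R) (m n : nat) : R :=
  lam ^ m * (INR (fact (m + n)) / (INR (fact m) * INR (fact n))) * G (m + n)%nat.

Definition dcoef (G : nat -> R) (n : nat) : R := INR (S n) * G (S n).
Definition conv1 (G H : nat -> R) (n : nat) : R := sum_f_R0 (fun l => G l * H (n - l)%nat) n.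

Lemma dcoef_conv1 G H n : dcoef (conv1 G H) n = conv1 (dcoef G) H n + conv1 G (dcoef H) n.
Proof.
  unfold dcoef, conv1; rewrite (sum_leibniz (fun l i => G l * H i)).
  f_equal; apply sum_eq; intros; ring.
Qed.

Lemma shift_x_spread lam G m n : shift_x (spread lam G) m n = spread lam (dcoef G) m n.
Proof.
  unfold shift_x, spread, dcoef; rewrite Nat.add_succ_r, !fact_simpl, !mult_INR.
  field; repeat split; try apply fact_ne_0; apply not_0_INR; lia.
Qed.

Lemma shift_t_spread lam G m n : shift_t (spread lam G) m n = lam * spread lam (dcoef G) m n.
Proof.
  unfold shift_t, spread, dcoef; rewrite Nat.add_succ_l, !fact_simpl, !mult_INR; simpl pow.
  field; repeat split; try apply fact_ne_0; apply not_0_INR; lia.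
Qed.

Lemma conv2_scal_l c a b m n : conv2 (fun j l => c * a j l) b m n = c * conv2 a b m n.
Proof.
  unfold conv2; rewrite scal_sum; apply sum_eq; intros j _.
  rewrite (Rmult_comm _ c), scal_sum; apply sum_eq; intros l _; ring.
Qed.

Lemma conv2_scal_r c a b m n : conv2 a (fun j l => c * b j l) m n = c * conv2 a b m n.
Proof.
  unfold conv2; rewrite scal_sum; apply sum_eq; intros j _.
  rewrite (Rmult_comm _ c), scal_sum; apply sum_eq; intros l _; ring.
Qed.

(** Both factors are functions of the same variable lam t + x, so their product is (G H)(lam t +
    x). *)
Lemma conv2_spread lam G H m n :
  conv2 (spread lam G) (spread lam H) m n = spread lam (conv1 G H) m n.
Proof.
  revert G H n; induction m as [|m IH]; intros G H n.
  - unfold conv2, spread, conv1; cbn [sum_f_R0 Nat.sub]; rewrite !Nat.add_0_l.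
    rewrite scal_sum; apply sum_eq; intros l Hl; rewrite !Nat.add_0_l; simpl; field.
    repeat split; apply fact_ne_0.
  - assert (E : forall a, a (S m) n = shift_t a m n / INR (S m)).
    { intros a; unfold shift_t; field; apply not_0_INR; lia. }
    rewrite !E; f_equal; rewrite shift_t_conv2, shift_t_spread.
    rewrite (conv2_ext (shift_t (spread lam G)) (fun j l => lam * spread lam (dcoef G) j l)
      (spread lam H) (spread lam H))
      by (intros; solve [reflexivity|apply shift_t_spread]).
    rewrite (conv2_ext (spread lam G) (spread lam G) (shift_t (spread lam H))
      (fun j l => lam * spread lam (dcoef H) j l))
      by (intros; solve [reflexivity|apply shift_t_spread]).
    rewrite conv2_scal_l, conv2_scal_r, !IH; unfold spread; rewrite dcoef_conv1; ring.
Qed.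

Lemma conv2_le a a' b b' m n :
  (forall j l, (j <= m)%nat -> Rabs (a j l) <= a' j l) ->
  (forall j l, (j <= m)%nat -> Rabs (b j l) <= b' j l) ->
  Rabs (conv2 a b m n) <= conv2 a' b' m n.
Proof.
  intros Ha Hb; eapply Rle_trans; [apply Rsum_abs|]; apply sum_Rle; intros j Hj.
  eapply Rle_trans; [apply Rsum_abs|]; apply sum_Rle; intros l Hl.
  rewrite Rabs_mult; apply Rmult_le_compat; try apply Rabs_pos; auto; apply Hb; lia.
Qed.

Lemma spread_le lam G H m n :
  0 <= lam -> G (m + n)%nat <= H (m + n)%nat -> spread lam G m n <= spread lam H m n.
Proof.
  intros Hl HGH; apply Rmult_le_compat_l; [|exact HGH].
  apply Rmult_le_pos; [apply pow_le; auto|].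
  left; apply Rdiv_lt_0_compat; [|apply Rmult_lt_0_compat]; apply INR_fact_lt_0.
Qed.

(** Let R = G(lam t + x), so that R_t = lam R_x. Each of the three terms of V^i is dominated by R,
    the constant one because A is at least 1; thus V^i r^i_x is dominated by 3 R R_x. By
    [conv_weight], G G' is at most 8 A G' coefficientwise, so lam = 24 A closes the induction on
    rows. *)
Lemma ck_majorant d A :
  1 <= A -> (forall i n, Rabs (d i n) <= A * weight n) ->
  forall m i n, Rabs (ck d i m n) <= spread (24 * A) (fun N => A * weight N) m n.
Proof.
  intros HA Hd; set (G := fun N => A * weight N); set (lam := 24 * A).
  assert (Hlam : 0 < lam) by (unfold lam; lra).
  assert (Hw : forall N, 0 < weight N).
  { intros N; apply Rinv_0_lt_compat, pow_lt, INR_pos1. }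
  induction m as [m IH] using (well_founded_induction lt_wf); intros i n.
  destruct m as [|m].
  { rewrite ck_0; unfold spread; simpl.
    replace (1 * (INR (fact n) / (1 * INR (fact n))) * G n) with (A * weight n)
      by (unfold G; field; apply fact_ne_0); apply Hd. }
  rewrite ck_S; unfold Rdiv; rewrite Rabs_mult, Rabs_Ropp, Rabs_inv.
  assert (Hm : 0 < INR (S m)) by (apply lt_0_INR; lia).
  rewrite (Rabs_pos_eq (INR (S m))) by lra.
  apply Rmult_le_reg_r with (INR (S m)); [auto|].
  rewrite Rmult_assoc, Rinv_l, Rmult_1_r by lra.
  rewrite (Rmult_comm _ (INR _)); change (INR (S m) * spread lam G (S m) n)
    with (shift_t (spread lam G) m n); rewrite shift_t_spread.
  assert (Hpos : forall j l, 0 <= spread lam G j l).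
  { intros j l; apply Rmult_le_pos; [|left; apply Rmult_lt_0_compat; [lra|auto]].
    apply Rmult_le_pos; [apply pow_le; lra|].
    left; apply Rdiv_lt_0_compat; [|apply Rmult_lt_0_compat]; apply INR_fact_lt_0. }
  apply Rle_trans with (conv2 (fun j l => 3 * spread lam G j l) (shift_x (spread lam G)) m n).
  { apply conv2_le; intros j l Hj.
    - unfold speed_coef.
      assert (H1 := IH j ltac:(lia) r1 l); assert (H2 := IH j ltac:(lia) r2 l).
      assert (H3 : Rabs (match j, l with O, O => speed_offset i | _, _ => 0 end) <= spread lam G j l).
      { destruct j, l; try (rewrite Rabs_R0; apply Hpos).
        unfold spread, G, weight; simpl.
        replace (1 * (1 / (1 * 1)) * (A * / ((0 + 1) * ((0 + 1) * 1)))) with A by field.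
        apply Rle_trans with 1; [|exact HA].
        destruct i; simpl; unfold Rabs; destruct Rcase_abs; lra. }
      eapply Rle_trans; [apply Rabs_triang|].
      assert (H4 := Rabs_triang (ck d r1 j l) (ck d r2 j l)); lra.
    - unfold shift_x; rewrite Rabs_mult, (Rabs_pos_eq (INR (S l))) by apply pos_INR.
      apply Rmult_le_compat_l; [apply pos_INR|apply IH; lia]. }
  rewrite conv2_scal_l, (conv2_ext _ (spread lam G) _ (spread lam (dcoef G)))
    by (intros; solve [reflexivity|apply shift_x_spread]).
  rewrite conv2_spread.
  apply Rle_trans with (3 * spread lam (fun N => 8 * A * dcoef G N) m n).
  - apply Rmult_le_compat_l; [lra|]; apply spread_le; [lra|].
    unfold conv1, dcoef, G.
    rewrite (sum_eq _ (fun l => weight l * (INR (S (m + n - l)) * weight (S (m + n - l))) * (A * A)))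
      by (intros; ring).
    rewrite <- scal_sum.
    apply Rle_trans with (A * A * (8 * (INR (S (m + n)) * weight (S (m + n))))); [|right; ring].
    apply Rmult_le_compat_l; [nra|apply conv_weight].
  - right; unfold spread, lam; ring.
Qed.

Lemma binomial_le_pow2 m n : INR (fact (m + n)) / (INR (fact m) * INR (fact n)) <= 2 ^ (m + n).
Proof.
  assert (Hf : forall k, 0 < INR (fact k)) by apply INR_fact_lt_0.
  revert n; induction m as [|m IHm]; intros n.
  - rewrite Nat.add_0_l; simpl; replace (INR (fact n) / (1 * INR (fact n))) with 1
      by (field; apply fact_ne_0).
    apply pow_R1_Rle; lra.
  - induction n as [|n IHn].
    + rewrite Nat.add_0_r; replace (INR (fact (S m)) / (INR (fact (S m)) * INR (fact 0))) with 1
        by (simpl (fact 0); simpl (INR 1); field; apply fact_ne_0).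
      apply pow_R1_Rle; lra.
    + assert (E : INR (fact (S m + S n)) / (INR (fact (S m)) * INR (fact (S n))) =
        INR (fact (m + S n)) / (INR (fact m) * INR (fact (S n))) +
        INR (fact (S m + n)) / (INR (fact (S m)) * INR (fact n))).
      { replace (S m + S n)%nat with (S (S (m + n))) by lia.
        replace (m + S n)%nat with (S (m + n)) by lia.
        replace (S m + n)%nat with (S (m + n)) by lia.
        rewrite !fact_simpl, !mult_INR, !S_INR, plus_INR.
        assert (H1 := INR_pos1 m); assert (H2 := INR_pos1 n).
        field; repeat split; try apply fact_ne_0; lra. }
      rewrite E; generalize (IHm (S n)) IHn.
      replace (S m + n)%nat with (m + S n)%nat by lia.
      replace (S m + S n)%nat with (S (m + S n)) by lia; simpl; lra.
Qed.

(** Finitely many nonzero coefficients fit under A times [weight] for some large A. The majorant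
    then contributes at most (24 A)^(m + n) and its binomial coefficient at most 2^(m + n), together
    (48 A)^(m + n). *)
Lemma ck_geometric d K :
  (forall i n, (K < n)%nat -> d i n = 0) ->
  exists A L, 0 < L /\ forall i m n, Rabs (ck d i m n) <= A * L ^ (m + n).
Proof.
  intros HK.
  assert (Hb : exists A, 1 <= A /\ forall i n, Rabs (d i n) <= A * weight n).
  { assert (Hw : forall N, 0 < weight N).
    { intros N; apply Rinv_0_lt_compat, pow_lt, INR_pos1. }
    assert (Hfin : forall k, exists A, 1 <= A /\ forall i n, (n <= k)%nat -> Rabs (d i n) <= A * weight n).
    { induction k as [|k [A [HA HAk]]].
      - exists (1 + Rabs (d r1 0%nat) + Rabs (d r2 0%nat) + Rabs (d r3 0%nat)).
        assert (P := fun i => Rabs_pos (d i 0%nat)); split.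
        + generalize (P r1) (P r2) (P r3); lra.
        + intros i n Hn; replace n with 0%nat by lia; unfold weight; simpl.
          generalize (P r1) (P r2) (P r3); destruct i; nra.
      - set (S3 := Rabs (d r1 (S k)) + Rabs (d r2 (S k)) + Rabs (d r3 (S k))).
        assert (P := fun i => Rabs_pos (d i (S k))).
        assert (HS : 0 <= S3) by (unfold S3; generalize (P r1) (P r2) (P r3); lra).
        assert (Hq : 0 <= S3 / weight (S k)).
        { apply Rmult_le_pos; [exact HS|left; apply Rinv_0_lt_compat, Hw]. }
        exists (A + S3 / weight (S k)); split; [lra|].
        intros i n Hn; destruct (Nat.eq_dec n (S k)) as [->|Hne].
        + rewrite Rmult_plus_distr_r; unfold Rdiv; rewrite Rmult_assoc, Rinv_l, Rmult_1_r
            by (generalize (Hw (S k)); lra).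
          assert (0 < A * weight (S k)) by (apply Rmult_lt_0_compat; [lra|apply Hw]).
          unfold S3; generalize (P r1) (P r2) (P r3); destruct i; lra.
        + specialize (HAk i n ltac:(lia)); generalize (Hw n); nra. }
    destruct (Hfin K) as [A [HA H]]; exists A; split; auto.
    intros i n; destruct (le_lt_dec n K); auto.
    rewrite HK, Rabs_R0 by auto; left; apply Rmult_lt_0_compat; [lra|apply Hw]. }
  destruct Hb as [A [HA Hd]]; exists A, (48 * A); split; [lra|].
  intros i m n; eapply Rle_trans; [apply ck_majorant; eauto|]; unfold spread.
  assert (H1 := binomial_le_pow2 m n).
  assert (H2 : A * weight (m + n) <= A).
  { rewrite <- (Rmult_1_r A) at 2; apply Rmult_le_compat_l; [lra|]; unfold weight.
    rewrite <- Rinv_1; apply Rinv_le_contravar; [lra|].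
    apply pow_R1_Rle; generalize (pos_INR (m + n)); lra. }
  assert (H3 : (24 * A) ^ m <= (24 * A) ^ (m + n)) by (apply Rle_pow; [lra|lia]).
  assert (H4 : 0 < (24 * A) ^ m) by (apply pow_lt; lra).
  assert (H5 : 0 < INR (fact (m + n)) / (INR (fact m) * INR (fact n))).
  { apply Rdiv_lt_0_compat; [|apply Rmult_lt_0_compat]; apply INR_fact_lt_0. }
  replace (A * (48 * A) ^ (m + n)) with ((24 * A) ^ (m + n) * 2 ^ (m + n) * A)
    by (rewrite <- Rpow_mult_distr; replace (24 * A * 2) with (48 * A) by ring; ring).
  apply Rmult_le_compat; [apply Rmult_le_pos; lra| |apply Rmult_le_compat; lra|exact H2].
  apply Rmult_le_pos; [lra|]; left; apply Rinv_0_lt_compat, pow_lt, INR_pos1.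
Qed.

(** * Double power series *)

(* The double series with these coefficients converges on the square of half-side rho. *)
Definition adm (rho : R) (a : nat -> nat -> R) : Prop :=
  forall s, 0 < s < rho -> exists A, forall m n, Rabs (a m n) * s ^ (m + n) <= A.

(** Iterated as a power series in t whose coefficients are power series in x: one-variable calculus
    applies to t directly, and x is reached through [PS2_transpose]. *)
Definition PS2 (a : nat -> nat -> R) (t x : R) : R := PSeries (fun m => PSeries (a m) x) t.

(** Each of the n + 1 terms of the geometric sum up to q^n is at least q^n. *)
Lemma linear_geometric q n : 0 < q < 1 -> INR (S n) * q ^ n <= / (1 - q).
Proof.
  intros Hq; apply Rle_trans with (sum_f_R0 (fun k => q ^ k) n).
  - rewrite <- (Rmult_comm (q ^ n)), <- sum_cte; apply sum_Rle; intros k Hk.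
    replace n with (k + (n - k))%nat by lia; rewrite pow_add, <- (Rmult_1_r (q ^ k)) at 1.
    rewrite (Rmult_1_r (q ^ k)); rewrite <- (Rmult_1_r (q ^ k)) at 2.
    apply Rmult_le_compat_l; [apply pow_le; lra|].
    rewrite <- (pow1 (n - k)); apply pow_incr; lra.
  - rewrite tech3 by lra; unfold Rdiv; rewrite <- (Rmult_1_l (/ (1 - q))) at 2.
    apply Rmult_le_compat_r; [left; apply Rinv_0_lt_compat; lra|].
    assert (0 < q ^ S n) by (apply pow_lt; lra); lra.
Qed.

Lemma adm_shift_t rho a : adm rho a -> adm rho (shift_t a).
Proof.
  (* A larger radius s' below rho leaves the geometric factor (s / s')^m to absorb the factor m + 1
     produced by differentiation. *)
  intros Ha s Hs; set (s' := (s + rho) / 2).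
  assert (Hs' : 0 < s' < rho /\ s < s') by (unfold s'; lra).
  destruct (Ha s' (proj1 Hs')) as [A HA].
  assert (Hq : 0 < s / s' < 1).
  { split; [apply Rdiv_lt_0_compat; lra|]; apply Rmult_lt_reg_r with s'; [lra|].
    unfold Rdiv; rewrite Rmult_assoc, Rinv_l; lra. }
  exists (A / s' * / (1 - s / s')); intros m n; unfold shift_t.
  rewrite Rabs_mult, (Rabs_pos_eq (INR (S m))) by apply pos_INR.
  assert (Hp : 0 < s' ^ (m + n)) by (apply pow_lt; lra).
  replace (INR (S m) * Rabs (a (S m) n) * s ^ (m + n)) with
    (Rabs (a (S m) n) * s' ^ (S m + n) / s' * (INR (S m) * (s / s') ^ m * (s / s') ^ n)).
  2:{ unfold Rdiv; rewrite !Rpow_mult_distr, !pow_inv; simpl pow.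
      rewrite !pow_add; field; split; [|split]; try apply pow_nonzero; lra. }
  assert (H1 := linear_geometric (s / s') m Hq).
  assert (H2 : (s / s') ^ n <= 1) by (rewrite <- (pow1 n); apply pow_incr; lra).
  assert (H3 : 0 < (s / s') ^ n) by (apply pow_lt; lra).
  assert (H4 : 0 <= INR (S m) * (s / s') ^ m).
  { apply Rmult_le_pos; [apply pos_INR|apply pow_le; lra]. }
  apply Rmult_le_compat.
  - apply Rmult_le_pos; [apply Rmult_le_pos; [apply Rabs_pos|apply pow_le; lra]|].
    left; apply Rinv_0_lt_compat; lra.
  - apply Rmult_le_pos; lra.
  - apply Rmult_le_compat_r; [left; apply Rinv_0_lt_compat; lra|apply HA].
  - rewrite <- (Rmult_1_r (/ _)); apply Rmult_le_compat; lra.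
Qed.

Definition transpose (a : nat -> nat -> R) (m n : nat) : R := a n m.

Lemma adm_transpose rho a : adm rho a -> adm rho (transpose a).
Proof.
  intros Ha s Hs; destruct (Ha s Hs) as [A HA]; exists A; intros m n.
  rewrite Nat.add_comm; apply HA.
Qed.

Lemma adm_shift_x rho a : adm rho a -> adm rho (shift_x a).
Proof. intros Ha; exact (adm_transpose _ _ (adm_shift_t _ _ (adm_transpose _ _ Ha))). Qed.

Lemma adm_plus rho a b : adm rho a -> adm rho b -> adm rho (fun m n => a m n + b m n).
Proof.
  intros Ha Hb s Hs; destruct (Ha s Hs) as [A HA], (Hb s Hs) as [B HB].
  exists (A + B); intros m n; specialize (HA m n); specialize (HB m n).
  assert (0 < s ^ (m + n)) by (apply pow_lt; lra).
  assert (H1 := Rabs_triang (a m n) (b m n)).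
  apply Rle_trans with ((Rabs (a m n) + Rabs (b m n)) * s ^ (m + n)); [|lra].
  apply Rmult_le_compat_r; lra.
Qed.

Definition delta (e : R) (m n : nat) : R := match m, n with O, O => e | _, _ => 0 end.

Lemma adm_delta rho e : adm rho (delta e).
Proof.
  intros s Hs; exists (Rabs e); intros m n; unfold delta; destruct m, n; simpl;
    rewrite ?Rabs_R0, ?Rmult_0_l, ?Rmult_1_r; auto using Rle_refl, Rabs_pos.
Qed.

Lemma scale_nonneg x q s : 0 < s -> Rabs x <= q * s -> 0 <= q.
Proof.
  intros Hs Hx; apply Rmult_le_reg_r with s; auto.
  rewrite Rmult_0_l; apply Rle_trans with (Rabs x); [apply Rabs_pos|auto].
Qed.

Section Rows.
Context (b : nat -> R) (B s : R) (Hs : 0 < s) (HB : forall n, Rabs (b n) * s ^ n <= B).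

Lemma bounded_radius x : Rabs x < s -> Rbar_lt (Rabs x) (CV_radius b).
Proof.
  intros Hx; apply Rbar_lt_le_trans with s; [exact Hx|].
  apply (CV_radius_bounded b); exists B; intros n.
  rewrite Rabs_mult, (Rabs_pos_eq (s ^ n)); [apply HB|apply pow_le; lra].
Qed.

Lemma bounded_PSeries q x : q < 1 -> Rabs x <= q * s -> Rabs (PSeries b x) <= B / (1 - q).
Proof.
  intros Hq Hx.
  assert (Hq0 : 0 <= q) by (apply (scale_nonneg x q s); auto).
  assert (Hn : forall n, 0 <= Rabs (b n * x ^ n) <= B * q ^ n).
  { intros n; split; [apply Rabs_pos|]; rewrite Rabs_mult, <- RPow_abs.
    apply Rle_trans with (Rabs (b n) * (q * s) ^ n).
    - apply Rmult_le_compat_l; [apply Rabs_pos|]; apply pow_incr; split; [apply Rabs_pos|auto].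
    - rewrite Rpow_mult_distr, (Rmult_comm (q ^ n)), <- Rmult_assoc.
      apply Rmult_le_compat_r; [apply pow_le; auto|apply HB]. }
  assert (Hg : ex_series (fun n => B * q ^ n)).
  { apply (ex_series_scal B (fun n => q ^ n)), ex_series_geom; rewrite Rabs_pos_eq; auto. }
  assert (HA : ex_series (fun n => Rabs (b n * x ^ n))).
  { refine (ex_series_le _ _ _ Hg); intros n.
    change (norm (Rabs (b n * x ^ n))) with (Rabs (Rabs (b n * x ^ n))).
    rewrite Rabs_Rabsolu; apply Hn. }
  unfold PSeries; eapply Rle_trans; [apply Series_Rabs; exact HA|].
  eapply Rle_trans; [apply Series_le; [exact Hn|exact Hg]|].
  rewrite Series_scal_l, Series_geom by (rewrite Rabs_pos_eq; auto); right; reflexivity.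
Qed.

End Rows.

Lemma le_scale_lt y q s : 0 < s -> q < 1 -> y <= q * s -> y < s.
Proof. intros; assert (q * s < 1 * s) by (apply Rmult_lt_compat_r; lra); lra. Qed.

Lemma bounded_tail (b : nat -> R) B s q x N :
  0 < s -> (forall n, Rabs (b n) * s ^ n <= B) -> q < 1 -> Rabs x <= q * s ->
  Rabs (PSeries b x - sum_f_R0 (fun n => b n * x ^ n) N) <= q ^ S N * (B / (1 - q)).
Proof.
  intros Hs HB Hq Hx; assert (Hq0 : 0 <= q) by (apply (scale_nonneg x q s); auto).
  rewrite (PSeries_decr_n b N) by (apply CV_radius_inside, (bounded_radius b B s); eauto using le_scale_lt).
  replace (_ - _) with (x ^ S N * PSeries (PS_decr_n b (S N)) x) by ring.
  assert (HsN : 0 < s ^ S N) by (apply pow_lt; auto).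
  assert (H : Rabs (s ^ S N * PSeries (PS_decr_n b (S N)) x) <= B / (1 - q)).
  { rewrite <- PSeries_scal; apply (bounded_PSeries _ B s); auto.
    intros n; change (PS_scal (s ^ S N) (PS_decr_n b (S N)) n) with (s ^ S N * b (S N + n)%nat).
    rewrite Rabs_mult, (Rabs_pos_eq (s ^ S N)) by lra.
    generalize (HB (S N + n)%nat); rewrite pow_add; intros K; lra. }
  rewrite Rabs_mult, (Rabs_pos_eq (s ^ S N)) in H by lra.
  rewrite Rabs_mult, <- RPow_abs.
  apply Rle_trans with ((q * s) ^ S N * Rabs (PSeries (PS_decr_n b (S N)) x)).
  - apply Rmult_le_compat_r; [apply Rabs_pos|]; apply pow_incr; split; [apply Rabs_pos|auto].
  - rewrite Rpow_mult_distr, Rmult_assoc; apply Rmult_le_compat_l; [apply pow_le; auto|exact H].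
Qed.

Lemma sum_swap (f : nat -> nat -> R) M N :
  sum_f_R0 (fun m => sum_f_R0 (f m) N) M = sum_f_R0 (fun n => sum_f_R0 (fun m => f m n) M) N.
Proof.
  induction M as [|M IH]; [reflexivity|].
  rewrite tech5, IH, <- plus_sum; apply sum_eq; intros; rewrite tech5; reflexivity.
Qed.

Lemma adm_rows rho a s : adm rho a -> 0 < s < rho ->
  exists A, 0 <= A /\ forall m n, Rabs (a m n) * s ^ n <= A / s ^ m.
Proof.
  intros Ha Hs; destruct (Ha s Hs) as [A HA]; exists A; split.
  - eapply Rle_trans; [|apply (HA 0%nat 0%nat)]; simpl; rewrite Rmult_1_r; apply Rabs_pos.
  - intros m n; assert (0 < s ^ m) by (apply pow_lt; lra).
    apply Rmult_le_reg_r with (s ^ m); auto; unfold Rdiv; rewrite (Rmult_assoc A), Rinv_l, Rmult_1_r by lra.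
    generalize (HA m n); rewrite pow_add; intros; lra.
Qed.

Lemma rows_bounded a A s q x :
  0 < s -> (forall m n, Rabs (a m n) * s ^ n <= A / s ^ m) -> q < 1 -> Rabs x <= q * s ->
  forall m, Rabs (PSeries (a m) x) * s ^ m <= A / (1 - q).
Proof.
  intros Hs HA Hq Hx m; assert (0 < s ^ m) by (apply pow_lt; lra).
  apply Rle_trans with (A / s ^ m / (1 - q) * s ^ m).
  - apply Rmult_le_compat_r; [lra|]; apply (bounded_PSeries _ _ s); auto.
  - right; field; lra.
Qed.

(** Square partial sums are symmetric in the two indices and converge geometrically to the iterated
    sum; this is what justifies the exchange of summations in [PS2_transpose]. *)
Lemma PS2_partial_sums a A s q t x N :
  0 < s -> 0 <= A -> (forall m n, Rabs (a m n) * s ^ n <= A / s ^ m) ->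
  q < 1 -> Rabs t <= q * s -> Rabs x <= q * s ->
  Rabs (PS2 a t x - sum_f_R0 (fun m => sum_f_R0 (fun n => a m n * x ^ n * t ^ m) N) N)
  <= 2 * (A / (1 - q) / (1 - q)) * q ^ S N.
Proof.
  intros Hs HA0 HA Hq Ht Hx; assert (Hq0 : 0 <= q) by (apply (scale_nonneg x q s); auto).
  assert (HqN : 0 <= q ^ S N) by (apply pow_le; auto).
  assert (Hi : 0 < / (1 - q)) by (apply Rinv_0_lt_compat; lra).
  set (P := sum_f_R0 (fun m => PSeries (a m) x * t ^ m) N).
  assert (H1 : Rabs (PS2 a t x - P) <= q ^ S N * (A / (1 - q) / (1 - q))).
  { apply (bounded_tail _ (A / (1 - q)) s); auto; apply rows_bounded; auto. }
  assert (H2 : Rabs (P - sum_f_R0 (fun m => sum_f_R0 (fun n => a m n * x ^ n * t ^ m) N) N)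
    <= q ^ S N * (A / (1 - q) / (1 - q))).
  { unfold P; rewrite <- minus_sum; eapply Rle_trans; [apply Rsum_abs|].
    apply Rle_trans with (sum_f_R0 (fun m => q ^ m * (q ^ S N * (A / (1 - q)))) N).
    - apply sum_Rle; intros m Hm.
      rewrite <- scal_sum.
      replace (PSeries (a m) x * t ^ m - t ^ m * sum_f_R0 (fun n => a m n * x ^ n) N) with
        (t ^ m * (PSeries (a m) x - sum_f_R0 (fun n => a m n * x ^ n) N)) by ring.
      rewrite Rabs_mult, <- RPow_abs.
      assert (Hsm : 0 < s ^ m) by (apply pow_lt; auto).
      apply Rle_trans with ((q * s) ^ m * (q ^ S N * (A / s ^ m / (1 - q)))).
      + apply Rmult_le_compat; try apply Rabs_pos.
        * apply pow_le, Rabs_pos.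
        * apply pow_incr; split; [apply Rabs_pos|auto].
        * apply (bounded_tail _ _ s); auto.
      + rewrite Rpow_mult_distr; right; field; lra.
    - rewrite <- scal_sum, tech3 by lra.
      assert (0 <= A / (1 - q)) by (apply Rmult_le_pos; lra).
      assert (0 <= q ^ S N * (A / (1 - q))) by (apply Rmult_le_pos; auto).
      apply Rle_trans with (q ^ S N * (A / (1 - q)) * (1 / (1 - q))); [|right; field; lra].
      apply Rmult_le_compat_l; auto; apply Rmult_le_compat_r; lra. }
  replace (PS2 a t x - _) with ((PS2 a t x - P) +
    (P - sum_f_R0 (fun m => sum_f_R0 (fun n => a m n * x ^ n * t ^ m) N) N)) by ring.
  eapply Rle_trans; [apply Rabs_triang|lra].
Qed.

Lemma scale_exists rho t x :
  Rabs t < rho -> Rabs x < rho ->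
  exists s q, 0 < s < rho /\ 0 <= q < 1 /\ Rabs t <= q * s /\ Rabs x <= q * s.
Proof.
  intros Ht Hx; set (m := Rmax (Rabs t) (Rabs x)).
  assert (Hm : 0 <= m < rho).
  { split; [apply Rle_trans with (Rabs t); [apply Rabs_pos|apply Rmax_l]|apply Rmax_lub_lt; auto]. }
  exists ((m + rho) / 2), (2 * m / (m + rho)).
  assert (E : 2 * m / (m + rho) * ((m + rho) / 2) = m) by (field; lra).
  split; [lra|split; [split|]].
  - apply Rmult_le_pos; [lra|left; apply Rinv_0_lt_compat; lra].
  - apply Rmult_lt_reg_r with ((m + rho) / 2); lra.
  - rewrite E; split; [apply Rmax_l|apply Rmax_r].
Qed.

Lemma PS2_transpose rho a t x :
  adm rho a -> Rabs t < rho -> Rabs x < rho -> PS2 (transpose a) x t = PS2 a t x.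
Proof.
  intros Ha Ht Hx; destruct (scale_exists rho t x Ht Hx) as [s [q [Hs [Hq [Hts Hxs]]]]].
  destruct (adm_rows rho a s Ha Hs) as [A [HA0 HA]].
  destruct (adm_rows rho _ s (adm_transpose _ _ Ha) Hs) as [B [HB0 HB]].
  apply Rminus_diag_uniq, NNPP; intros Hne.
  set (d := PS2 (transpose a) x t - PS2 a t x) in *.
  (* C q^(N + 1) bounds the difference of the two iterated sums, compared through their common
     square partial sum; the extra 1 keeps C positive. *)
  set (C := 2 * (A / (1 - q) / (1 - q)) + 2 * (B / (1 - q) / (1 - q)) + 1).
  assert (Hi : 0 < / (1 - q)) by (apply Rinv_0_lt_compat; lra).
  assert (HC : 0 < C).
  { unfold C; assert (0 <= A / (1 - q) / (1 - q)) by (repeat apply Rmult_le_pos; lra).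
    assert (0 <= B / (1 - q) / (1 - q)) by (repeat apply Rmult_le_pos; lra); lra. }
  assert (Hd : 0 < Rabs d / C) by (apply Rdiv_lt_0_compat; auto; apply Rabs_pos_lt; auto).
  destruct (pow_lt_1_zero q ltac:(rewrite Rabs_pos_eq; lra) _ Hd) as [N HN].
  specialize (HN (S N) ltac:(lia)); rewrite Rabs_pos_eq in HN by (apply pow_le; lra).
  assert (H1 := PS2_partial_sums a A s q t x N ltac:(lra) HA0 HA ltac:(lra) Hts Hxs).
  assert (H2 := PS2_partial_sums (transpose a) B s q x t N ltac:(lra) HB0 HB ltac:(lra) Hxs Hts).
  rewrite sum_swap in H2.
  rewrite (sum_eq _ (fun m => sum_f_R0 (fun n => a m n * x ^ n * t ^ m) N)) in H2
    by (intros; apply sum_eq; intros; unfold transpose; ring).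
  set (S0 := sum_f_R0 _ N) in *.
  assert (H3 : Rabs d <= C * q ^ S N).
  { unfold d; replace (PS2 (transpose a) x t - PS2 a t x) with
      ((PS2 (transpose a) x t - S0) - (PS2 a t x - S0)) by ring.
    eapply Rle_trans; [apply Rabs_triang|]; rewrite Rabs_Ropp; unfold C.
    assert (0 <= q ^ S N) by (apply pow_le; lra); nra. }
  apply (Rmult_lt_compat_l C) in HN; auto; unfold Rdiv in HN.
  replace (C * (Rabs d * / C)) with (Rabs d) in HN by (field; lra); lra.
Qed.

Lemma PS2_radius rho a t x :
  adm rho a -> Rabs t < rho -> Rabs x < rho ->
  Rbar_lt (Rabs t) (CV_radius (fun m => PSeries (a m) x)) /\
  forall m, Rbar_lt (Rabs x) (CV_radius (a m)).
Proof.
  intros Ha Ht Hx; destruct (scale_exists rho t x Ht Hx) as [s [q [Hs [Hq [Hts Hxs]]]]].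
  destruct (adm_rows rho a s Ha Hs) as [A [HA0 HA]]; split.
  - apply (bounded_radius _ (A / (1 - q)) s); [lra| |apply (le_scale_lt _ q); lra].
    apply rows_bounded; auto; lra.
  - intros m; apply (bounded_radius _ (A / s ^ m) s); auto; [lra|apply (le_scale_lt _ q); lra].
Qed.

Lemma is_derive_PS2_t rho a t x :
  adm rho a -> Rabs t < rho -> Rabs x < rho ->
  is_derive (fun t => PS2 a t x) t (PS2 (shift_t a) t x).
Proof.
  intros Ha Ht Hx; replace (PS2 (shift_t a) t x) with (PSeries (PS_derive (fun m => PSeries (a m) x)) t).
  - apply is_derive_PSeries, (PS2_radius rho); auto.
  - apply PSeries_ext; intros m; unfold PS_derive; rewrite <- PSeries_scal.
    apply PSeries_ext; reflexivity.
Qed.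

Lemma is_derive_PS2_x rho a t x :
  adm rho a -> Rabs t < rho -> Rabs x < rho ->
  is_derive (fun x => PS2 a t x) x (PS2 (shift_x a) t x).
Proof.
  intros Ha Ht Hx; rewrite <- (PS2_transpose rho) by auto using adm_shift_x.
  apply (is_derive_ext_loc (fun x => PS2 (transpose a) x t)).
  - assert (H : 0 < rho - Rabs x) by lra.
    exists (mkposreal _ H); intros y Hy; apply (PS2_transpose rho); auto.
    assert (Hy' : Rabs (y - x) < rho - Rabs x) by exact Hy.
    replace y with ((y - x) + x) by ring; eapply Rle_lt_trans; [apply Rabs_triang|lra].
  - exact (is_derive_PS2_t rho (transpose a) x t (adm_transpose _ _ Ha) Hx Ht).
Qed.

Lemma PS2_plus rho a b t x :
  adm rho a -> adm rho b -> Rabs t < rho -> Rabs x < rho ->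
  PS2 (fun m n => a m n + b m n) t x = PS2 a t x + PS2 b t x.
Proof.
  intros Ha Hb Ht Hx; destruct (PS2_radius rho a t x) as [A1 A2]; auto.
  destruct (PS2_radius rho b t x) as [B1 B2]; auto; unfold PS2.
  rewrite <- PSeries_plus by (apply CV_radius_inside; auto).
  apply PSeries_ext; intros m; unfold PS_plus.
  change plus with Rplus; rewrite <- PSeries_plus by (apply CV_radius_inside; auto).
  apply PSeries_ext; reflexivity.
Qed.

Lemma PS2_opp a t x : PS2 (fun m n => - a m n) t x = - PS2 a t x.
Proof.
  unfold PS2; rewrite <- PSeries_opp; apply PSeries_ext; intros m.
  unfold PS_opp; change opp with Ropp; rewrite <- PSeries_opp; apply PSeries_ext; reflexivity.
Qed.

Lemma PSeries_single e x : PSeries (fun n => match n with O => e | _ => 0 end) x = e.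
Proof.
  assert (Hx := Rabs_pos x).
  rewrite PSeries_decr_1.
  - rewrite (PSeries_ext _ (fun _ => 0)), PSeries_const_0 by reflexivity; ring.
  - apply CV_radius_inside, (bounded_radius _ (Rabs e) (Rabs x + 1)); [lra| |lra].
    intros [|n]; [simpl; lra|]; rewrite Rabs_R0, Rmult_0_l; apply Rabs_pos.
Qed.

Lemma PS2_delta e t x : PS2 (delta e) t x = e.
Proof.
  unfold PS2; rewrite (PSeries_ext _ (fun m => match m with O => e | _ => 0 end)).
  - apply PSeries_single.
  - intros [|m]; unfold delta; [apply PSeries_single|apply PSeries_const_0].
Qed.

(** Two one-variable Cauchy products: in t for the series of rows, then in x inside each finite sum
    of products of rows. *)
Lemma PS2_conv2 rho a b t x :
  adm rho a -> adm rho b -> Rabs t < rho -> Rabs x < rho ->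
  PS2 (conv2 a b) t x = PS2 a t x * PS2 b t x.
Proof.
  intros Ha Hb Ht Hx; destruct (PS2_radius rho a t x) as [A1 A2]; auto.
  destruct (PS2_radius rho b t x) as [B1 B2]; auto; unfold PS2.
  rewrite <- PSeries_mult by auto; apply PSeries_ext; intros m; unfold PS_mult at 1.
  assert (H : forall N (g : nat -> nat -> R), (forall j, (j <= N)%nat -> ex_pseries (g j) x) ->
    ex_pseries (fun n => sum_f_R0 (fun j => g j n) N) x /\ PSeries (fun n => sum_f_R0 (fun j => g j n) N) x = sum_f_R0 (fun j => PSeries (g j) x) N).
  { induction N as [|N IH]; intros g Hg; [split; [apply (Hg 0%nat)|]; auto|].
    destruct (IH g) as [H1 H2]; [auto|]; split.
    - apply (ex_pseries_plus (fun n => sum_f_R0 (fun j => g j n) N)); auto.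
    - rewrite tech5, <- H2, <- PSeries_plus by auto; apply PSeries_ext; reflexivity. }
  rewrite (sum_eq _ (fun j => PSeries (PS_mult (a j) (b (m - j)%nat)) x))
    by (intros; rewrite PSeries_mult by auto; reflexivity).
  rewrite <- (proj2 (H m (fun j => PS_mult (a j) (b (m - j)%nat))
    (fun j _ => ex_pseries_mult _ _ _ (A2 j) (B2 (m - j)%nat)))).
  apply PSeries_ext; intros n; reflexivity.
Qed.

(** * Local solvability *)

Section Translated.
Context (rho t0 x0 : R).

Definition square (p : R * R) : Prop := Rabs (fst p - t0) < rho /\ Rabs (snd p - x0) < rho.
Definition tps (a : nat -> nat -> R) (t x : R) : R := PS2 a (t - t0) (x - x0).

Lemma open_square : open square.
Proof.
  apply open_of_locally_2d; intros t x [Ht Hx]; simpl in *.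
  assert (Hd : 0 < Rmin (rho - Rabs (t - t0)) (rho - Rabs (x - x0))) by (apply Rmin_pos; lra).
  exists (mkposreal _ Hd); simpl; intros u v Hu Hv.
  assert (H1 := Rmin_l (rho - Rabs (t - t0)) (rho - Rabs (x - x0))).
  assert (H2 := Rmin_r (rho - Rabs (t - t0)) (rho - Rabs (x - x0))).
  split; simpl.
  - replace (u - t0) with ((u - t) + (t - t0)) by ring.
    eapply Rle_lt_trans; [apply Rabs_triang|lra].
  - replace (v - x0) with ((v - x) + (x - x0)) by ring.
    eapply Rle_lt_trans; [apply Rabs_triang|lra].
Qed.

Lemma is_derive_tps_t a t x :
  adm rho a -> square (t, x) -> is_derive (fun s => tps a s x) t (tps (shift_t a) t x).
Proof.
  intros Ha [Ht Hx]; unfold tps; rewrite <- (Rmult_1_l (PS2 (shift_t a) _ _)).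
  apply (is_derive_comp (fun s => PS2 a s (x - x0)) (fun s => s - t0)).
  - apply (is_derive_PS2_t rho); auto.
  - auto_derive; auto; ring.
Qed.

Lemma is_derive_tps_x a t x :
  adm rho a -> square (t, x) -> is_derive (fun s => tps a t s) x (tps (shift_x a) t x).
Proof.
  intros Ha [Ht Hx]; unfold tps; rewrite <- (Rmult_1_l (PS2 (shift_x a) _ _)).
  apply (is_derive_comp (fun s => PS2 a (t - t0) s) (fun s => s - x0)).
  - apply (is_derive_PS2_x rho); auto.
  - auto_derive; auto; ring.
Qed.

Lemma tps_bounded a r :
  adm rho a -> 0 < r < rho -> exists C, 0 <= C /\
  forall t x, Rabs (t - t0) <= r -> Rabs (x - x0) <= r -> Rabs (tps a t x) <= C.
Proof.
  intros Ha Hr; set (s := (r + rho) / 2); set (q := r / s).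
  assert (Hs : 0 < s < rho /\ r < s) by (unfold s; lra).
  assert (Hqs : q * s = r) by (unfold q; field; lra).
  assert (Hq : q < 1) by (apply Rmult_lt_reg_r with s; lra).
  destruct (adm_rows rho a s Ha (proj1 Hs)) as [A [HA0 HA]].
  assert (Hi : 0 < / (1 - q)) by (apply Rinv_0_lt_compat; lra).
  exists (A / (1 - q) / (1 - q)); split; [repeat apply Rmult_le_pos; lra|].
  intros t x Ht Hx; unfold tps, PS2; apply (bounded_PSeries _ _ s); try lra.
  apply rows_bounded; auto; lra.
Qed.

(** The partial derivatives are series of the same kind, hence bounded on a slightly smaller square,
    which makes the function Lipschitz there. *)
Lemma continuity_2d_tps a t x :
  adm rho a -> square (t, x) -> continuity_2d_pt (tps a) t x.
Proof.
  intros Ha Htx; assert (H := Htx); destruct H as [Ht Hx]; simpl in Ht, Hx.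
  set (m := Rmax (Rabs (t - t0)) (Rabs (x - x0))).
  assert (Hm : 0 <= m < rho).
  { split; [apply Rle_trans with (Rabs (t - t0)); [apply Rabs_pos|apply Rmax_l]|apply Rmax_lub_lt; auto]. }
  assert (Hm1 : Rabs (t - t0) <= m) by apply Rmax_l.
  assert (Hm2 : Rabs (x - x0) <= m) by apply Rmax_r.
  set (r := (m + rho) / 2); assert (Hr : 0 < r < rho /\ m < r) by (unfold r; lra).
  destruct (tps_bounded _ r (adm_shift_t _ _ Ha) (proj1 Hr)) as [C [HC0 HC]].
  destruct (tps_bounded _ r (adm_shift_x _ _ Ha) (proj1 Hr)) as [C' [HC0' HC']].
  intros e; assert (Hd : 0 < Rmin (r - m) (e / (C + C' + 1))).
  { apply Rmin_pos; [lra|]; apply Rdiv_lt_0_compat; [apply cond_pos|lra]. }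
  set (d := Rmin (r - m) (e / (C + C' + 1))) in *.
  assert (H1 : d <= r - m) by apply Rmin_l.
  assert (H2 : d * (C + C' + 1) <= e).
  { apply Rle_trans with (e / (C + C' + 1) * (C + C' + 1)); [|right; field; lra].
    apply Rmult_le_compat_r; [lra|apply Rmin_r]. }
  exists (mkposreal _ Hd); simpl; intros u v Hu Hv.
  assert (near : forall y y0 w, Rabs (w - y) <= d -> Rabs (y - y0) <= m -> Rabs (w - y0) <= r).
  { intros y y0 w Hw Hy; replace (w - y0) with ((w - y) + (y - y0)) by ring.
    eapply Rle_trans; [apply Rabs_triang|lra]. }
  assert (B1 : Rabs (tps a u v - tps a t v) <= C * Rabs (u - t)).
  { apply (bounded_variation (fun s => tps a s v) (fun s => tps (shift_t a) s v)).
    intros s Hs; assert (Hs' : Rabs (s - t0) <= r) by (apply (near t); lra).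
    assert (Hv' : Rabs (v - x0) <= r) by (apply (near x); lra); split; [|auto].
    apply is_derive_tps_t; auto; split; simpl; lra. }
  assert (B2 : Rabs (tps a t v - tps a t x) <= C' * Rabs (v - x)).
  { apply (bounded_variation (fun s => tps a t s) (fun s => tps (shift_x a) t s)).
    intros s Hs; assert (Hs' : Rabs (s - x0) <= r) by (apply (near x); lra).
    assert (Ht' : Rabs (t - t0) <= r) by lra; split; [|auto].
    apply is_derive_tps_x; auto; split; simpl; lra. }
  replace (tps a u v - tps a t x) with ((tps a u v - tps a t v) + (tps a t v - tps a t x)) by ring.
  eapply Rle_lt_trans; [apply Rabs_triang|].
  apply Rle_lt_trans with (C * d + C' * d).
  - apply Rplus_le_compat; (eapply Rle_trans; [eassumption|]); apply Rmult_le_compat_l; lra.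
  - lra.
Qed.

Lemma smooth2_tps a : adm rho a -> smooth2 square (tps a).
Proof.
  intros Ha; split; [apply open_square|]; intros t x Htx n; revert a Ha.
  induction n as [|n IH]; intros a Ha; (split; [apply continuity_2d_tps; auto|]).
  - exact I.
  - split; [eexists; apply is_derive_tps_t; auto|].
    split; [eexists; apply is_derive_tps_x; auto|].
    assert (Hloc := open_locally_2d _ _ _ open_square Htx); split.
    + apply (ex_diff_n_ext_loc (tps (shift_t a))); [|apply IH, adm_shift_t, Ha].
      revert Hloc; apply locally_2d_impl, locally_2d_forall; intros u v Huv.
      symmetry; apply is_derive_unique, is_derive_tps_t; auto.
    + apply (ex_diff_n_ext_loc (tps (shift_x a))); [|apply IH, adm_shift_x, Ha].
      revert Hloc; apply locally_2d_impl, locally_2d_forall; intros u v Huv.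
      symmetry; apply is_derive_unique, is_derive_tps_x; auto.
Qed.

Lemma taylor2_tps a m n : 0 < rho -> adm rho a -> taylor2 (tps a) t0 x0 m n = a m n.
Proof.
  intros Hrho Ha.
  assert (H0 : square (t0, x0)) by (split; simpl; rewrite Rminus_diag, Rabs_R0; auto).
  revert a Ha n; induction m as [|m IH]; intros a Ha n.
  - revert a Ha; induction n as [|n IH]; intros a Ha.
    + unfold taylor2, partial_derive, tps, PS2; simpl.
      rewrite !Rminus_diag, !PSeries_0; field.
    + assert (E : taylor2 (tps a) t0 x0 0 (S n) = taylor2 (d_x (tps a)) t0 x0 0 n / INR (S n)).
      { rewrite taylor2_d_x; unfold shift_x; field; apply not_0_INR; lia. }
      rewrite E, (taylor2_ext square _ (tps (shift_x a))), IH.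
      * unfold shift_x; field; apply not_0_INR; lia.
      * apply adm_shift_x, Ha.
      * apply open_square.
      * intros u v Huv; apply is_derive_unique, is_derive_tps_x; auto.
      * exact H0.
  - assert (E : taylor2 (tps a) t0 x0 (S m) n = taylor2 (d_t (tps a)) t0 x0 m n / INR (S m)).
    { rewrite (taylor2_d_t square); auto using smooth2_tps.
      unfold shift_t; field; apply not_0_INR; lia. }
    rewrite E, (taylor2_ext square _ (tps (shift_t a))), IH.
    + unfold shift_t; field; apply not_0_INR; lia.
    + apply adm_shift_t, Ha.
    + apply open_square.
    + intros u v Huv; apply is_derive_unique, is_derive_tps_t; auto.
    + exact H0.
Qed.
End Translated.

(* Cauchy-Kovalevskaya theorem for the Taylor polynomials of the x-jet of z as initial data. *)
Lemma local_solvability z K :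
  exists O f, is_solution O f /\ O (z (ind vt), z (ind vx)) /\
    forall c, (ord c <= K)%nat -> prolong f (z (ind vt)) (z (ind vx)) c = proj z c.
Proof.
  set (d := fun i n => if le_lt_dec n K then initial_data z i n else 0).
  destruct (ck_geometric d K) as [A [L [HL Hck]]].
  { intros i n Hn; unfold d; destruct (le_lt_dec n K); [lia|auto]. }
  set (rho := / L); assert (Hrho : 0 < rho) by (apply Rinv_0_lt_compat; auto).
  assert (Hadm : forall i, adm rho (ck d i)).
  { intros i s Hs; exists A; intros m n.
    assert (HA : 0 <= A).
    { eapply Rle_trans; [apply Rabs_pos|]; eapply Rle_trans; [apply (Hck i 0%nat 0%nat)|]; simpl; lra. }
    assert (HLs : 0 <= L * s <= 1).
    { split; [apply Rmult_le_pos; lra|]; replace 1 with (L * rho) by (unfold rho; field; lra).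
      apply Rmult_le_compat_l; lra. }
    apply Rle_trans with (A * L ^ (m + n) * s ^ (m + n)).
    - apply Rmult_le_compat_r; [apply pow_le; lra|auto].
    - rewrite Rmult_assoc, <- Rpow_mult_distr; rewrite <- (Rmult_1_r A) at 2.
      apply Rmult_le_compat_l; auto; rewrite <- (pow1 (m + n)); apply pow_incr; auto. }
  set (t0 := z (ind vt)); set (x0 := z (ind vx)).
  set (f := fun i => tps t0 x0 (ck d i)).
  exists (square rho t0 x0), f; split; [|split].
  - intros i; split; [apply smooth2_tps, Hadm|]; intros t x Htx.
    assert (Et : ut i (prolong f t x) = tps t0 x0 (shift_t (ck d i)) t x).
    { apply (is_derive_unique (fun s => tps t0 x0 (ck d i) s x)), (is_derive_tps_t rho); auto. }
    assert (Ex : ux i (prolong f t x) = tps t0 x0 (shift_x (ck d i)) t x).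
    { apply (is_derive_unique (fun s => tps t0 x0 (ck d i) t s)), (is_derive_tps_x rho); auto. }
    rewrite Et, Ex; destruct Htx as [Ht Hx]; simpl in Ht, Hx.
    assert (EV : V i (prolong f t x) = PS2 (speed_coef (ck d) i) (t - t0) (x - x0)).
    { change (speed_coef (ck d) i) with
        (fun m n => (ck d r1 m n + ck d r2 m n) + delta (speed_offset i) m n).
      rewrite (PS2_plus rho (fun m n => ck d r1 m n + ck d r2 m n)), (PS2_plus rho), PS2_delta
        by auto using adm_plus, adm_delta.
      destruct i; unfold V, u, prolong, partial_derive, f, tps; simpl; ring. }
    rewrite EV; unfold tps.
    assert (Hsc : adm rho (speed_coef (ck d) i)).
    { exact (adm_plus rho _ (delta (speed_offset i)) (adm_plus rho _ _ (Hadm r1) (Hadm r2))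
        (adm_delta rho (speed_offset i))). }
    rewrite <- (PS2_conv2 rho) by auto using adm_shift_x.
    replace (shift_t (ck d i)) with (fun m n => - conv2 (speed_coef (ck d) i) (shift_x (ck d i)) m n).
    + rewrite PS2_opp; ring.
    + extensionality m; extensionality n; symmetry; apply ck_recursion.
  - split; simpl; fold t0 x0; rewrite Rminus_diag, Rabs_R0; auto.
  - intros [[]|i m n] Hc; [reflexivity|reflexivity|].
    simpl; transitivity (INR (fact m) * INR (fact n) * taylor2 (f i) t0 x0 m n).
    + unfold taylor2; field; split; apply fact_ne_0.
    + unfold f; rewrite (taylor2_tps rho) by auto; f_equal; apply ck_dep.
      intros j l Hl; unfold d; simpl in Hc; destruct (le_lt_dec l K); [auto|lia].
Qed.

(** * Conservation at the points of the equation manifold *)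

Lemma Dt_local k U F z w :
  DF k U F -> U z -> U w -> (forall c, (ord c <= S k)%nat -> z c = w c) -> Dt k F z = Dt k F w.
Proof.
  intros HF Hz Hw H; rewrite !Dt_lsum; apply lsum_ext; intros c Hc; apply in_coords in Hc.
  f_equal.
  - destruct c as [[]|i a b]; simpl; auto; apply H; simpl in *; lia.
  - apply (DF_dep (DF_pder HF c)); auto.
Qed.

Lemma Dx_local k U F z w :
  DF k U F -> U z -> U w -> (forall c, (ord c <= S k)%nat -> z c = w c) -> Dx k F z = Dx k F w.
Proof.
  intros HF Hz Hw H; rewrite !Dx_lsum; apply lsum_ext; intros c Hc; apply in_coords in Hc.
  f_equal.
  - destruct c as [[]|i a b]; simpl; auto; apply H; simpl in *; lia.
  - apply (DF_dep (DF_pder HF c)); auto.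
Qed.

(** A solution need only have the right jet up to order k + 1, which is all that the divergence
    sees, and up to the order restricted by a neighbourhood inside U. This is why polynomial initial
    data suffice in [local_solvability]. *)
Lemma conservation_on_equations k U C z :
  current_on k U C ->
  vanishes_on_solutions U (fun z => Dt k (fst C) z + Dx k (snd C) z) ->
  U (proj z) -> Dt k (fst C) (proj z) + Dx k (snd C) (proj z) = 0.
Proof.
  intros [H1 H2] Hv Hz; destruct (DF_open H1 _ Hz) as [n [e He]].
  destruct (local_solvability z (Nat.max n (S k))) as [O [f [Hs [HO Hf]]]].
  set (w := prolong f (z (ind vt)) (z (ind vx))) in *.
  assert (Hw : U w).
  { apply He; intros c Hc; rewrite Hf, Rminus_diag, Rabs_R0 by lia; apply cond_pos. }
  rewrite <- (Hv O f Hs _ _ HO Hw); fold w; f_equal.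
  - apply (Dt_local k U); auto; intros c Hc; symmetry; apply Hf; lia.
  - apply (Dx_local k U); auto; intros c Hc; symmetry; apply Hf; lia.
Qed.

(** * Conserved currents with first-order densities *)

Notation rc i := (der i 0 0).
Notation pc i := (der i 0 1).

(* With the t-derivatives eliminated by means of the equations, a density rho(r, r_x) and a flux flux(t, x, r, r_x)
   form a conserved current iff the coefficients of r^i_xx and the remaining terms of D_t rho + D_x flux vanish. *)
Record normal_pair (U : jet -> Prop) (rho flux : jet -> R) : Prop := {
  np_rho : DF 1 U rho;
  np_flux : DF 1 U flux;
  np_rho_dep : forall c z, U z -> (forall i, c <> rc i /\ c <> pc i) -> pder c rho z = 0;
  np_flux_dep : forall c z, U z -> (forall v, c <> ind v) ->
    (forall i, c <> rc i /\ c <> pc i) -> pder c flux z = 0;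
  np_top : forall i z, U z -> pder (pc i) flux z = V i z * pder (pc i) rho z;
  np_rest : forall z, U z ->
    pder (ind vx) flux z + sum_dvar (fun i => ux i z * pder (rc i) flux z) =
    sum_dvar (fun i => V i z * ux i z * pder (rc i) rho z) +
    (ux r1 z + ux r2 z) * sum_dvar (fun i => ux i z * pder (pc i) rho z) }.

Lemma proj_t i z : proj z (der i 1 0) = - (V i z * ux i z).
Proof.
  unfold proj; rewrite ck_S; unfold conv2, speed_coef, shift_x; simpl sum_f_R0.
  rewrite !ck_0; unfold initial_data, taylor; simpl.
  destruct i; unfold V, u, ux; simpl; field.
Qed.

Lemma proj_tx i z :
  proj z (der i 1 1) = - (V i z * z (der i 0 2) + (ux r1 z + ux r2 z) * ux i z).
Proof.
  unfold proj; rewrite ck_S; unfold conv2, speed_coef, shift_x; simpl sum_f_R0.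
  rewrite !ck_0; unfold initial_data, taylor; simpl.
  destruct i; unfold V, u, ux; simpl; field.
Qed.

Lemma normal_pair_conserved U rho flux : normal_pair U rho flux -> conserved_current U (rho, flux).
Proof.
  intros H; exists 1%nat; split; [split; apply H|].
  intros O f Hs t x HO HU; set (w := prolong f t x) in *.
  assert (E1 : forall i, w (der i 1 0) = - (V i w * ux i w)).
  { intros i; unfold w at 1; rewrite (prolong_proj O f t x Hs HO); apply proj_t. }
  assert (E2 : forall i, w (der i 1 1) = - (V i w * w (der i 0 2) + (ux r1 w + ux r2 w) * ux i w)).
  { intros i; unfold w at 1; rewrite (prolong_proj O f t x Hs HO); apply proj_tx. }
  clearbody w.
  assert (D0 : forall i, pder (der i 1 0) rho w = 0).
  { intros i; apply (np_rho_dep _ _ _ H); auto; split; discriminate. }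
  assert (D1 : forall i, pder (der i 1 0) flux w = 0).
  { intros i; apply (np_flux_dep _ _ _ H); auto; [discriminate|split; discriminate]. }
  assert (D2 : pder (ind vt) rho w = 0).
  { apply (np_rho_dep _ _ _ H); auto; split; discriminate. }
  assert (T := fun i => np_top _ _ _ H i w HU); assert (R := np_rest _ _ _ H w HU).
  unfold Dt, Dx, sum_dvar, fst, snd; simpl sum_f_R0; simpl Nat.sub.
  rewrite !D0, !D1, D2, !E1, !E2, !T; unfold sum_dvar in R; unfold ux in *.
  apply Rminus_diag_eq in R; refine (eq_trans _ R); ring.
Qed.

Lemma normal_pair_sub U W rho flux :
  jet_open W -> (forall z, W z -> U z) -> normal_pair U rho flux -> normal_pair W rho flux.
Proof.
  intros HW HU [H1 H2 H3 H4 H5 H6]; constructor; auto.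
  - apply (DF_sub H1); auto.
  - apply (DF_sub H2); auto.
Qed.

Lemma pder_plus k U F G c z :
  DF k U F -> DF k U G -> U z -> pder c (fun w => F w + G w) z = pder c F z + pder c G z.
Proof.
  intros HF HG Hz; apply is_pder_unique, is_pder_plus; [apply (DF_is_pder HF)|apply (DF_is_pder HG)]; auto.
Qed.

Lemma pder_scal k U F a c z :
  DF k U F -> U z -> pder c (fun w => a * F w) z = a * pder c F z.
Proof.
  intros HF Hz; apply is_pder_unique; eapply is_pder_eq.
  - apply (is_pder_mult c (fun _ => a)); [apply is_pder_const|apply (DF_is_pder HF); auto].
  - cbv beta; ring.
Qed.

Lemma normal_pair_plus U rho flux rho' flux' :
  normal_pair U rho flux -> normal_pair U rho' flux' ->
  normal_pair U (fun z => rho z + rho' z) (fun z => flux z + flux' z).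
Proof.
  intros [H1 H2 H3 H4 H5 H6] [H1' H2' H3' H4' H5' H6']; constructor.
  - apply DF_plus; auto.
  - apply DF_plus; auto.
  - intros c z Hz Hc; rewrite (pder_plus 1 U), H3, H3'; auto; ring.
  - intros c z Hz Hv Hc; rewrite (pder_plus 1 U), H4, H4'; auto; ring.
  - intros i z Hz; rewrite !(pder_plus 1 U), H5, H5'; auto; ring.
  - intros z Hz; specialize (H6 z Hz); specialize (H6' z Hz); unfold sum_dvar in *.
    rewrite !(pder_plus 1 U); auto; lra.
Qed.

Lemma normal_pair_scal U rho flux a :
  normal_pair U rho flux -> normal_pair U (fun z => a * rho z) (fun z => a * flux z).
Proof.
  intros [H1 H2 H3 H4 H5 H6]; constructor.
  - apply DF_mult; auto; apply DF_const, (DF_open H1).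
  - apply DF_mult; auto; apply DF_const, (DF_open H1).
  - intros c z Hz Hc; rewrite (pder_scal 1 U), H3; auto; ring.
  - intros c z Hz Hv Hc; rewrite (pder_scal 1 U), H4; auto; ring.
  - intros i z Hz; rewrite !(pder_scal 1 U), H5; auto; ring.
  - intros z Hz; specialize (H6 z Hz); unfold sum_dvar in *.
    rewrite !(pder_scal 1 U); auto.
    apply Rminus_diag_eq in H6; apply Rminus_diag_uniq.
    rewrite <- (Rmult_0_r a), <- H6; ring.
Qed.

Lemma normal_pair_zero U : jet_open U -> normal_pair U (fun _ => 0) (fun _ => 0).
Proof.
  intros HU; assert (E : forall c z, pder c (fun _ => 0) z = 0).
  { intros; apply is_pder_unique, is_pder_const. }
  constructor; intros; unfold sum_dvar; rewrite ?E; auto using DF_const; ring.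
Qed.

Lemma is_pder_ext c F G z l : (forall w, F w = G w) -> is_pder c F z l -> is_pder c G z l.
Proof. intros H; apply is_derive_ext; intros; apply H. Qed.

Ltac cdec := repeat match goal with
  | |- context [coord_eq_dec ?a ?b] => destruct (coord_eq_dec a b); try discriminate; try congruence
  end.

(** Syntax-directed differentiation: the value is an evar assembled by the rules, usually reconciled
    afterwards through [is_pder_eq]. Functions not built from the listed operations are left as
    goals, which [pdb] below closes for differential functions. *)
Ltac pd := lazymatch goal with
  | |- is_pder ?c (fun w => @?F w + @?G w) ?z _ => apply (is_pder_plus c F G z); pd
  | |- is_pder ?c (fun w => @?F w - @?G w) ?z _ => apply (is_pder_minus c F G z); pd
  | |- is_pder ?c (fun w => - @?F w) ?z _ => apply (is_pder_opp c F z); pd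
  | |- is_pder ?c (fun w => @?F w * @?G w) ?z _ => apply (is_pder_mult c F G z); pd
  | |- is_pder ?c (fun w => / @?F w) ?z _ => apply (is_pder_inv c F z); [pd|]
  | |- is_pder ?c (fun w => exp (@?F w)) ?z _ => apply (is_pder_exp c F z); pd
  | |- is_pder ?c (fun w => w ?d) ?z _ => apply is_pder_coord
  | |- is_pder ?c (fun _ => ?a) ?z _ => apply is_pder_const
  | _ => idtac
  end.

(** The alternative a = 0 admits boxes meeting r^1_x r^2_x = 0: there the constant in front of C_0
    is zero, as [remove_C0] shows, and subtracting the multiple must still give a normal pair. *)
Lemma normal_pair_C0 U a :
  jet_open U -> (a = 0 \/ forall z, U z -> cur_C0_domain z) ->
  normal_pair U (fun z => a * fst cur_C0 z) (fun z => a * snd cur_C0 z).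
Proof.
  intros HU [->|HD].
  { destruct (normal_pair_zero U HU) as [H1 H2 H3 H4 H5 H6].
    replace (fun z : jet => 0 * fst cur_C0 z) with (fun _ : jet => 0) by (extensionality z; ring).
    replace (fun z : jet => 0 * snd cur_C0 z) with (fun _ : jet => 0) by (extensionality z; ring).
    constructor; auto. }
  apply normal_pair_scal; unfold cur_C0; simpl fst; simpl snd.
  assert (Hc : forall c, (ord c <= 1)%nat -> DF 1 U (fun z => z c)) by (intros; apply DF_coord; auto).
  assert (Hi : forall i, i = r1 \/ i = r2 -> DF 1 U (fun z => / ux i z)).
  { intros i Hi; apply DF_inv; [apply Hc; auto|].
    intros z Hz; destruct (HD z Hz); destruct Hi; subst; auto. }
  assert (He : DF 1 U (fun z => exp (u r1 z - u r2 z))).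
  { apply DF_exp, DF_minus; apply Hc; auto. }
  assert (HV : forall i, DF 1 U (V i)).
  { intros []; unfold V, u; repeat first [apply DF_plus|apply DF_minus]; auto using DF_const. }
  assert (PR : forall c z, U z -> is_pder c
    (fun z => (1 * / z (pc r1) - 1 * / z (pc r2)) * exp (z (rc r1) - z (rc r2))) z
    (((if coord_eq_dec (pc r2) c then 1 else 0) / (z (pc r2)) ^ 2
      - (if coord_eq_dec (pc r1) c then 1 else 0) / (z (pc r1)) ^ 2) * exp (z (rc r1) - z (rc r2))
     + (1 * / z (pc r1) - 1 * / z (pc r2)) * exp (z (rc r1) - z (rc r2)) *
      ((if coord_eq_dec (rc r1) c then 1 else 0) - (if coord_eq_dec (rc r2) c then 1 else 0)))).
  { intros c z Hz; destruct (HD z Hz) as [D1 D2]; unfold ux in D1, D2.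
    eapply is_pder_eq; [pd; auto|]; cbv beta; field; auto. }
  assert (PS : forall c z, U z -> is_pder c
    (fun z => ((z (rc r1) + z (rc r2) + 1) * / z (pc r1) - (z (rc r1) + z (rc r2) - 1) * / z (pc r2)) *
       exp (z (rc r1) - z (rc r2))) z
    (((z (rc r1) + z (rc r2) - 1) * (if coord_eq_dec (pc r2) c then 1 else 0) / (z (pc r2)) ^ 2
      - (z (rc r1) + z (rc r2) + 1) * (if coord_eq_dec (pc r1) c then 1 else 0) / (z (pc r1)) ^ 2
      + ((if coord_eq_dec (rc r1) c then 1 else 0) + (if coord_eq_dec (rc r2) c then 1 else 0)) *
        (/ z (pc r1) - / z (pc r2))) * exp (z (rc r1) - z (rc r2))
     + ((z (rc r1) + z (rc r2) + 1) * / z (pc r1) - (z (rc r1) + z (rc r2) - 1) * / z (pc r2)) *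
      exp (z (rc r1) - z (rc r2)) *
      ((if coord_eq_dec (rc r1) c then 1 else 0) - (if coord_eq_dec (rc r2) c then 1 else 0)))).
  { intros c z Hz; destruct (HD z Hz) as [D1 D2]; unfold ux in D1, D2.
    eapply is_pder_eq; [pd; auto|]; cbv beta; field; auto. }
  assert (QR := fun c z Hz => is_pder_unique _ _ _ _ (PR c z Hz)).
  assert (QS := fun c z Hz => is_pder_unique _ _ _ _ (PS c z Hz)).
  unfold V, u, ux, Rdiv in *.
  constructor.
  - apply DF_mult; auto; apply DF_minus; apply DF_mult; auto using DF_const.
  - apply DF_mult; auto; apply DF_minus; apply DF_mult; auto; [apply (HV r1)|apply (HV r2)].
  - intros c z Hz Hd; rewrite QR by auto.
    destruct (Hd r1), (Hd r2); cdec; ring.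
  - intros c z Hz Hv Hd; rewrite QS by auto.
    destruct (Hd r1), (Hd r2); cdec; ring.
  - intros i z Hz; rewrite QR, QS by auto; destruct (HD z Hz) as [D1 D2]; unfold ux in D1, D2.
    unfold V, u, ux; destruct i; cdec; field; auto.
  - intros z Hz; unfold sum_dvar; rewrite !QR, !QS by auto.
    destruct (HD z Hz) as [D1 D2]; unfold ux in D1, D2.
    unfold V, u, ux; cdec; field; auto.
Qed.

Lemma normal_pair_C1 U D Omega :
  jet_open U -> smooth2 D Omega -> (forall z, U z -> cur_C1_domain D z) ->
  normal_pair U (fst (cur_C1 Omega)) (snd (cur_C1 Omega)).
Proof.
  intros HU HO HD; unfold cur_C1; simpl fst; simpl snd.
  assert (Hc : forall c, (ord c <= 1)%nat -> DF 1 U (fun z => z c)) by (intros; apply DF_coord; auto).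
  assert (H0 : DF 1 U omega0) by (apply Hc; auto).
  assert (H1 : DF 1 U omega1).
  { apply DF_mult; [apply Hc; auto|apply DF_exp, DF_minus; apply Hc; auto]. }
  assert (He : DF 1 U (fun z => exp (u r1 z - u r2 z))).
  { apply DF_exp, DF_minus; apply Hc; auto. }
  assert (HOm : DF 1 U (fun z => Omega (omega0 z) (omega1 z))) by (apply (DF_comp2 1 U D); auto).
  assert (HR : DF 1 U (fun z => exp (u r1 z - u r2 z) * Omega (omega0 z) (omega1 z))).
  { apply DF_mult; auto. }
  assert (HS : DF 1 U (fun z => (u r1 z + u r2 z) * exp (u r1 z - u r2 z) * Omega (omega0 z) (omega1 z))).
  { apply DF_mult; auto; apply DF_mult; auto; apply DF_plus; apply Hc; auto. }
  set (O0 := fun z => Derive (fun s => Omega s (omega1 z)) (omega0 z)).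
  set (O1 := fun z => Derive (fun s => Omega (omega0 z) s) (omega1 z)).
  set (d := fun (a c : coord) => if coord_eq_dec a c then 1 else 0).
  assert (PO : forall c z, U z -> is_pder c (fun z => Omega (omega0 z) (omega1 z)) z
    (O0 z * d (rc r3) c + O1 z * (d (pc r3) c * exp (z (rc r2) - z (rc r1)) +
      z (pc r3) * ((d (rc r2) c - d (rc r1) c) * exp (z (rc r2) - z (rc r1)))))).
  { intros c z Hz; apply (is_pder_comp2 c D); auto; [apply HD, Hz|apply is_pder_coord|].
    unfold omega1, ux, u; pd. }
  (* Cancels the exponential inside omega^1 against the prefactor, so that no exponential remains in
     front of the second partial derivative of Omega. *)
  assert (Ee : forall z : jet, exp (z (rc r1) - z (rc r2)) * exp (z (rc r2) - z (rc r1)) = 1).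
  { intros z; rewrite <- exp_plus, <- exp_0; f_equal; ring. }
  assert (PR : forall c z, U z -> is_pder c
    (fun z => exp (z (rc r1) - z (rc r2)) * Omega (omega0 z) (omega1 z)) z
    ((d (rc r1) c - d (rc r2) c) * exp (z (rc r1) - z (rc r2)) * Omega (omega0 z) (omega1 z) +
     exp (z (rc r1) - z (rc r2)) * O0 z * d (rc r3) c +
     O1 z * (d (pc r3) c + z (pc r3) * (d (rc r2) c - d (rc r1) c)))).
  { intros c z Hz; eapply is_pder_eq.
    - apply is_pder_mult; [pd|apply PO, Hz].
    - cbv beta; fold (d (rc r1) c) (d (rc r2) c); specialize (Ee z).
      transitivity ((d (rc r1) c - d (rc r2) c) * exp (z (rc r1) - z (rc r2)) * Omega (omega0 z) (omega1 z) +
        exp (z (rc r1) - z (rc r2)) * O0 z * d (rc r3) c +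
        O1 z * ((exp (z (rc r1) - z (rc r2)) * exp (z (rc r2) - z (rc r1))) *
        (d (pc r3) c + z (pc r3) * (d (rc r2) c - d (rc r1) c)))); [ring|].
      rewrite Ee; ring. }
  assert (PS : forall c z, U z -> is_pder c
    (fun z => (z (rc r1) + z (rc r2)) * exp (z (rc r1) - z (rc r2)) * Omega (omega0 z) (omega1 z)) z
    ((d (rc r1) c + d (rc r2) c) * (exp (z (rc r1) - z (rc r2)) * Omega (omega0 z) (omega1 z)) +
     (z (rc r1) + z (rc r2)) *
    ((d (rc r1) c - d (rc r2) c) * exp (z (rc r1) - z (rc r2)) * Omega (omega0 z) (omega1 z) +
     exp (z (rc r1) - z (rc r2)) * O0 z * d (rc r3) c +
     O1 z * (d (pc r3) c + z (pc r3) * (d (rc r2) c - d (rc r1) c))))).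
  { intros c z Hz.
    apply (is_pder_ext c (fun z => (z (rc r1) + z (rc r2)) *
      (exp (z (rc r1) - z (rc r2)) * Omega (omega0 z) (omega1 z)))); [intros; ring|].
    refine (is_pder_mult c (fun z => z (rc r1) + z (rc r2)) _ z _ _ _ (PR c z Hz)); pd. }
  assert (QR := fun c z Hz => is_pder_unique _ _ _ _ (PR c z Hz)).
  assert (QS := fun c z Hz => is_pder_unique _ _ _ _ (PS c z Hz)).
  unfold V, u, ux in *.
  constructor; auto.
  - intros c z Hz Hd; rewrite QR by auto; unfold d.
    destruct (Hd r1), (Hd r2), (Hd r3); cdec; ring.
  - intros c z Hz Hv Hd; rewrite QS by auto; unfold d.
    destruct (Hd r1), (Hd r2), (Hd r3); cdec; ring.
  - intros i z Hz; rewrite QR, QS by auto; unfold V, u, d.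
    destruct i; cdec; ring.
  - intros z Hz; unfold sum_dvar; rewrite !QR, !QS by auto; unfold V, u, ux, d; cdec; ring.
Qed.

Lemma smooth2_partial_derive_10 D f : smooth2 D f -> smooth2 D (partial_derive 1 0 f).
Proof. apply smooth2_partial. Qed.

Lemma smooth2_partial_derive_01 D f : smooth2 D f -> smooth2 D (partial_derive 0 1 f).
Proof. apply smooth2_partial. Qed.

Lemma partial_derive_01_10 f a b :
  Derive (fun s => partial_derive 0 1 f s b) a = partial_derive 1 1 f a b.
Proof. reflexivity. Qed.

Lemma partial_derive_10_01 D f a b :
  smooth2 D f -> D (a, b) -> Derive (fun s => partial_derive 1 0 f a s) b = partial_derive 1 1 f a b.
Proof.
  intros Hf Hab; generalize (partial_derive_d_t D 0 1 f a b Hf Hab).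
  intros <-; reflexivity.
Qed.

Lemma normal_pair_EHC U D Psi :
  jet_open U -> smooth2 D Psi -> Psi_equation D Psi -> (forall z, U z -> cur_EHC_domain D z) ->
  normal_pair U (fst (cur_EHC Psi)) (snd (cur_EHC Psi)).
Proof.
  intros HU HP HE HD; unfold cur_EHC; simpl fst; simpl snd.
  set (A := partial_derive 1 0 Psi); set (B := partial_derive 0 1 Psi).
  assert (HA : smooth2 D A) by (apply smooth2_partial_derive_10; auto).
  assert (HB : smooth2 D B) by (apply smooth2_partial_derive_01; auto).
  assert (Hc : forall c, (ord c <= 1)%nat -> DF 1 U (fun z => z c)) by (intros; apply DF_coord; auto).
  assert (FA : DF 1 U (fun z => A (u r1 z) (u r2 z))).
  { apply (DF_comp2 1 U D A); auto; apply Hc; auto. }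
  assert (FB : DF 1 U (fun z => B (u r1 z) (u r2 z))).
  { apply (DF_comp2 1 U D B); auto; apply Hc; auto. }
  set (d := fun (a c : coord) => if coord_eq_dec a c then 1 else 0).
  set (A1 := fun z => Derive (fun s => A s (u r2 z)) (u r1 z)).
  set (B2 := fun z => Derive (fun s => B (u r1 z) s) (u r2 z)).
  (* By the equation for Psi this is the mixed derivative Psi_{r^1 r^2}. *)
  set (M := fun z => (B (u r1 z) (u r2 z) - A (u r1 z) (u r2 z)) / 2).
  assert (PA : forall c z, U z -> is_pder c (fun z => A (u r1 z) (u r2 z)) z
    (A1 z * d (rc r1) c + M z * d (rc r2) c)).
  { intros c z Hz; eapply is_pder_eq.
    - apply (is_pder_comp2 c D A); auto; [apply HD, Hz|apply is_pder_coord|apply is_pder_coord].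
    - f_equal; f_equal; unfold A; rewrite (partial_derive_10_01 D) by (auto; apply HD, Hz).
      specialize (HE _ _ (HD z Hz)); unfold M, A, B; lra. }
  assert (PB : forall c z, U z -> is_pder c (fun z => B (u r1 z) (u r2 z)) z
    (M z * d (rc r1) c + B2 z * d (rc r2) c)).
  { intros c z Hz; eapply is_pder_eq.
    - apply (is_pder_comp2 c D B); auto; [apply HD, Hz|apply is_pder_coord|apply is_pder_coord].
    - f_equal; f_equal; unfold B; rewrite partial_derive_01_10.
      specialize (HE _ _ (HD z Hz)); unfold M, A, B; lra. }
  assert (PR : forall c z, U z -> is_pder c (fun z => A (u r1 z) (u r2 z) - B (u r1 z) (u r2 z)) z
    ((A1 z - M z) * d (rc r1) c + (M z - B2 z) * d (rc r2) c)).
  { intros c z Hz; eapply is_pder_eq; [apply is_pder_minus; [apply PA|apply PB]; auto|ring]. }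
  assert (PS : forall c z, U z -> is_pder c (fun z => (u r1 z + u r2 z + 1) * A (u r1 z) (u r2 z)
      - (u r1 z + u r2 z - 1) * B (u r1 z) (u r2 z)) z
    ((d (rc r1) c + d (rc r2) c) * (A (u r1 z) (u r2 z) - B (u r1 z) (u r2 z)) +
     (u r1 z + u r2 z + 1) * (A1 z * d (rc r1) c + M z * d (rc r2) c) -
     (u r1 z + u r2 z - 1) * (M z * d (rc r1) c + B2 z * d (rc r2) c))).
  { intros c z Hz; eapply is_pder_eq.
    - apply is_pder_minus; (apply is_pder_mult; [unfold u; pd|]); [apply PA|apply PB]; auto.
    - fold (d (rc r1) c) (d (rc r2) c); unfold u; ring. }
  assert (QR := fun c z Hz => is_pder_unique _ _ _ _ (PR c z Hz)).
  assert (QS := fun c z Hz => is_pder_unique _ _ _ _ (PS c z Hz)).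
  assert (HV1 : DF 1 U (fun z => u r1 z + u r2 z + 1)).
  { apply DF_plus; [apply DF_plus; apply Hc; auto|apply DF_const; auto]. }
  assert (HV2 : DF 1 U (fun z => u r1 z + u r2 z - 1)).
  { apply DF_minus; [apply DF_plus; apply Hc; auto|apply DF_const; auto]. }
  constructor.
  - apply DF_minus; auto.
  - apply DF_minus; apply DF_mult; auto.
  - intros c z Hz Hd; rewrite QR by auto; unfold d.
    destruct (Hd r1), (Hd r2); cdec; ring.
  - intros c z Hz Hv Hd; rewrite QS by auto; unfold d.
    destruct (Hd r1), (Hd r2); cdec; ring.
  - intros i z Hz; rewrite QR, QS by auto; unfold d.
    destruct i; cdec; ring.
  - intros z Hz; unfold sum_dvar; rewrite !QR, !QS by auto; unfold V, d, M; cdec; field.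
Qed.

(** * Reduction of the flux to first order *)

Lemma Dt_mono k m U F z : DF k U F -> U z -> (k <= m)%nat -> Dt m F z = Dt k F z.
Proof.
  intros HF Hz Hm; induction Hm as [|m Hm IH]; [reflexivity|].
  rewrite <- IH; unfold Dt, sum_dvar.
  assert (E : forall i, sum_f_R0 (fun m => sum_f_R0 (fun a => z (der i (S a) (m - a)) * pder (der i a (m - a)) F z) m) (S m) =
    sum_f_R0 (fun m => sum_f_R0 (fun a => z (der i (S a) (m - a)) * pder (der i a (m - a)) F z) m) m).
  { intros i; rewrite tech5, (sum_eq_R0 _ (S m)); [ring|]; intros a Ha.
    rewrite (DF_pder_high HF) by (auto; cbn [ord]; lia); ring. }
  rewrite !E; reflexivity.
Qed.

Lemma Dx_mono k m U F z : DF k U F -> U z -> (k <= m)%nat -> Dx m F z = Dx k F z.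
Proof.
  intros HF Hz Hm; induction Hm as [|m Hm IH]; [reflexivity|].
  rewrite <- IH; unfold Dx, sum_dvar.
  assert (E : forall i, sum_f_R0 (fun m => sum_f_R0 (fun a => z (der i a (S (m - a))) * pder (der i a (m - a)) F z) m) (S m) =
    sum_f_R0 (fun m => sum_f_R0 (fun a => z (der i a (S (m - a))) * pder (der i a (m - a)) F z) m) m).
  { intros i; rewrite tech5, (sum_eq_R0 _ (S m)); [ring|]; intros a Ha.
    rewrite (DF_pder_high HF) by (auto; cbn [ord]; lia); ring. }
  rewrite !E; reflexivity.
Qed.

Lemma jet_locally_proj z (P : jet -> Prop) :
  jet_locally (proj z) P -> jet_locally z (fun w => P (proj w)).
Proof.
  intros [n [e He]].
  assert (H : forall l, jet_locally z (fun w => forall c, In c l -> Rabs (proj w c - proj z c) < e)).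
  { induction l as [|c l IH].
    - apply (jet_locally_mono z (fun _ => True)); [easy|apply jet_locally_true].
    - refine (jet_locally_mono _ _ _ _ (jet_locally_and _ _ _ (proj1 (jcont_eps _ z)
        (DF_cont (DF_proj (ord c) (fun _ => True) c jet_open_true (le_n _)) z I) e) IH)).
      intros w [H1 H2] d [<-|Hd]; auto. }
  refine (jet_locally_mono _ _ _ _ (H (coords n))).
  intros w Hw; apply He; intros c Hc; apply Hw, in_coords, Hc.
Qed.

Lemma box_mono n n' (e : posreal) z0 z : (n' <= n)%nat -> box n e z0 z -> box n' e z0 z.
Proof. intros Hn H c Hc; apply H; lia. Qed.

(** Provides room to vary one coordinate: comparing an identity that is affine in this coordinate at
    two of its values extracts the coefficient. *)
Lemma box_shift n e z0 z c :
  (ord c <= n)%nat -> box n e z0 z -> exists d, d <> 0 /\ box n e z0 (upd z c (z c + d)).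
Proof.
  intros Hc Hz; assert (H := Hz c Hc); exists ((e - Rabs (z c - z0 c)) / 2); split; [lra|].
  apply box_upd; auto; set (d := (e - Rabs (z c - z0 c)) / 2).
  replace (z c + d - z0 c) with ((z c - z0 c) + d) by ring.
  eapply Rle_lt_trans; [apply Rabs_triang|].
  rewrite (Rabs_pos_eq d); unfold d; lra.
Qed.

Lemma pder_zero_on U F c z : jet_open U -> (forall w, U w -> F w = 0) -> U z -> pder c F z = 0.
Proof.
  intros HU H Hz; rewrite (pder_ext_loc c F (fun _ => 0)).
  - apply is_pder_unique, is_pder_const.
  - apply (jet_locally_mono z U); auto.
Qed.

Lemma pder_shift_inv k n e z0 F c d :
  DF k (box n e z0) F -> (k <= n)%nat -> (forall z, box n e z0 z -> pder c F z = 0) ->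
  forall z s, box n e z0 z -> box n e z0 (upd z c s) -> pder d F (upd z c s) = pder d F z.
Proof.
  intros HF Hk H z s Hz Hs; apply (box_upd_inv k n e z0); auto.
  - apply DF_pder, HF.
  - intros w Hw; rewrite (pder_comm k (box n e z0)) by auto.
    apply (pder_zero_on (box n e z0)); auto; apply jet_open_box.
Qed.

Section Restriction.
Context (U : jet -> Prop) (rho : jet -> R) (K : nat).
Context (Hrho : DF K U rho) (Hdep : first_order_tx_independent U rho).

Lemma DF_rho_1 : DF 1 U rho.
Proof.
  split; [apply (DF_open Hrho)|split; [|apply Hrho]].
  intros z w Hz Hw H; apply Hdep; auto; intros i; split; apply H; simpl; lia.
Qed.

Lemma pder_rho_dep c z : U z -> (forall i, c <> rc i /\ c <> pc i) -> pder c rho z = 0.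
Proof.
  intros Hz Hc; apply is_pder_unique.
  apply (is_derive_ext_loc (fun _ => rho z)); [|exact (is_derive_const (rho z) (z c))].
  refine (filter_imp _ _ _ (upd_locally z c U (DF_open Hrho z Hz))).
  intros s Hs; apply Hdep; auto; intros i; destruct (Hc i); unfold u, ux.
  rewrite !upd_other; auto.
Qed.

Lemma pder_rho_proj c z : U z -> U (proj z) -> pder c rho (proj z) = pder c rho z.
Proof.
  intros Hz Hp; destruct (classic (forall i, c <> rc i /\ c <> pc i)) as [Hc|Hc].
  { rewrite !pder_rho_dep; auto. }
  assert (E : proj z c = z c).
  { apply NNPP; intros Hne; apply Hc; intros i; split; intros ->; apply Hne, proj_x. }
  unfold pder; rewrite E; apply Derive_ext_loc.
  refine (filter_imp (fun s => U (upd z c s) /\ U (upd (proj z) c s)) _ _ (filter_and _ _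
    (upd_locally z c U (DF_open Hrho z Hz)) _)).
  - intros s [H1 H2]; apply Hdep; auto; intros i; unfold u, ux, upd.
    rewrite !proj_x; auto.
  - rewrite <- E; apply (upd_locally (proj z) c U (DF_open Hrho _ Hp)).
Qed.

(** Equals - D_t rho after r^i_t and r^i_tx have been eliminated by means of the equations; the
    r^i_xx enter linearly, and nothing of higher order enters. *)
Definition flux_rhs (z : jet) : R :=
  sum_dvar (fun i => V i z * ux i z * pder (rc i) rho z +
    (V i z * z (der i 0 2) + (ux r1 z + ux r2 z) * ux i z) * pder (pc i) rho z).

Lemma Dt_rho_proj z : U z -> U (proj z) -> Dt 1 rho (proj z) = - flux_rhs z.
Proof.
  intros Hz Hp.
  assert (D0 : forall i, pder (der i 1 0) rho z = 0).
  { intros i; apply pder_rho_dep; auto; split; discriminate. }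
  assert (D2 : pder (ind vt) rho z = 0).
  { apply pder_rho_dep; auto; split; discriminate. }
  generalize (fun c => pder_rho_proj c z Hz Hp) (fun i => proj_t i z) (fun i => proj_tx i z).
  generalize (proj z); intros w Ep Et Ex; unfold Dt, flux_rhs, sum_dvar; simpl sum_f_R0; simpl Nat.sub.
  rewrite !Ep, !D0, D2, !Et, !Ex; ring.
Qed.
End Restriction.

Lemma conserved_normal_pair U rho sigma z0 :
  conserved_current U (rho, sigma) -> first_order_tx_independent U rho ->
  U z0 -> (forall c, z0 c = proj z0 c) ->
  exists n e, (2 <= n)%nat /\ (forall z, box n e z0 z -> U z /\ U (proj z)) /\
    normal_pair (box n e z0) rho (fun z => sigma (proj z)).
Proof.
  intros [k [[Hr Hs] Hv]] Hdep Hz0 HE; simpl in Hr, Hs.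
  assert (HU := DF_open Hr); set (K := S (S k)).
  assert (Hr1 := DF_rho_1 U rho k Hr Hdep).
  assert (Hz0p : proj z0 = z0) by (extensionality c; auto).
  assert (Hloc : jet_locally z0 (fun z => U z /\ U (proj z))).
  { apply jet_locally_and; auto; apply jet_locally_proj; rewrite Hz0p; auto. }
  (* [box_shift] is applied below to coordinates of order up to [S K], one more than the restricted
     flux F is known to have. *)
  destruct Hloc as [n0 [e He]]; set (n := Nat.max n0 (S K)); exists n, e.
  set (B := box n e z0).
  assert (HB : forall z, B z -> U z /\ U (proj z)).
  { intros z Hz; apply He; apply (box_mono n); auto; unfold n; lia. }
  split; [unfold n, K; lia|split; [exact HB|]].
  assert (HBo : jet_open B) by apply jet_open_box.
  set (F := fun z => sigma (proj z)).
  assert (HF : DF K B F).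
  { apply (DF_comp K B K U sigma proj); auto.
    - apply (DF_mono Hs); unfold K; lia.
    - intros z Hz; apply HB, Hz.
    - intros c Hc; apply DF_proj; auto. }
  assert (EQ : forall z, B z -> Dx K F z = flux_rhs rho z).
  { intros z Hz; destruct (HB z Hz) as [H1 H2].
    generalize (conservation_on_equations k U (rho, sigma) z (conj Hr Hs) Hv H2); simpl.
    rewrite <- (Dt_mono k K U rho), (Dt_mono 1 K U rho) by (auto; unfold K; lia).
    rewrite <- (Dx_mono k K U sigma) by (auto; unfold K; lia).
    rewrite (Dt_rho_proj U rho k Hr Hdep) by auto.
    unfold F; rewrite (Dx_proj K U B sigma z (DF_mono Hs K ltac:(unfold K; lia)) HBo
      (fun w Hw => proj2 (HB w Hw)) Hz).
    lra. }
  assert (Hkn : (K <= n)%nat) by (unfold n; lia).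
  assert (Rinv : forall z c s, B z -> B (upd z c s) -> (1 < ord c)%nat ->
    (forall i, c <> der i 0 2) -> flux_rhs rho (upd z c s) = flux_rhs rho z).
  { intros z c s Hz Hw Hc Hc2; unfold flux_rhs.
    assert (Ep : forall d, pder d rho (upd z c s) = pder d rho z).
    { intros d; apply (DF_dep (DF_pder Hr1 d)); try (apply HB; assumption).
      intros c' Hc'; apply upd_other; intros ->; lia. }
    assert (Ec : forall d, (ord d <= 1)%nat -> upd z c s d = z d).
    { intros d Hd; apply upd_other; intros ->; lia. }
    assert (E2 : forall i, upd z c s (der i 0 2) = z (der i 0 2)).
    { intros i; apply upd_other; auto. }
    assert (EV : forall i, V i (upd z c s) = V i z).
    { intros i; destruct i; unfold V, u; rewrite !Ec by (simpl; lia); reflexivity. }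
    unfold sum_dvar, ux; rewrite !Ep, !EV, !E2, !Ec by (simpl; lia); reflexivity. }
  (* [proj] reads t, x and x-derivatives only, so F cannot depend on a coordinate with a
     t-derivative. *)
  assert (Htd : forall i a b z, B z -> pder (der i (S a) b) F z = 0).
  { intros i a b z Hz; apply is_pder_unique.
    apply (is_derive_ext (fun _ => F z)); [|exact (is_derive_const (F z) (z (der i (S a) b)))].
    intros s; unfold F; f_equal; extensionality c.
    refine (proj_dep z (upd z (der i (S a) b) s) _ (ord c) _ c (le_n _)).
    - intros v; symmetry; apply upd_other; discriminate.
    - intros j m _; symmetry; apply upd_other; discriminate. }
  (* Downward induction on b, with j bounding the distance to the top order. Once F is free of the
     x-derivative of order b + 1, D_x F is affine in it with slope the derivative of F by the one of
     order b, whereas [flux_rhs] is free of it because b + 1 exceeds 2. *)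
  assert (Hhigh : forall j b, (2 <= b)%nat -> (K < b + j)%nat ->
    forall i z, B z -> pder (der i 0 b) F z = 0).
  { induction j as [|j IH]; intros b Hb2 HbK i z Hz.
    - apply (DF_pder_high HF); auto; simpl; lia.
    - destruct (le_lt_dec b K) as [HbK'|HbK']; [|apply (DF_pder_high HF); auto; simpl; lia].
      set (c' := der i 0 (S b)).
      assert (Hc' : forall w, B w -> pder c' F w = 0) by (intros w Hw; apply IH; auto; lia).
      destruct (box_shift n e z0 z c') as [d [Hd Hw]]; [unfold c', n; simpl; lia|auto|].
      set (w := upd z c' (z c' + d)) in *.
      assert (E : Dx K F w - Dx K F z = 0).
      { rewrite !EQ by auto; unfold w; rewrite Rinv; auto; [ring|unfold c'; simpl; lia|].
        intros i'; unfold c'; intros E; injection E; lia. }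
      rewrite !Dx_lsum, lsum_minus in E.
      rewrite (lsum_single _ _ (der i 0 b)) in E; [|apply NoDup_coords|apply in_coords; simpl; lia|].
      + unfold w in E; rewrite (pder_shift_inv K n e z0) in E; auto.
        unfold dxc in E; fold c' in E; rewrite upd_same in E.
        replace ((z c' + d) * pder (der i 0 b) F z - z c' * pder (der i 0 b) F z)
          with (d * pder (der i 0 b) F z) in E by ring.
        apply Rmult_integral in E; destruct E; [contradiction|auto].
      + intros c Hc; unfold w; rewrite (pder_shift_inv K n e z0) by auto.
        replace (dxc (upd z c' (z c' + d)) c) with (dxc z c); [ring|].
        destruct c as [[]|i' a b']; try reflexivity; unfold dxc; symmetry; apply upd_other.
        unfold c'; intros E'; apply Hc; congruence. }
  assert (Hhigh' : forall i b z, B z -> (2 <= b)%nat -> pder (der i 0 b) F z = 0).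
  { intros i b z Hz Hb; apply (Hhigh (S K)); auto; lia. }
  assert (HF1 : DF 1 B F).
  { split; [exact HBo|split; [|apply HF]].
    intros z w Hz Hw H; apply (box_dep K n e z0 F (fun c => (ord c <= 1)%nat)); auto.
    intros [v|i [|a] b] x Hx Hc; simpl in Hc; [lia| |apply Htd; auto].
    apply Hhigh'; auto; lia. }
  assert (EQ1 : forall z, B z -> pder (ind vx) F z + sum_dvar (fun i => ux i z * pder (rc i) F z) +
    sum_dvar (fun i => z (der i 0 2) * pder (pc i) F z) = flux_rhs rho z).
  { intros z Hz; rewrite <- EQ, (Dx_mono 1 K B) by (auto; unfold K; lia).
    unfold Dx, sum_dvar, ux; simpl sum_f_R0; simpl Nat.sub; rewrite !Htd by auto; ring. }
  (* The coefficients of r^i_xx on both sides of EQ1, extracted by shifting that coordinate. *)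
  assert (Htop : forall i z, B z -> pder (pc i) F z = V i z * pder (pc i) rho z).
  { intros i z Hz; set (c := der i 0 2).
    destruct (box_shift n e z0 z c) as [d [Hd Hw]]; [unfold c, n, K; simpl; lia|auto|].
    assert (E1 := EQ1 z Hz); assert (E2 := EQ1 _ Hw).
    assert (Hc0 : forall w, B w -> pder c F w = 0) by (intros; apply Hhigh'; auto).
    assert (EF : forall d', pder d' F (upd z c (z c + d)) = pder d' F z).
    { intros d'; apply (pder_shift_inv K n e z0); auto. }
    assert (Er : forall d', pder d' rho (upd z c (z c + d)) = pder d' rho z).
    { intros d'; apply (DF_dep (DF_pder Hr1 d')); try (apply HB; assumption).
      intros c' Hc'; apply upd_other; intros ->; simpl in Hc'; lia. }
    assert (Ec : forall d', d' <> c -> upd z c (z c + d) d' = z d').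
    { intros d' Hd'; apply upd_other; auto. }
    assert (Es : upd z c (z c + d) c = z c + d) by apply upd_same.
    unfold flux_rhs, sum_dvar in E1, E2; rewrite !EF, !Er in E2.
    apply (Rmult_eq_reg_l d); auto.
    unfold c in *; destruct i; unfold V, u, ux in E1, E2 |- *;
      rewrite !Es, !Ec in E2 by discriminate;
      apply Rminus_diag_uniq;
      apply (f_equal2 Rminus E2) in E1; ring_simplify in E1;
      apply Rminus_diag_eq in E1; (refine (eq_trans _ E1); ring). }
  constructor.
  - apply (DF_sub Hr1); auto; intros; apply HB; auto.
  - exact HF1.
  - intros c z Hz Hc; apply (pder_rho_dep U rho k Hr Hdep); auto; apply HB, Hz.
  - intros [v|i [|a] [|[|b]]] z Hz Hcv Hc; try (apply Htd; auto).
    + destruct (Hcv v); auto.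
    + destruct (Hc i) as [[] _]; auto.
    + destruct (Hc i) as [_ []]; auto.
    + apply Hhigh'; auto; lia.
  - exact Htop.
  - intros z Hz; generalize (EQ1 z Hz); unfold sum_dvar, flux_rhs, sum_dvar.
    rewrite !Htop by auto; intros E; apply Rminus_diag_eq in E; apply Rminus_diag_uniq.
    refine (eq_trans _ E); ring.
Qed.

(** * Determining equations *)

Lemma if_coord_same (c : coord) (a b : R) : (if coord_eq_dec c c then a else b) = a.
Proof. destruct (coord_eq_dec c c); congruence. Qed.

Lemma if_coord_diff (c d : coord) (a b : R) : c <> d -> (if coord_eq_dec c d then a else b) = b.
Proof. destruct (coord_eq_dec c d); congruence. Qed.

Ltac cdec_in E := cbv beta in E;
  repeat match type of E with
  | context [coord_eq_dec ?a ?a] => destruct (coord_eq_dec a a) as [_|]; [|congruence]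
  | context [coord_eq_dec ?a ?b] => destruct (coord_eq_dec a b) as [?Heq|_]; [discriminate Heq|]
  end.

Ltac df := repeat apply DF_pder; eassumption.
Ltac pdb := pd; try (lazymatch goal with
  | |- is_pder _ (fun w => ?F w) _ _ => eapply (DF_is_pder (F := F)); [df|eassumption]
  | |- is_pder _ ?F _ _ => eapply (DF_is_pder (F := F)); [df|eassumption]
  end).

(* Differentiates the identity H along the coordinate c at z. *)
Ltac diff_eq H HBo c z Hz E :=
  eassert (E : _ = _) by
    (eapply (is_pder_open_eq _ c _ _ z _ _ HBo H Hz); pdb); cdec_in E.

Lemma V_offset i z : V i z = z (rc r1) + z (rc r2) + speed_offset i.
Proof. destruct i; unfold V, u; simpl; ring. Qed.

(** The derivative of V^j along r^i, the same for every j. *)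
Definition in12 (i : dvar) : R := match i with r3 => 0 | _ => 1 end.

Section Structure.
Context (n : nat) (e : posreal) (z0 : jet) (rho flux : jet -> R) (Hn : (2 <= n)%nat).
Notation B := (box n e z0).
Context (HN : normal_pair B rho flux).

Notation P i := (pder (pc i) rho).
Notation Q i := (pder (pc i) (pder (pc i) rho)).
Notation M i j := (pder (rc i) (pder (pc j) rho)).

Let HBo : jet_open B := jet_open_box n e z0.
Let Hrho : DF 1 B rho := np_rho _ _ _ HN.
Let HS : DF 1 B flux := np_flux _ _ _ HN.

Lemma pder_swap F c d z : DF 1 B F -> B z -> pder c (pder d F) z = pder d (pder c F) z.
Proof. apply pder_comm. Qed.

Lemma pder_of_zero F c d z :
  DF 1 B F -> (forall w, B w -> pder c F w = 0) -> B z -> pder c (pder d F) z = 0.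
Proof.
  intros HF H Hz; rewrite pder_swap by auto; apply (pder_zero_on B); auto.
Qed.

Lemma top_eq i z : B z ->
  pder (pc i) flux z = (z (rc r1) + z (rc r2) + speed_offset i) * P i z.
Proof. intros Hz; rewrite (np_top _ _ _ HN) by auto; now rewrite V_offset. Qed.

Lemma rest_eq z : B z ->
  pder (ind vx) flux z + (z (pc r1) * pder (rc r1) flux z + z (pc r2) * pder (rc r2) flux z
    + z (pc r3) * pder (rc r3) flux z) =
  (z (rc r1) + z (rc r2) + 1) * z (pc r1) * pder (rc r1) rho z +
  (z (rc r1) + z (rc r2) - 1) * z (pc r2) * pder (rc r2) rho z +
  (z (rc r1) + z (rc r2)) * z (pc r3) * pder (rc r3) rho z +
  (z (pc r1) + z (pc r2)) * (z (pc r1) * P r1 z + z (pc r2) * P r2 z + z (pc r3) * P r3 z).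
Proof. exact (np_rest _ _ _ HN z). Qed.

Lemma rho_ind v d z : B z -> pder (ind v) (pder d rho) z = 0.
Proof.
  intros Hz; apply pder_of_zero; auto; intros w Hw.
  apply (np_rho_dep _ _ _ HN); auto; split; discriminate.
Qed.

Lemma flux_rp i j z : B z ->
  pder (pc j) (pder (rc i) flux) z =
  in12 i * P j z + (z (rc r1) + z (rc r2) + speed_offset j) * M i j z.
Proof.
  intros Hz; rewrite pder_swap by auto.
  destruct i; [diff_eq (top_eq j) HBo (rc r1) z Hz E|diff_eq (top_eq j) HBo (rc r2) z Hz E
    |diff_eq (top_eq j) HBo (rc r3) z Hz E]; rewrite E; simpl in12; ring.
Qed.

(** Cross-differentiating [top_eq] gives (V^i - V^j) rho_{r^i_x r^j_x} = 0, and the speeds are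
    distinct. *)
Lemma rho_pp i j z : i <> j -> B z -> pder (pc j) (P i) z = 0.
Proof.
  intros Hij Hz.
  diff_eq (top_eq i) HBo (pc j) z Hz Ei.
  diff_eq (top_eq j) HBo (pc i) z Hz Ej.
  rewrite pder_swap, Ej, (pder_swap rho (pc i)) in Ei by auto.
  assert (D : speed_offset i - speed_offset j <> 0) by (destruct i, j; simpl; try congruence; lra).
  apply (Rmult_eq_reg_l (speed_offset i - speed_offset j)); [|exact D]; lra.
Qed.

Lemma rho_pp_p i j c z : i <> j -> B z -> pder (pc j) (pder c (P i)) z = 0.
Proof. intros Hij Hz; apply pder_of_zero; [df| |auto]; intros; apply rho_pp; auto. Qed.

Lemma flux_ind_p v j z : B z -> pder (pc j) (pder (ind v) flux) z = 0.
Proof.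
  intros Hz; rewrite pder_swap by auto.
  diff_eq (top_eq j) HBo (ind v) z Hz E; rewrite E, rho_ind by auto; ring.
Qed.

(* Derivative of rest_eq with respect to r^j_x; four_eq and five_eq are its derivatives with respect to
   r^k_x, k <> j, and to r^j_x. *)
Lemma flux_r j z : B z ->
  pder (rc j) flux z =
  (z (rc r1) + z (rc r2) + speed_offset j) * pder (rc j) rho z +
  ((speed_offset r1 - speed_offset j) * z (pc r1) * M r1 j z +
   (speed_offset r2 - speed_offset j) * z (pc r2) * M r2 j z +
   (speed_offset r3 - speed_offset j) * z (pc r3) * M r3 j z) +
  in12 j * (z (pc r1) * P r1 z + z (pc r2) * P r2 z + z (pc r3) * P r3 z) +
  (z (pc r1) + z (pc r2)) * (z (pc j) * Q j z).
Proof.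
  intros Hz; destruct j;
    [diff_eq rest_eq HBo (pc r1) z Hz E|diff_eq rest_eq HBo (pc r2) z Hz E
    |diff_eq rest_eq HBo (pc r3) z Hz E];
    rewrite flux_ind_p, !flux_rp, ?(pder_swap rho (pc _) (rc _)) in E by auto;
    rewrite ?(rho_pp r1 r2), ?(rho_pp r1 r3), ?(rho_pp r2 r1), ?(rho_pp r2 r3),
      ?(rho_pp r3 r1), ?(rho_pp r3 r2) in E by (try discriminate; assumption);
    simpl speed_offset in *; simpl in12 in *; lra.
Qed.

Lemma rho_rp_p i j z : B z -> pder (pc j) (M i j) z = pder (rc i) (Q j) z.
Proof. intros Hz; apply pder_swap; auto; df. Qed.

Lemma four_eq j k z : j <> k -> B z ->
  (speed_offset k - speed_offset j) * (M j k z - M k j z) =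
  in12 j * z (pc k) * Q k z + in12 k * z (pc j) * Q j z.
Proof.
  intros Hjk Hz; destruct j, k; try congruence;
  match goal with |- (speed_offset ?k - speed_offset ?j) * _ = _ =>
    diff_eq (flux_r j) HBo (pc k) z Hz E;
    rewrite flux_rp, (pder_swap rho (pc k)) in E by auto;
    rewrite !(rho_pp_p j k), ?(rho_pp r1 r2), ?(rho_pp r1 r3), ?(rho_pp r2 r1), ?(rho_pp r2 r3),
      ?(rho_pp r3 r1), ?(rho_pp r3 r2) in E by (try discriminate; assumption)
  end; simpl speed_offset in *; simpl in12 in *; lra.
Qed.

Lemma five_eq j z : B z ->
  (speed_offset r1 - speed_offset j) * z (pc r1) * pder (rc r1) (Q j) z +
  (speed_offset r2 - speed_offset j) * z (pc r2) * pder (rc r2) (Q j) z +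
  (speed_offset r3 - speed_offset j) * z (pc r3) * pder (rc r3) (Q j) z +
  2 * in12 j * z (pc j) * Q j z +
  (z (pc r1) + z (pc r2)) * (Q j z + z (pc j) * pder (pc j) (Q j) z) = 0.
Proof.
  intros Hz; destruct j;
  match goal with |- context [2 * in12 ?j] =>
    diff_eq (flux_r j) HBo (pc j) z Hz E;
    rewrite flux_rp, (pder_swap rho (pc j) (rc j)), !rho_rp_p in E by auto;
    rewrite ?(rho_pp r1 r2), ?(rho_pp r1 r3), ?(rho_pp r2 r1), ?(rho_pp r2 r3),
      ?(rho_pp r3 r1), ?(rho_pp r3 r2) in E by (try discriminate; assumption)
  end; simpl speed_offset in *; simpl in12 in *; lra.
Qed.

Lemma Q_p i j z : i <> j -> B z -> pder (pc i) (Q j) z = 0.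
Proof. intros; apply rho_pp_p; auto. Qed.

Lemma Q_pp i j c z : i <> j -> B z -> pder (pc i) (pder c (Q j)) z = 0.
Proof. intros; apply pder_of_zero; auto; [df|]; intros; apply Q_p; auto. Qed.

(** The second derivative [Q j] does not involve r^i_x for i <> j, so [five_eq] is affine in r^i_x
    and the slope vanishes separately. What then remains of the equation is [five_rest]. *)
Lemma five_coef i j z : i <> j -> B z ->
  (speed_offset i - speed_offset j) * pder (rc i) (Q j) z +
  in12 i * (Q j z + z (pc j) * pder (pc j) (Q j) z) = 0.
Proof.
  intros Hij Hz; destruct i, j; try congruence;
  match goal with |- (speed_offset ?i - speed_offset ?j) * _ + _ = _ =>
    diff_eq (five_eq j) HBo (pc i) z Hz E;
    rewrite !(Q_pp i j), !(Q_p i j) in E by (try discriminate; assumption)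
  end; simpl speed_offset in *; simpl in12 in *; lra.
Qed.

Lemma five_rest j z : B z ->
  in12 j * (z (pc j) * (3 * Q j z + z (pc j) * pder (pc j) (Q j) z)) = 0.
Proof.
  intros Hz; generalize (five_eq j z Hz).
  destruct j; [generalize (five_coef r2 r1 z ltac:(discriminate) Hz) (five_coef r3 r1 z ltac:(discriminate) Hz)
    |generalize (five_coef r1 r2 z ltac:(discriminate) Hz) (five_coef r3 r2 z ltac:(discriminate) Hz)
    |simpl; intros; ring];
  simpl; intros Ha Hb E.
  - apply (f_equal (Rmult (z (pc r2)))) in Ha; apply (f_equal (Rmult (z (pc r3)))) in Hb; lra.
  - apply (f_equal (Rmult (z (pc r1)))) in Ha; apply (f_equal (Rmult (z (pc r3)))) in Hb; lra.
Qed.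

(** For i = 1, 2, [five_rest] is the Euler equation of homogeneity degree -3 in r^i_x for [Q i]; the
    third power compensates for it, so that no dependence on r^i_x remains. *)
Definition cubic (i : dvar) (z : jet) : R := z (pc i) * (z (pc i) * (z (pc i) * Q i z)).

(** When [flux_r] is substituted into [rest_eq], the first derivatives of rho cancel and [four_eq]
    eliminates the mixed second derivatives in pairs; the terms with [Q r3] cancel too. *)
Lemma flux_x_cubic z : B z -> pder (ind vx) flux z + cubic r1 z + cubic r2 z = 0.
Proof.
  intros Hz; generalize (rest_eq z Hz); rewrite !flux_r by auto.
  assert (H12 := f_equal (Rmult (z (pc r1) * z (pc r2))) (four_eq r1 r2 z ltac:(discriminate) Hz)).
  assert (H13 := f_equal (Rmult (z (pc r1) * z (pc r3))) (four_eq r1 r3 z ltac:(discriminate) Hz)).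
  assert (H23 := f_equal (Rmult (z (pc r2) * z (pc r3))) (four_eq r2 r3 z ltac:(discriminate) Hz)).
  unfold cubic; simpl speed_offset in *; simpl in12 in *; lra.
Qed.

Lemma flux_ind_rest v z : B z ->
  pder (ind vx) (pder (ind v) flux) z + (z (pc r1) * pder (rc r1) (pder (ind v) flux) z
   + z (pc r2) * pder (rc r2) (pder (ind v) flux) z + z (pc r3) * pder (rc r3) (pder (ind v) flux) z) = 0.
Proof.
  intros Hz; diff_eq rest_eq HBo (ind v) z Hz E.
  rewrite !rho_ind, !(pder_swap flux (ind v)) in E by auto; lra.
Qed.

(** The t- and x-derivatives of the flux are free of the r^i_x, so [flux_ind_rest] is affine in
    r^j_x, with this expression as its slope. *)
Lemma flux_ind_r v j z : B z -> pder (rc j) (pder (ind v) flux) z = 0.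
Proof.
  assert (Hpp : forall c w, B w -> pder (pc j) (pder c (pder (ind v) flux)) w = 0).
  { intros c w Hw; apply pder_of_zero; [df| |auto]; intros; apply flux_ind_p; auto. }
  intros Hz; destruct j;
    [diff_eq (flux_ind_rest v) HBo (pc r1) z Hz E|diff_eq (flux_ind_rest v) HBo (pc r2) z Hz E
    |diff_eq (flux_ind_rest v) HBo (pc r3) z Hz E]; rewrite !Hpp in E by auto; lra.
Qed.

Lemma DF_cubic i : DF 1 B (cubic i).
Proof. repeat apply DF_mult; try (apply DF_coord; auto); df. Qed.

Lemma cubic_pder i c z : B z -> c <> pc i ->
  pder c (cubic i) z = z (pc i) * (z (pc i) * (z (pc i) * pder c (Q i) z)).
Proof.
  intros Hz Hc; apply is_pder_unique; unfold cubic; eapply is_pder_eq; [pdb|].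
  cbv beta; rewrite if_coord_diff by auto; ring.
Qed.

Lemma cubic_p i j z : in12 i = 1 -> B z -> pder (pc j) (cubic i) z = 0.
Proof.
  intros Hi Hz; destruct (coord_eq_dec (pc j) (pc i)) as [E|Hji].
  - injection E as ->; apply is_pder_unique; unfold cubic; eapply is_pder_eq; [pdb|].
    cbv beta; rewrite if_coord_same.
    transitivity (z (pc i) * (z (pc i) * (3 * Q i z + z (pc i) * pder (pc i) (Q i) z))); [ring|].
    generalize (five_rest i z Hz); rewrite Hi, Rmult_1_l; intros ->; ring.
  - rewrite cubic_pder, Q_p by (congruence || auto); ring.
Qed.

Lemma cubic_r i j z : in12 i = 1 -> i <> j -> B z ->
  (speed_offset j - speed_offset i) * pder (rc j) (cubic i) z = 2 * in12 j * cubic i z.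
Proof.
  intros Hi Hij Hz; rewrite cubic_pder by (auto; discriminate); unfold cubic.
  assert (Ha := f_equal (fun x => z (pc i) * (z (pc i) * (z (pc i) * x)))
    (five_coef j i z ltac:(auto) Hz)).
  assert (Hb := f_equal (fun x => in12 j * (z (pc i) * (z (pc i) * x))) (five_rest i z Hz)).
  rewrite Hi in Hb; simpl in Ha, Hb; lra.
Qed.

Lemma cubic_other i c z : B z -> (forall i, c <> rc i /\ c <> pc i) -> pder c (cubic i) z = 0.
Proof.
  intros Hz Hc; rewrite cubic_pder by (auto; apply Hc).
  replace (pder c (Q i) z) with 0; [ring|]; symmetry.
  apply pder_of_zero; auto; [df|]; intros; apply pder_of_zero; auto.
  intros; apply (np_rho_dep _ _ _ HN); auto.
Qed.

Lemma cubic_r2_1 z : B z -> pder (rc r2) (cubic r1) z = - cubic r1 z.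
Proof.
  intros Hz; generalize (cubic_r r1 r2 z eq_refl ltac:(discriminate) Hz); simpl; lra.
Qed.

Lemma cubic_r1_1 z : B z -> pder (rc r1) (cubic r1) z = - cubic r2 z.
Proof.
  intros Hz; assert (H1 := DF_cubic r1); assert (H2 := DF_cubic r2).
  diff_eq flux_x_cubic HBo (rc r1) z Hz E; rewrite flux_ind_r in E by auto.
  generalize (cubic_r r2 r1 z eq_refl ltac:(discriminate) Hz); simpl; lra.
Qed.

(** Integrability condition: the mixed r^1, r^2 derivative of [cubic r1] is computed in both orders,
    with the r^2-derivative of [cubic r2] taken from [flux_x_cubic]. *)
Lemma cubic_opp z : B z -> cubic r2 z = - cubic r1 z.
Proof.
  intros Hz; assert (H1 := DF_cubic r1); assert (H2 := DF_cubic r2).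
  diff_eq cubic_r2_1 HBo (rc r1) z Hz Ea.
  diff_eq cubic_r1_1 HBo (rc r2) z Hz Eb.
  diff_eq flux_x_cubic HBo (rc r2) z Hz Ec; rewrite flux_ind_r, cubic_r2_1 in Ec by auto.
  rewrite pder_swap, Eb, cubic_r1_1 in Ea by auto; lra.
Qed.

Lemma flux_x z : B z -> pder (ind vx) flux z = 0.
Proof. intros Hz; generalize (flux_x_cubic z Hz); rewrite cubic_opp by auto; lra. Qed.

Lemma cubic_exp : exists c, forall z, B z -> cubic r1 z = c * exp (z (rc r1) - z (rc r2)).
Proof.
  assert (H1 := DF_cubic r1).
  set (g := fun z => cubic r1 z * exp (- (z (rc r1) - z (rc r2)))).
  assert (Hg : DF 1 B g).
  { apply DF_mult; auto; apply DF_exp, DF_opp, DF_minus; apply DF_coord; auto. }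
  assert (Hg0 : forall c z, B z -> pder c g z = 0).
  { intros c z Hz; apply is_pder_unique; eapply is_pder_eq; [unfold g; pdb|]; cbv beta.
    destruct (classic (forall i, c <> rc i /\ c <> pc i)) as [Hc|Hc].
    - rewrite cubic_other, !if_coord_diff by (auto; intros <-; destruct (Hc r1), (Hc r2); auto); ring.
    - apply not_all_ex_not in Hc; destruct Hc as [i Hi].
      destruct (coord_eq_dec c (pc i)) as [->|Hp].
      + rewrite cubic_p, !if_coord_diff by (auto; discriminate); ring.
      + destruct (coord_eq_dec c (rc i)) as [->|Hr]; [|destruct Hi; auto].
        destruct i.
        * rewrite cubic_r1_1, cubic_opp, if_coord_same, if_coord_diff by (auto; discriminate); ring.
        * rewrite cubic_r2_1, if_coord_same, if_coord_diff by (auto; discriminate); ring.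
        * generalize (cubic_r r1 r3 z eq_refl ltac:(discriminate) Hz); simpl speed_offset; simpl in12.
          rewrite !if_coord_diff by discriminate; intros E.
          replace (pder (rc r3) (cubic r1) z) with 0 by lra; ring. }
  exists (g z0); intros z Hz.
  rewrite <- (box_dep 1 n e z0 g (fun _ => False) Hg ltac:(lia) (fun c w Hw _ => Hg0 c w Hw)
    z z0 Hz (box_center _ _ _)) by easy.
  unfold g; rewrite Rmult_assoc, <- exp_plus, Rplus_opp_l, exp_0; ring.
Qed.
End Structure.

(** * Splitting off C_0 and C_1 *)

(** Vanishing of a cubic gives vanishing of the second derivative only after division by r^i_x;
    continuity fills in the points with r^i_x = 0. *)
Lemma zero_off_hyperplane k U F c :
  DF k U F -> (forall z, U z -> z c <> 0 -> F z = 0) -> forall z, U z -> F z = 0.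
Proof.
  intros HF H z Hz; apply NNPP; intros Hne.
  destruct (Req_dec (z c) 0) as [Hc|Hc]; [|auto].
  assert (He : 0 < Rabs (F z)) by (apply Rabs_pos_lt; auto).
  destruct (upd_locally z c _ (jet_locally_and z _ _ (DF_open HF z Hz)
    (proj1 (jcont_eps F z) (DF_cont HF z Hz) (mkposreal _ He)))) as [d Hd].
  destruct (Hd (z c + d / 2)) as [H1 H2].
  { change (Rabs (z c + d / 2 - z c) < d); assert (Hd0 := cond_pos d).
    replace (z c + d / 2 - z c) with (d / 2) by ring; rewrite Rabs_pos_eq; lra. }
  simpl in H2; rewrite H in H2; auto.
  - rewrite Rminus_0_l, Rabs_Ropp in H2; lra.
  - rewrite upd_same; assert (Hd0 := cond_pos d); lra.
Qed.

Notation Qd rho i := (pder (pc i) (pder (pc i) rho)).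

Lemma C0_density_pp U a z :
  jet_open U -> (forall z, U z -> cur_C0_domain z) -> U z ->
  z (pc r1) * (z (pc r1) * (z (pc r1) * Qd (fun z => a * fst cur_C0 z) r1 z))
  = 2 * a * exp (z (rc r1) - z (rc r2)).
Proof.
  intros HU HD Hz.
  assert (H1 : forall w, U w -> is_pder (pc r1) (fun z => a * fst cur_C0 z) w
    (- a * (/ w (pc r1) * / w (pc r1)) * exp (w (rc r1) - w (rc r2)))).
  { intros w Hw; destruct (HD w Hw) as [D1 D2]; unfold cur_C0, fst, ux, u, Rdiv in *.
    eapply is_pder_eq; [pd; auto|]; cbv beta; rewrite ?if_coord_same, ?if_coord_diff by discriminate.
    field; auto. }
  destruct (HD z Hz) as [D1 D2]; unfold ux in D1, D2.
  assert (H2 : is_pder (pc r1)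
    (fun w => - a * (/ w (pc r1) * / w (pc r1)) * exp (w (rc r1) - w (rc r2))) z
    (2 * a / (z (pc r1)) ^ 3 * exp (z (rc r1) - z (rc r2)))).
  { eapply is_pder_eq; [pd; auto|]; cbv beta; rewrite ?if_coord_same, ?if_coord_diff by discriminate.
    field; auto. }
  rewrite (pder_ext_loc (pc r1) _ (fun w => - a * (/ w (pc r1) * / w (pc r1)) * exp (w (rc r1) - w (rc r2)))).
  - rewrite (is_pder_unique _ _ _ _ H2); field; auto.
  - apply (jet_locally_mono z U); auto; intros w Hw; apply is_pder_unique; auto.
Qed.

Lemma remove_C0 n e z0 rho flux :
  (2 <= n)%nat -> normal_pair (box n e z0) rho flux ->
  exists c, (c = 0 \/ forall z, box n e z0 z -> cur_C0_domain z) /\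
    let rho' := fun z => rho z + - c * fst cur_C0 z in
    let flux' := fun z => flux z + - c * snd cur_C0 z in
    normal_pair (box n e z0) rho' flux' /\
    forall i z, in12 i = 1 -> box n e z0 z -> Qd rho' i z = 0.
Proof.
  intros Hn HN; set (B := box n e z0) in *.
  assert (HBo : jet_open B) by apply jet_open_box.
  destruct (cubic_exp n e z0 rho flux Hn HN) as [c0 Hc0].
  (* Differentiating 1 / r^1_x twice produces the factor 2, see [C0_density_pp]. *)
  set (c := c0 / 2); exists c.
  (* If c is nonzero, both cubics are nowhere zero in the box, hence neither r^1_x nor r^2_x
     vanishes there: the box lies in the domain of C_0 by itself. *)
  assert (Hdom : c = 0 \/ forall z, B z -> cur_C0_domain z).
  { destruct (Req_dec c 0) as [Hc|Hc]; [left; auto|right].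
    intros z Hz; assert (Hexp := exp_pos (z (rc r1) - z (rc r2))).
    assert (Hne : c0 * exp (z (rc r1) - z (rc r2)) <> 0).
    { apply Rmult_integral_contrapositive; split; [unfold c in Hc; lra|lra]. }
    assert (E1 := Hc0 z Hz); assert (E2 := cubic_opp n e z0 rho flux HN z Hz).
    rewrite E1 in E2; unfold cubic in E1, E2; split; unfold ux; intros E0; apply Hne.
    - rewrite <- E1, E0; ring.
    - rewrite E0 in E2; lra. }
  split; [exact Hdom|]; intros rho' flux'.
  assert (HC : normal_pair B (fun z => - c * fst cur_C0 z) (fun z => - c * snd cur_C0 z)).
  { apply normal_pair_C0; auto; destruct Hdom; [left; lra|right; auto]. }
  assert (HN' : normal_pair B rho' flux') by (apply normal_pair_plus; auto).
  split; [exact HN'|].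
  assert (Hrho := np_rho _ _ _ HN); assert (HrC := np_rho _ _ _ HC).
  assert (E : forall z, B z -> cubic rho' r1 z = 0).
  { intros z Hz; unfold cubic.
    rewrite (pder_ext_loc (pc r1) _ (fun w => pder (pc r1) rho w +
      pder (pc r1) (fun z => - c * fst cur_C0 z) w)).
    2:{ apply (jet_locally_mono z B); auto; intros w Hw; unfold rho'; apply (pder_plus 1 B); auto. }
    rewrite (pder_plus 1 B) by (auto using DF_pder).
    specialize (Hc0 z Hz); unfold cubic in Hc0.
    destruct Hdom as [Hc|HD].
    - assert (Hz2 : Qd (fun z => - c * fst cur_C0 z) r1 z = 0).
      { apply (pder_zero_on B); auto; intros w Hw; apply (pder_zero_on B); auto.
        intros; rewrite Hc; ring. }
      rewrite Hz2, Rplus_0_r, Hc0; replace c0 with (2 * c) by (unfold c; field); rewrite Hc; ring.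
    - assert (HQ := C0_density_pp B (- c) z HBo HD Hz).
      rewrite !Rmult_plus_distr_l, Hc0, HQ; unfold c; field. }
  intros i z Hi Hz; apply (zero_off_hyperplane 1 B _ (pc i)); auto.
  { apply DF_pder, DF_pder, (np_rho _ _ _ HN'). }
  intros w Hw Hne.
  assert (Ei : cubic rho' i w = 0).
  { destruct i; [auto| |simpl in Hi; lra].
    rewrite (cubic_opp n e z0 rho' flux' HN') by auto; rewrite E by auto; ring. }
  unfold cubic in Ei; apply Rmult_integral in Ei; destruct Ei as [|Ei]; [contradiction|].
  apply Rmult_integral in Ei; destruct Ei as [|Ei]; [contradiction|].
  apply Rmult_integral in Ei; destruct Ei as [|Ei]; [contradiction|auto].
Qed.

(** Moving a point along omega^1 = const rescales r^3_x by e^s, where s is a difference of two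
    displacements, hence the bound 2 d; the result must stay in the larger box. *)
Lemma scaled_ball y0 (e : posreal) :
  exists d : posreal, d <= e /\ forall y s, Rabs (y - y0) < d -> Rabs s < 2 * d -> Rabs (y * exp s - y0) < e.
Proof.
  assert (HC : continuity_2d_pt (fun y s => y * exp s) y0 0).
  { apply continuity_2d_pt_mult; [apply continuity_2d_pt_id1|].
    apply (continuity_1d_2d_pt_comp exp (fun _ s => s)); [|apply continuity_2d_pt_id2].
    apply derivable_continuous_pt, derivable_pt_exp. }
  destruct (HC e) as [h Hh].
  assert (Hd : 0 < Rmin e (h / 2)) by (apply Rmin_pos; [apply cond_pos|assert (H := cond_pos h); lra]).
  exists (mkposreal _ Hd); simpl; split; [apply Rmin_l|]; intros y s Hy Hs.
  assert (H1 := Rmin_r e (h / 2)); assert (H0 := cond_pos h).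
  rewrite exp_0, Rmult_1_r in Hh; apply Hh; [lra|rewrite Rminus_0_r; lra].
Qed.

Section RemoveC1.
Context (n : nat) (e : posreal) (z0 : jet) (rho flux : jet -> R) (Hn : (2 <= n)%nat).
Notation B := (box n e z0).
Context (HN : normal_pair B rho flux).
Context (HQ : forall i z, in12 i = 1 -> B z -> Qd rho i z = 0).

Let HBo : jet_open B := jet_open_box n e z0.
Let Hrho : DF 1 B rho := np_rho _ _ _ HN.
Notation P i := (pder (pc i) rho).
Notation E0 := (z0 (rc r1) - z0 (rc r2)).

Lemma P12_p i j z : in12 i = 1 -> B z -> pder (pc j) (P i) z = 0.
Proof.
  intros Hi Hz; destruct i, j; simpl in Hi; try lra;
    first [apply HQ; auto; fail|apply (rho_pp n e z0 rho flux HN); [discriminate|auto]].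
Qed.

(** By [P12_p] the coefficients [P r1] and [P r2] are free of the r^i_x, so this is the part of rho
    that does not involve r^1_x, r^2_x. *)
Definition reduced (z : jet) : R := rho z - z (pc r1) * P r1 z - z (pc r2) * P r2 z.

Lemma DF_reduced : DF 1 B reduced.
Proof.
  apply DF_minus; [apply DF_minus; auto|]; (apply DF_mult; [apply DF_coord; auto|df]).
Qed.

Lemma reduced_pder c z : B z -> (forall i, c <> rc i) ->
  pder c reduced z = if coord_eq_dec c (pc r3) then P r3 z else 0.
Proof.
  intros Hz Hc; apply is_pder_unique; eapply is_pder_eq; [unfold reduced; pdb|]; cbv beta.
  destruct (classic (forall i, c <> rc i /\ c <> pc i)) as [Ho|Ho].
  - assert (Z : forall w, B w -> pder c rho w = 0) by (intros; apply (np_rho_dep _ _ _ HN); auto).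
    rewrite Z, !if_coord_diff by (auto; try apply Ho; apply not_eq_sym, Ho).
    rewrite !(pder_of_zero n e z0 rho) by auto; ring.
  - apply not_all_ex_not in Ho; destruct Ho as [i Hi].
    destruct (coord_eq_dec c (pc i)) as [->|Hp]; [|destruct Hi; auto].
    rewrite !P12_p by auto; destruct i;
      rewrite ?if_coord_same, ?if_coord_diff by discriminate; ring.
Qed.

Lemma reduced_pp z : B z -> Qd reduced r3 z = Qd rho r3 z.
Proof.
  intros Hz; apply pder_ext_loc; apply (jet_locally_mono z B); auto; intros w Hw.
  rewrite reduced_pder by (auto; discriminate); apply if_coord_same.
Qed.

(* The point with r^1, r^2 moved to their values at z0 along omega^0, omega^1 = const. *)
Definition base_point (r3' p3' : R) : jet := upd (upd z0 (rc r3) r3') (pc r3) p3'.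

Lemma box_base_point a b :
  Rabs (a - z0 (rc r3)) < e -> Rabs (b - z0 (pc r3)) < e -> B (base_point a b).
Proof. intros Ha Hb; apply box_upd; [apply box_upd|]; auto using box_center. Qed.

Definition Omega_domain (p : R * R) : Prop :=
  Rabs (fst p - z0 (rc r3)) < e /\ Rabs (snd p * exp E0 - z0 (pc r3)) < e.

(** Fixed by requiring the density of C_1(Omega) to equal [reduced] where r^1, r^2 have their values
    at z0 and hence r^3_x = omega^1 e^E0. Using all of [reduced], not only its second
    r^3_x-derivative, is what makes [rho_C1_slice] hold. *)
Definition Omega_of (a w : R) : R := exp (- E0) * reduced (base_point a (w * exp E0)).

Lemma open_Omega_domain : open Omega_domain.
Proof.
  apply open_of_locally_2d; intros a w [Ha Hw]; simpl in Ha, Hw.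
  assert (H1 : continuity_2d_pt (fun a _ => Rabs (a - z0 (rc r3))) a w).
  { apply (continuity_1d_2d_pt_comp Rabs (fun a _ => a - z0 (rc r3))); [apply Rcontinuity_abs|].
    apply continuity_2d_pt_minus; [apply continuity_2d_pt_id1|apply continuity_2d_pt_const]. }
  assert (H2 : continuity_2d_pt (fun _ w => Rabs (w * exp E0 - z0 (pc r3))) a w).
  { apply (continuity_1d_2d_pt_comp Rabs (fun _ w => w * exp E0 - z0 (pc r3))); [apply Rcontinuity_abs|].
    apply continuity_2d_pt_minus; [apply continuity_2d_pt_mult|]; auto using continuity_2d_pt_id2, continuity_2d_pt_const. }
  apply Rlt_0_minus in Ha, Hw.
  specialize (H1 (mkposreal _ Ha)); specialize (H2 (mkposreal _ Hw)).
  generalize (locally_2d_and _ _ _ _ H1 H2); apply locally_2d_impl, locally_2d_forall.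
  simpl; intros u v [K1 K2]; apply Rabs_def2 in K1, K2; split; simpl; lra.
Qed.

Lemma smooth2_Omega : smooth2 Omega_domain Omega_of.
Proof.
  set (U' := fun z : jet => Omega_domain (z (rc r3), z (pc r3))).
  assert (HU' : jet_open U').
  { apply (jet_open_two_coords (rc r3) (pc r3)), open_Omega_domain. }
  set (Phi := fun z : jet => base_point (z (rc r3)) (z (pc r3) * exp E0)).
  apply (smooth2_slice 1 U' (fun z => exp (- E0) * reduced (Phi z)) z0 (rc r3) (pc r3)).
  - discriminate.
  - apply open_Omega_domain.
  - intros a b Hab; exact Hab.
  - apply DF_mult; [apply DF_const; auto|].
    apply (DF_comp 1 U' 1 B reduced Phi DF_reduced HU').
    + intros z [H1 H2]; apply box_base_point; auto.
    + intros c Hc; unfold Phi, base_point, upd.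
      destruct (coord_eq_dec c (pc r3)); [apply DF_mult; [apply DF_coord|apply DF_const]; auto|].
      destruct (coord_eq_dec c (rc r3)); [apply DF_coord|apply DF_const]; auto.
Qed.

(** Logarithm of the factor between r^3_x and its value transported to the centre along omega^1 =
    const. *)
Definition drift (z : jet) : R := (z (rc r1) - z (rc r2)) - E0.
Definition to_base (z : jet) : jet := base_point (z (rc r3)) (z (pc r3) * exp (- drift z)).

Lemma C1_density z : fst (cur_C1 Omega_of) z = exp (drift z) * reduced (to_base z).
Proof.
  unfold cur_C1, fst, Omega_of, omega0, omega1, to_base, drift, u, ux.
  assert (E1 : exp (z (rc r1) - z (rc r2)) * exp (- E0) = exp (z (rc r1) - z (rc r2) - E0)).
  { rewrite <- exp_plus; f_equal; ring. }
  assert (E2 : exp (z (rc r2) - z (rc r1)) * exp E0 = exp (- (z (rc r1) - z (rc r2) - E0))).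
  { rewrite <- exp_plus; f_equal; ring. }
  rewrite <- E1, <- E2, !Rmult_assoc; reflexivity.
Qed.

Context (e' : posreal) (Hee' : e' <= e).
Context (He' : forall y s, Rabs (y - z0 (pc r3)) < e' -> Rabs s < 2 * e' ->
  Rabs (y * exp s - z0 (pc r3)) < e).
Notation B' := (box n e' z0).

Lemma box_sub z : B' z -> B z.
Proof. intros Hz c Hc; eapply Rlt_le_trans; [apply Hz; auto|auto]. Qed.

Lemma drift_small z : B' z -> Rabs (drift z) < 2 * e'.
Proof.
  intros Hz; assert (H1 := Hz (rc r1) ltac:(simpl; lia)); assert (H2 := Hz (rc r2) ltac:(simpl; lia)).
  unfold drift; apply Rabs_def2 in H1, H2; apply Rabs_def1; lra.
Qed.

Lemma to_base_box z : B' z -> B (to_base z).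
Proof.
  intros Hz; apply box_base_point.
  - eapply Rlt_le_trans; [apply (Hz (rc r3)); simpl; lia|auto].
  - apply He'; [apply (Hz (pc r3)); simpl; lia|rewrite Rabs_Ropp; apply drift_small; auto].
Qed.

Lemma C1_domain_box z : B' z -> cur_C1_domain Omega_domain z.
Proof.
  intros Hz; unfold cur_C1_domain, Omega_domain, omega0, omega1, u, ux; simpl; split.
  - eapply Rlt_le_trans; [apply (Hz (rc r3)); simpl; lia|auto].
  - rewrite Rmult_assoc, <- exp_plus; apply He'; [apply (Hz (pc r3)); simpl; lia|].
    generalize (drift_small z Hz); rewrite <- (Rabs_Ropp (drift z)); unfold drift.
    intros H; eapply Rle_lt_trans; [|exact H]; right; f_equal; ring.
Qed.

Lemma is_pder_to_base F z : DF 1 B F -> B' z ->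
  is_pder (pc r3) (fun w => F (to_base w)) z (exp (- drift z) * pder (pc r3) F (to_base z)).
Proof.
  intros HF Hz; assert (H := DF_is_pder HF (pc r3) _ (to_base_box z Hz)).
  unfold is_pder in H |- *.
  apply (is_derive_ext (fun s => F (upd (to_base z) (pc r3) (s * exp (- drift z))))).
  { intros s; unfold to_base, base_point; rewrite upd_upd; reflexivity. }
  apply (is_derive_comp (fun s => F (upd (to_base z) (pc r3) s)) (fun s => s * exp (- drift z))).
  - exact H.
  - auto_derive; auto; ring.
Qed.

Lemma transport z : B' z -> exp (drift z) * Qd rho r3 z = Qd rho r3 (to_base z).
Proof.
  intros Hz; set (q := Qd rho r3); assert (Hq : DF 1 B q) by (unfold q; df).
  set (d := drift z).
  set (a := z (rc r1) - z0 (rc r1)); set (b := z (rc r2) - z0 (rc r2)).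
  assert (Hd : d = a - b) by (unfold d, drift, a, b; ring).
  (* A curve on which omega^0 and omega^1 are constant, from the central values of r^1, r^2 at t = 0
     to z at t = 1. By [five_coef] with j = r3, rho_{r^3_x r^3_x} is proportional to e^(- t d) along
     it. *)
  set (g := fun t : R => upd (upd (upd z (rc r1) (z0 (rc r1) + t * a)) (rc r2) (z0 (rc r2) + t * b))
    (pc r3) (z (pc r3) * exp (- ((1 - t) * d)))).
  assert (Hg : forall t, 0 <= t <= 1 -> B (g t)).
  { intros t Ht; assert (Hz' := box_sub z Hz).
    assert (Hlin : forall i, Rabs (z0 (rc i) + t * (z (rc i) - z0 (rc i)) - z0 (rc i)) < e).
    { intros i; replace (z0 (rc i) + t * (z (rc i) - z0 (rc i)) - z0 (rc i)) with
        (t * (z (rc i) - z0 (rc i))) by ring; rewrite Rabs_mult, (Rabs_pos_eq t) by lra.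
      assert (H := Hz' (rc i) ltac:(simpl; lia)); assert (H0 := Rabs_pos (z (rc i) - z0 (rc i))).
      apply Rle_lt_trans with (1 * Rabs (z (rc i) - z0 (rc i))); [apply Rmult_le_compat_r|]; lra. }
    unfold g; apply box_upd.
    - apply box_upd; [apply box_upd; [exact Hz'|apply (Hlin r1)]|apply (Hlin r2)].
    - apply He'; [apply (Hz (pc r3)); simpl; lia|].
      rewrite Rabs_Ropp, Rabs_mult, (Rabs_pos_eq (1 - t)) by lra.
      assert (H := drift_small z Hz); fold d in H; assert (H0 := Rabs_pos d).
      apply Rle_lt_trans with (1 * Rabs d); [apply Rmult_le_compat_r|]; lra. }
  set (v := fun (t : R) (c : coord) => if coord_eq_dec c (pc r3) then d * g t (pc r3) else
    if coord_eq_dec c (rc r2) then b else if coord_eq_dec c (rc r1) then a else 0).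
  assert (Hgv : forall t c, is_derive (fun t => g t c) t (v t c)).
  { intros t c; unfold g, v, upd.
    destruct (coord_eq_dec c (pc r3)) as [->|].
    - destruct (coord_eq_dec (pc r3) (pc r3)); [|congruence]; auto_derive; auto; eqR.
      unfold g; rewrite upd_same; unfold Rminus; ring.
    - destruct (coord_eq_dec c (rc r2)); [auto_derive; auto; ring|].
      destruct (coord_eq_dec c (rc r1)); [auto_derive; auto; ring|].
      apply (is_derive_const (z c)). }
  assert (HK : forall t, 0 <= t <= 1 -> is_derive (fun t => exp (t * d) * q (g t)) t 0).
  { intros t Ht; assert (HB := Hg t Ht).
    assert (Hloc : locally t (fun t => B (g t))).
    { apply curve_locally; auto; intros c; apply (ex_derive_continuous (fun t => g t c)).
      eexists; apply Hgv. }
    assert (H := chain_rule 1 B q g t (v t) Hq Hloc (fun c _ => Hgv t c)).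
    assert (F1 := five_coef n e z0 rho flux HN r1 r3 (g t) ltac:(discriminate) HB).
    assert (F2 := five_coef n e z0 rho flux HN r2 r3 (g t) ltac:(discriminate) HB).
    fold q in F1, F2; simpl in F1, F2.
    assert (EL : lsum (fun c => v t c * pder c q (g t)) (coords 1) = - d * q (g t)).
    { rewrite lsum_coords; unfold sum_dvar; simpl sum_f_R0; simpl Nat.sub; unfold v.
      repeat match goal with |- context [coord_eq_dec ?x ?y] =>
        first [rewrite (if_coord_diff x y) by discriminate|rewrite (if_coord_same x)] end.
      assert (G1 : pder (rc r1) q (g t) = - (q (g t) + g t (pc r3) * pder (pc r3) q (g t))) by lra.
      assert (G2 : pder (rc r2) q (g t) = q (g t) + g t (pc r3) * pder (pc r3) q (g t)) by lra.
      rewrite G1, G2, Hd; ring. }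
    rewrite EL in H.
    assert (He : is_derive (fun t => exp (t * d)) t (d * exp (t * d))) by (auto_derive; auto; ring).
    generalize (is_derive_mult _ _ _ _ _ He H Rmult_comm).
    match goal with |- is_derive _ _ ?x -> _ => replace x with 0; auto end.
    change (0 = d * exp (t * d) * q (g t) + exp (t * d) * (- d * q (g t))); ring. }
  assert (E := eq_is_derive (fun t => exp (t * d) * q (g t)) 0 1 HK Rlt_0_1); cbv beta in E.
  rewrite Rmult_0_l, exp_0, !Rmult_1_l in E.
  replace (g 1) with z in E.
  2:{ extensionality c; unfold g, upd.
      destruct (coord_eq_dec c (pc r3)) as [->|].
      - rewrite Rminus_diag, Rmult_0_l, Ropp_0, exp_0; ring.
      - destruct (coord_eq_dec c (rc r2)) as [->|]; [unfold b; ring|].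
        destruct (coord_eq_dec c (rc r1)) as [->|]; [unfold a; ring|auto]. }
  (* g 0 and [to_base z] differ only in coordinates other than the r^i and r^3_x, and on these q
     does not depend. *)
  rewrite <- E; apply (box_dep 1 n e z0 q (fun c => c = pc r3 \/ exists i, c = rc i)); auto; try lia.
  - intros c w Hw Hc; unfold q.
    destruct (classic (forall i, c <> rc i /\ c <> pc i)) as [Ho|Ho].
    + apply (pder_of_zero n e z0); auto; [df|]; intros; apply (pder_of_zero n e z0); auto.
      intros; apply (np_rho_dep _ _ _ HN); auto.
    + apply not_all_ex_not in Ho; destruct Ho as [i Hi].
      destruct (coord_eq_dec c (pc i)) as [->|]; [|exfalso; apply Hi; split; auto; intros ->; eauto].
      apply (Q_p n e z0 rho flux HN); auto; intros ->; auto.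
  - apply Hg; lra.
  - apply to_base_box; auto.
  - intros c [->|[i ->]]; unfold g, to_base, base_point.
    + rewrite !upd_same; f_equal; f_equal; unfold d; ring.
    + destruct i; unfold upd; cdec; ring.
Qed.

Definition rho_C1 (z : jet) : R := rho z + -1 * fst (cur_C1 Omega_of) z.
Definition flux_C1 (z : jet) : R := flux z + -1 * snd (cur_C1 Omega_of) z.

Lemma normal_pair_remove_C1 : normal_pair B' rho_C1 flux_C1.
Proof.
  apply normal_pair_plus.
  - apply (normal_pair_sub B); auto using jet_open_box, box_sub.
  - apply normal_pair_scal, (normal_pair_C1 _ Omega_domain);
      auto using jet_open_box, smooth2_Omega, C1_domain_box.
Qed.

Let HC : DF 1 B' (fst (cur_C1 Omega_of)).
Proof.
  apply (np_rho B' _ (snd (cur_C1 Omega_of))), (normal_pair_C1 _ Omega_domain);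
    auto using jet_open_box, smooth2_Omega, C1_domain_box.
Qed.

Lemma rho_C1_pder c z : B' z -> pder c rho_C1 z = pder c rho z + -1 * pder c (fst (cur_C1 Omega_of)) z.
Proof.
  intros Hz; apply is_pder_unique; unfold rho_C1; eapply is_pder_eq.
  - apply is_pder_plus.
    + apply (DF_is_pder Hrho); apply box_sub; auto.
    + apply is_pder_mult; [apply is_pder_const|apply (DF_is_pder HC); auto].
  - cbv beta; ring.
Qed.

Lemma C1_p12 i z : in12 i = 1 -> pder (pc i) (fst (cur_C1 Omega_of)) z = 0.
Proof.
  intros Hi; apply is_pder_unique.
  apply (is_derive_ext (fun _ => fst (cur_C1 Omega_of) z)); [|exact (is_derive_const _ (z (pc i)))].
  intros s; destruct i; simpl in Hi; [reflexivity|reflexivity|lra].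
Qed.

Lemma C1_p3 z : B' z -> pder (pc r3) (fst (cur_C1 Omega_of)) z = pder (pc r3) reduced (to_base z).
Proof.
  intros Hz; apply is_pder_unique.
  apply (is_pder_ext _ (fun w => exp (drift w) * reduced (to_base w))); [intros; symmetry; apply C1_density|].
  eapply is_pder_eq.
  - apply is_pder_mult; [unfold drift; pd|apply is_pder_to_base; auto using DF_reduced].
  - cbv beta; rewrite !if_coord_diff by discriminate.
    rewrite <- Rmult_assoc, <- exp_plus, Rplus_opp_r, exp_0; ring.
Qed.

(** For i = r3, the second r^3_x-derivative of the C_1 density is that of rho at [to_base z] times
    e^(- drift), and [transport] identifies this with the one of rho at z. *)
Lemma rho_C1_pp i z : B' z -> Qd rho_C1 i z = 0.
Proof.
  intros Hz; destruct (classic (in12 i = 1)) as [Hi|Hi].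
  - rewrite (pder_ext_loc (pc i) _ (pder (pc i) rho)); [apply HQ; auto using box_sub|].
    apply (jet_locally_mono z B'); [|apply jet_open_box; auto]; intros w Hw.
    rewrite rho_C1_pder, C1_p12 by auto; ring.
  - assert (i = r3) by (destruct i; simpl in Hi; congruence || lra); subst i.
    assert (Hr := DF_pder Hrho (pc r3)).
    assert (HR := DF_pder DF_reduced (pc r3)).
    rewrite (pder_ext_loc (pc r3) _ (fun w => pder (pc r3) rho w + -1 * pder (pc r3) reduced (to_base w))).
    + erewrite is_pder_unique; cycle 1.
      { apply is_pder_plus; [apply (DF_is_pder Hr), box_sub, Hz|].
        apply is_pder_mult; [apply is_pder_const|apply is_pder_to_base; auto]. }
      cbv beta; rewrite reduced_pp by (apply to_base_box; auto).
      rewrite <- transport by auto.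
      assert (Ee : exp (- drift z) * exp (drift z) = 1) by (rewrite <- exp_plus, Rplus_opp_l, exp_0; ring).
      transitivity (Qd rho r3 z * (1 - exp (- drift z) * exp (drift z))); [ring|rewrite Ee; ring].
    + apply (jet_locally_mono z B'); [|apply jet_open_box; auto]; intros w Hw.
      rewrite rho_C1_pder, C1_p3 by auto; ring.
Qed.

(** The normalization that later removes r^3 from the remaining density, through [slice_zero]. *)
Lemma rho_C1_slice z : B' z -> z (rc r1) = z0 (rc r1) -> z (rc r2) = z0 (rc r2) ->
  rho_C1 z - z (pc r1) * pder (pc r1) rho_C1 z - z (pc r2) * pder (pc r2) rho_C1 z = 0.
Proof.
  intros Hz H1 H2; rewrite !rho_C1_pder, !C1_p12 by auto; unfold rho_C1; rewrite C1_density.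
  assert (Hd : drift z = 0) by (unfold drift; rewrite H1, H2; ring).
  replace (reduced (to_base z)) with (reduced z).
  - rewrite Hd, exp_0; unfold reduced; ring.
  - apply (box_dep 1 n e z0 reduced (fun c => c = pc r3 \/ exists i, c = rc i)); auto using DF_reduced, box_sub, to_base_box; try lia.
    + intros c w Hw Hc; rewrite reduced_pder; [|auto|intros i ->; apply Hc; eauto].
      apply if_coord_diff; intros ->; auto.
    + unfold to_base, base_point; intros c [->|[i ->]].
      * rewrite upd_same, Hd, Ropp_0, exp_0; ring.
      * destruct i; unfold upd; cdec; auto.
Qed.
End RemoveC1.

(** * Splitting off EHC *)

(** Joint continuity is part of [ex_diff_n], while a potential is known only through its partial
    derivatives; where these are bounded, it is Lipschitz. *)
Lemma continuity_2d_of_partials (D : R * R -> Prop) f A B a b :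
  open D -> D (a, b) ->
  (forall u v, D (u, v) -> is_derive (fun s => f s v) u (A u v) /\ is_derive (fun s => f u s) v (B u v)) ->
  continuity_2d_pt A a b -> continuity_2d_pt B a b -> continuity_2d_pt f a b.
Proof.
  intros HD Hab Hf HA HB.
  destruct (locally_2d_and _ _ _ _ (open_locally_2d D a b HD Hab)
    (locally_2d_and _ _ _ _ (HA (mkposreal 1 Rlt_0_1)) (HB (mkposreal 1 Rlt_0_1)))) as [d Hd].
  simpl in Hd.
  set (K := Rabs (A a b) + Rabs (B a b) + 1).
  assert (HK : 0 < K) by (unfold K; generalize (Rabs_pos (A a b)) (Rabs_pos (B a b)); lra).
  assert (Hbound : forall u v, Rabs (u - a) < d -> Rabs (v - b) < d ->
    Rabs (A u v) <= K /\ Rabs (B u v) <= K).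
  { intros u v Hu Hv; destruct (Hd u v Hu Hv) as [_ [H1 H2]]; unfold K.
    generalize (Rabs_pos (A a b)) (Rabs_pos (B a b)); intros P1 P2; split.
    - replace (A u v) with ((A u v - A a b) + A a b) by ring.
      eapply Rle_trans; [apply Rabs_triang|lra].
    - replace (B u v) with ((B u v - B a b) + B a b) by ring.
      eapply Rle_trans; [apply Rabs_triang|lra]. }
  intros e; assert (Hm : 0 < Rmin d (e / (2 * K + 1))).
  { apply Rmin_pos; [apply cond_pos|apply Rdiv_lt_0_compat; [apply cond_pos|lra]]. }
  exists (mkposreal _ Hm); simpl; intros u v Hu Hv.
  set (m := Rmin d (e / (2 * K + 1))) in *.
  assert (M1 : m <= d) by apply Rmin_l.
  assert (M2 : m * (2 * K + 1) <= e).
  { apply Rle_trans with (e / (2 * K + 1) * (2 * K + 1)); [|right; field; lra].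
    apply Rmult_le_compat_r; [lra|apply Rmin_r]. }
  assert (B1 : Rabs (f u v - f a v) <= K * Rabs (u - a)).
  { apply (bounded_variation (fun s => f s v) (fun s => A s v)); intros s Hs.
    split; [apply Hf|]; apply (Hd s v) || apply Hbound; lra. }
  assert (B2 : Rabs (f a v - f a b) <= K * Rabs (v - b)).
  { assert (Ha : Rabs (a - a) < d) by (rewrite Rminus_diag, Rabs_R0; apply cond_pos).
    apply (bounded_variation (fun s => f a s) (fun s => B a s)); intros s Hs.
    split; [apply Hf|]; apply (Hd a s) || apply Hbound; lra. }
  replace (f u v - f a b) with ((f u v - f a v) + (f a v - f a b)) by ring.
  eapply Rle_lt_trans; [apply Rabs_triang|].
  apply Rle_lt_trans with (K * m + K * m); [|lra].
  apply Rplus_le_compat; (eapply Rle_trans; [eassumption|]); apply Rmult_le_compat_l; lra.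
Qed.

Lemma continuity_2d_swap f x y :
  continuity_2d_pt f x y -> continuity_2d_pt (fun u v => f v u) y x.
Proof. intros H e; destruct (H e) as [d Hd]; exists d; intros u v Hu Hv; apply Hd; auto. Qed.

Lemma continuity_2d_slice f x y : continuity_2d_pt f x y -> continuous (fun s => f s y) x.
Proof.
  intros H; apply filterlim_locally; intros e; destruct (H e) as [d Hd]; exists d.
  intros s Hs; apply Hd; [exact Hs|rewrite Rminus_diag, Rabs_R0; apply cond_pos].
Qed.

Lemma smooth2_continuity D f a b : smooth2 D f -> D (a, b) -> continuity_2d_pt f a b.
Proof. intros [_ H] Hab; exact (proj1 (H a b Hab 0%nat)). Qed.

Section Potential.
Context (a0 b0 : R) (e : posreal).

Definition rectangle (p : R * R) : Prop := Rabs (fst p - a0) < e /\ Rabs (snd p - b0) < e.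

Lemma open_rectangle : open rectangle.
Proof. exact (open_square e a0 b0). Qed.

Context (A B : R -> R -> R) (HA : smooth2 rectangle A) (HB : smooth2 rectangle B).
Context (Hclosed : forall a b, rectangle (a, b) ->
  Derive (fun s => A a s) b = Derive (fun s => B s b) a).

(** Line integral of A da + B db from (a0, b0), first along b and then along a. *)
Definition potential (a b : R) : R := RInt (fun s => A s b) a0 a + RInt (fun s => B a0 s) b0 b.

Lemma rectangle_between a b s : rectangle (a, b) -> Rmin a0 a <= s <= Rmax a0 a -> rectangle (s, b).
Proof.
  intros [Ha Hb] Hs; split; auto; simpl in *.
  apply (between_ball a0 a0 a); auto; rewrite Rminus_diag, Rabs_R0; apply cond_pos.
Qed.

Lemma ex_RInt_A a b : rectangle (a, b) -> ex_RInt (fun s => A s b) a0 a.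
Proof.
  intros Hab; apply (@ex_RInt_continuous R_CompleteNormedModule); intros s Hs.
  apply continuity_2d_slice, (smooth2_continuity rectangle); auto.
  apply (rectangle_between a); auto.
Qed.

Lemma ex_RInt_B b : Rabs (b - b0) < e -> ex_RInt (fun s => B a0 s) b0 b.
Proof.
  intros Hb; apply (@ex_RInt_continuous R_CompleteNormedModule); intros s Hs.
  apply (continuity_2d_slice (fun u v => B v u)), continuity_2d_swap, (smooth2_continuity rectangle); auto.
  split; simpl; [rewrite Rminus_diag, Rabs_R0; apply cond_pos|].
  apply (between_ball b0 b0 b); auto; rewrite Rminus_diag, Rabs_R0; apply cond_pos.
Qed.

Lemma is_derive_potential_1 a b : rectangle (a, b) -> is_derive (fun s => potential s b) a (A a b).
Proof.
  intros Hab; unfold potential; rewrite <- (Rplus_0_r (A a b)).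
  apply (is_derive_plus (fun s => RInt (fun s => A s b) a0 s)); [|apply @is_derive_const].
  apply (is_derive_RInt (fun s => A s b) (fun x => RInt (fun s => A s b) a0 x) a0).
  - generalize (locally_of_2d _ _ _ (open_locally_2d _ _ _ open_rectangle Hab)); apply filter_imp.
    intros s Hs; apply (@RInt_correct R_CompleteNormedModule), ex_RInt_A, Hs.
  - apply continuity_2d_slice, (smooth2_continuity rectangle); auto.
Qed.

Lemma rectangle_locally_2 a b : rectangle (a, b) -> locally b (fun s => Rabs (s - b0) < e).
Proof.
  intros [_ Hb]; simpl in Hb; assert (H : 0 < e - Rabs (b - b0)) by lra.
  exists (mkposreal _ H); intros s Hs; assert (Hs' : Rabs (s - b) < e - Rabs (b - b0)) by exact Hs.
  replace (s - b0) with ((s - b) + (b - b0)) by ring; eapply Rle_lt_trans; [apply Rabs_triang|lra].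
Qed.

(** Differentiation under the first integral gives the integral of A_b, which closedness turns into
    that of B_a, that is B(a, b) - B(a0, b); the second integral supplies B(a0, b). *)
Lemma is_derive_potential_2 a b : rectangle (a, b) -> is_derive (fun s => potential a s) b (B a b).
Proof.
  intros Hab; assert (Hloc := rectangle_locally_2 a b Hab).
  assert (Hrect : forall s t, Rmin a0 a <= s <= Rmax a0 a -> Rabs (t - b0) < e -> rectangle (s, t)).
  { intros s t Hs Ht; split; [apply (rectangle_between a b s Hab Hs)|auto]. }
  assert (H1 : is_derive (fun t => RInt (fun s => A s t) a0 a) b
    (RInt (fun s => Derive (fun t => A s t) b) a0 a)).
  { apply (is_derive_RInt_param (fun t s => A s t)).
    - revert Hloc; apply filter_imp; intros t Ht s Hs.
      exact (proj2 (smooth2_ex_derive _ _ _ _ HA (Hrect s t Hs Ht))).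
    - intros s Hs; apply (continuity_2d_swap (fun s t => Derive (fun t => A s t) t)).
      apply (smooth2_continuity rectangle); [apply (smooth2_partial _ _ HA)|].
      apply Hrect; [auto|apply Hab].
    - revert Hloc; apply filter_imp; intros t Ht; apply ex_RInt_A; split; [apply Hab|auto]. }
  assert (E : RInt (fun s => Derive (fun t => A s t) b) a0 a = B a b - B a0 b).
  { rewrite (RInt_ext _ (fun s => Derive (fun s => B s b) s)).
    - apply (RInt_Derive (fun s => B s b)); intros s Hs; assert (Hr : rectangle (s, b)) by (apply Hrect; [auto|apply Hab]).
      + exact (proj1 (smooth2_ex_derive _ _ _ _ HB Hr)).
      + apply (continuity_2d_slice (fun s b => Derive (fun s => B s b) s)).
        apply (smooth2_continuity rectangle); auto; apply (smooth2_partial _ _ HB).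
    - intros s Hs; apply Hclosed, Hrect; [lra|apply Hab]. }
  rewrite E in H1; unfold potential.
  replace (B a b) with ((B a b - B a0 b) + B a0 b) by ring.
  apply (is_derive_plus (fun t => RInt (fun s => A s t) a0 a)); [exact H1|].
  apply (is_derive_RInt (fun s => B a0 s) (fun x => RInt (fun s => B a0 s) b0 x) b0).
  - revert Hloc; apply filter_imp; intros t Ht.
    apply (@RInt_correct R_CompleteNormedModule), ex_RInt_B, Ht.
  - apply (continuity_2d_slice (fun u v => B v u)), continuity_2d_swap, (smooth2_continuity rectangle); auto.
    split; simpl; [rewrite Rminus_diag, Rabs_R0; apply cond_pos|apply Hab].
Qed.

Lemma smooth2_potential : smooth2 rectangle potential.
Proof.
  split; [apply open_rectangle|]; intros a b Hab n.
  assert (HC : continuity_2d_pt potential a b).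
  { apply (continuity_2d_of_partials rectangle _ A B); auto using open_rectangle.
    - intros u v Huv; split; [apply is_derive_potential_1|apply is_derive_potential_2]; auto.
    - apply (smooth2_continuity rectangle); auto.
    - apply (smooth2_continuity rectangle); auto. }
  assert (Hloc := open_locally_2d _ _ _ open_rectangle Hab).
  destruct n as [|n]; (split; [exact HC|]); [exact I|].
  split; [eexists; apply is_derive_potential_1; auto|].
  split; [eexists; apply is_derive_potential_2; auto|]; split.
  - apply (ex_diff_n_ext_loc A); [|apply HA; auto].
    revert Hloc; apply locally_2d_impl, locally_2d_forall; intros u v Huv.
    symmetry; apply is_derive_unique, is_derive_potential_1; auto.
  - apply (ex_diff_n_ext_loc B); [|apply HB; auto].
    revert Hloc; apply locally_2d_impl, locally_2d_forall; intros u v Huv.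
    symmetry; apply is_derive_unique, is_derive_potential_2; auto.
Qed.
End Potential.

Lemma box_const k n e z0 F : DF k (box n e z0) F -> (k <= n)%nat ->
  (forall c z, box n e z0 z -> pder c F z = 0) ->
  forall z w, box n e z0 z -> box n e z0 w -> F z = F w.
Proof.
  intros HF Hk H z w Hz Hw; apply (box_dep k n e z0 F (fun _ => False)); auto; easy.
Qed.

Section Residual.
Context (n : nat) (e : posreal) (z0 : jet) (rho flux : jet -> R) (Hn : (2 <= n)%nat).
Notation B := (box n e z0).
Context (HN : normal_pair B rho flux).
Context (HQ : forall i z, B z -> Qd rho i z = 0).
Context (Hslice : forall z, B z -> z (rc r1) = z0 (rc r1) -> z (rc r2) = z0 (rc r2) ->
  rho z - z (pc r1) * pder (pc r1) rho z - z (pc r2) * pder (pc r2) rho z = 0).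

Let HBo : jet_open B := jet_open_box n e z0.
Let Hrho : DF 1 B rho := np_rho _ _ _ HN.
Let HS : DF 1 B flux := np_flux _ _ _ HN.
Notation P i := (pder (pc i) rho).

Lemma P_p i j z : B z -> pder (pc j) (P i) z = 0.
Proof.
  intros Hz; destruct (coord_eq_dec (pc i) (pc j)) as [E|E].
  - injection E as ->; auto.
  - apply (rho_pp n e z0 rho flux HN); auto; congruence.
Qed.

Lemma P_other i c z : B z -> (forall j, c <> rc j) -> pder c (P i) z = 0.
Proof.
  intros Hz Hc; destruct (classic (forall i, c <> rc i /\ c <> pc i)) as [Ho|Ho].
  - apply (pder_of_zero n e z0); auto; intros; apply (np_rho_dep _ _ _ HN); auto.
  - apply not_all_ex_not in Ho; destruct Ho as [j Hj].
    destruct (coord_eq_dec c (pc j)) as [->|]; [apply P_p; auto|destruct Hj; auto].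
Qed.

(** This is [four_eq] with vanishing right-hand side, divided by the nonzero difference of
    speeds. *)
Lemma P_closed i j z : B z -> pder (rc i) (P j) z = pder (rc j) (P i) z.
Proof.
  intros Hz; destruct (coord_eq_dec (rc i) (rc j)) as [E|E]; [injection E as ->; auto|].
  assert (Hij : i <> j) by congruence.
  assert (H := four_eq n e z0 rho flux HN i j z Hij Hz); rewrite !HQ, !Rmult_0_r, Rplus_0_r in H by auto.
  apply Rmult_integral in H; destruct H as [H|H]; [|lra].
  exfalso; destruct i, j; simpl in H; congruence || lra.
Qed.

Definition res_density (z : jet) : R := rho z - (z (pc r1) * P r1 z + z (pc r2) * P r2 z + z (pc r3) * P r3 z).
Definition res_flux (z : jet) : R := flux z -
  ((z (rc r1) + z (rc r2) + 1) * (z (pc r1) * P r1 z) +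
   (z (rc r1) + z (rc r2) - 1) * (z (pc r2) * P r2 z) +
   (z (rc r1) + z (rc r2)) * (z (pc r3) * P r3 z)).

Lemma DF_res_density : DF 1 B res_density.
Proof.
  apply DF_minus; auto; repeat apply DF_plus; (apply DF_mult; [apply DF_coord; auto|df]).
Qed.

Lemma DF_res_flux : DF 1 B res_flux.
Proof.
  assert (Hc : forall c, (ord c <= 1)%nat -> DF 1 B (fun z => z c)) by (intros; apply DF_coord; auto).
  apply DF_minus; auto; repeat apply DF_plus; (apply DF_mult; [|apply DF_mult; [apply Hc; auto|df]]);
    repeat first [apply DF_plus|apply DF_minus]; auto using DF_const.
Qed.

Lemma res_density_other c z : B z -> (forall j, c <> rc j) -> pder c res_density z = 0.
Proof.
  intros Hz Hc; apply is_pder_unique; eapply is_pder_eq; [unfold res_density; pdb|]; cbv beta.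
  rewrite !P_other by auto.
  destruct (classic (forall i, c <> rc i /\ c <> pc i)) as [Ho|Ho].
  - rewrite (np_rho_dep _ _ _ HN), !if_coord_diff by (auto; try apply not_eq_sym; apply Ho); ring.
  - apply not_all_ex_not in Ho; destruct Ho as [j Hj].
    destruct (coord_eq_dec c (pc j)) as [->|]; [|destruct Hj; auto].
    destruct j; rewrite if_coord_same, !if_coord_diff by discriminate; ring.
Qed.

Lemma res_density_r j z : B z -> pder (rc j) res_density z = pder (rc j) rho z -
  (z (pc r1) * pder (rc r1) (P j) z + z (pc r2) * pder (rc r2) (P j) z + z (pc r3) * pder (rc r3) (P j) z).
Proof.
  intros Hz; apply is_pder_unique; eapply is_pder_eq; [unfold res_density; pdb|]; cbv beta.
  rewrite !if_coord_diff by discriminate; rewrite !(P_closed j) by auto; ring.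
Qed.

Lemma res_flux_p j z : B z -> pder (pc j) res_flux z = 0.
Proof.
  intros Hz; apply is_pder_unique; eapply is_pder_eq; [unfold res_flux; pdb|]; cbv beta.
  rewrite (top_eq n e z0 rho flux HN), !P_p by auto.
  destruct j; simpl speed_offset; rewrite if_coord_same, !if_coord_diff by discriminate; ring.
Qed.

Lemma res_flux_other c z : B z -> c <> ind vt -> (forall j, c <> rc j) -> pder c res_flux z = 0.
Proof.
  intros Hz Ht Hc; destruct (classic (forall i, c <> rc i /\ c <> pc i)) as [Ho|Ho].
  - apply is_pder_unique; eapply is_pder_eq; [unfold res_flux; pdb|]; cbv beta.
    rewrite !P_other, !if_coord_diff by (auto; try apply not_eq_sym; apply Ho).
    replace (pder c flux z) with 0; [ring|].
    destruct c as [[]|i a b]; [congruence|symmetry; apply (flux_x n e z0 rho flux HN); auto|].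
    symmetry; apply (np_flux_dep _ _ _ HN); auto; discriminate.
  - apply not_all_ex_not in Ho; destruct Ho as [j Hj].
    destruct (coord_eq_dec c (pc j)) as [->|]; [apply res_flux_p; auto|destruct Hj; auto].
Qed.

(** All second derivatives [Q j] being zero, [flux_r] reduces to a relation of hydrodynamic type
    once closedness has reordered the mixed derivatives. *)
Lemma res_flux_r j z : B z ->
  pder (rc j) res_flux z = (z (rc r1) + z (rc r2) + speed_offset j) * pder (rc j) res_density z.
Proof.
  intros Hz; rewrite res_density_r by auto; apply is_pder_unique; eapply is_pder_eq; [unfold res_flux; pdb|]; cbv beta.
  rewrite (flux_r n e z0 rho flux HN), HQ, !(P_closed j) by auto.
  destruct j; simpl speed_offset; simpl in12;
  repeat match goal with |- context [coord_eq_dec ?x ?y] =>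
    first [rewrite (if_coord_diff x y) by discriminate|rewrite (if_coord_same x)] end; ring.
Qed.

Lemma res_flux_t_r j z : B z -> pder (rc j) (pder (ind vt) res_flux) z = 0.
Proof.
  intros Hz; assert (HG := DF_res_flux); assert (Hh := DF_res_density).
  rewrite (pder_swap n e z0) by auto.
  destruct j; [diff_eq (res_flux_r r1) HBo (ind vt) z Hz E|diff_eq (res_flux_r r2) HBo (ind vt) z Hz E
    |diff_eq (res_flux_r r3) HBo (ind vt) z Hz E]; rewrite E, (pder_of_zero n e z0) by
    (auto; intros; apply res_density_other; auto; discriminate); ring.
Qed.

Lemma res_flux_t_other c z : B z -> c <> ind vt -> pder c (pder (ind vt) res_flux) z = 0.
Proof.
  intros Hz Hc; destruct (classic (exists j, c = rc j)) as [[j ->]|Hj]; [apply res_flux_t_r; auto|].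
  apply (pder_of_zero n e z0); auto using DF_res_flux; intros w Hw; apply res_flux_other; auto.
  intros j ->; apply Hj; eauto.
Qed.

(** Symmetry of the second derivatives of [res_flux], written through [res_flux_r]. *)
Lemma res_density_mixed i j z : B z ->
  in12 i * pder (rc j) res_density z + (z (rc r1) + z (rc r2) + speed_offset j) * pder (rc i) (pder (rc j) res_density) z =
  in12 j * pder (rc i) res_density z + (z (rc r1) + z (rc r2) + speed_offset i) * pder (rc i) (pder (rc j) res_density) z.
Proof.
  intros Hz; assert (HG := DF_res_flux); assert (Hh := DF_res_density).
  assert (D : forall i j, pder (rc i) (pder (rc j) res_flux) z =
    in12 i * pder (rc j) res_density z + (z (rc r1) + z (rc r2) + speed_offset j) * pder (rc i) (pder (rc j) res_density) z).
  { clear i j; intros i j; destruct i; [diff_eq (res_flux_r j) HBo (rc r1) z Hz E|diff_eq (res_flux_r j) HBo (rc r2) z Hz E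
    |diff_eq (res_flux_r j) HBo (rc r3) z Hz E]; rewrite E; simpl in12; ring. }
  rewrite <- D, (pder_swap n e z0) by auto; rewrite D, (pder_swap n e z0 res_density (rc j)) by auto; reflexivity.
Qed.

(** On the slice, [res_density] plus r^3_x times [P r3] vanishes, and both functions are free of
    r^3_x. Differentiating by r^3_x, which does not leave the slice, kills [P r3] and then
    [res_density]. *)
Lemma slice_zero z : B z -> z (rc r1) = z0 (rc r1) -> z (rc r2) = z0 (rc r2) -> res_density z = 0.
Proof.
  intros Hz H1 H2; assert (HP := DF_pder Hrho (pc r3)); assert (Hh := DF_res_density).
  assert (E : forall w, B w -> w (rc r1) = z0 (rc r1) -> w (rc r2) = z0 (rc r2) ->
    res_density w + w (pc r3) * P r3 w = 0).
  { intros w Hw W1 W2; rewrite <- (Hslice w Hw W1 W2); unfold res_density; ring. }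
  assert (E3 : P r3 z = 0).
  { assert (K : is_pder (pc r3) (fun w => res_density w + w (pc r3) * P r3 w) z (P r3 z)).
    { eapply is_pder_eq; [pdb|]; cbv beta.
      rewrite res_density_other, P_p, if_coord_same by (auto; discriminate); ring. }
    rewrite <- (is_pder_unique _ _ _ _ K); apply is_pder_unique.
    apply (is_derive_ext_loc (fun _ => 0)); [|exact (is_derive_const 0 (z (pc r3)))].
    refine (filter_imp _ _ _ (upd_locally z (pc r3) B (HBo z Hz))); intros s Hs; symmetry; apply E; auto. }
  generalize (E z Hz H1 H2); rewrite E3; lra.
Qed.

(** By [res_density_mixed] with j = r3, h_{r^3} satisfies the same equations in r^1, r^2 as e^(r^1 -
    r^2), so it is determined by its values at the central r^1, r^2. There h vanishes for all r^3 by
    [slice_zero]. *)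
Lemma res_density_r3 z : B z -> pder (rc r3) res_density z = 0.
Proof.
  assert (Hh := DF_res_density); assert (Hh3 := DF_pder Hh (rc r3)).
  set (g := fun z => exp (- (z (rc r1) - z (rc r2))) * pder (rc r3) res_density z).
  assert (Hg : DF 1 B g).
  { apply DF_mult; auto; apply DF_exp, DF_opp, DF_minus; apply DF_coord; auto. }
  intros Hz.
  set (w := upd (upd z (rc r1) (z0 (rc r1))) (rc r2) (z0 (rc r2))).
  assert (Hw : B w).
  { apply box_upd; [apply box_upd|]; auto; rewrite Rminus_diag, Rabs_R0; apply cond_pos. }
  assert (E : g z = g w).
  { apply (box_dep 1 n e z0 g (fun c => c <> rc r1 /\ c <> rc r2)); auto; try lia.
    - intros c x Hx Hc; apply is_pder_unique; eapply is_pder_eq; [unfold g; pdb|]; cbv beta.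
      assert (Hc' : c = rc r1 \/ c = rc r2) by (apply NNPP; intros K; apply Hc; split; intros ->; auto).
      destruct Hc' as [->| ->].
      + assert (K := res_density_mixed r1 r3 x Hx); simpl speed_offset in K; simpl in12 in K.
        rewrite if_coord_same, if_coord_diff by discriminate.
        transitivity ((pder (rc r1) (pder (rc r3) res_density) x - pder (rc r3) res_density x) * exp (- (x (rc r1) - x (rc r2)))); [ring|].
        replace (pder (rc r1) (pder (rc r3) res_density) x) with (pder (rc r3) res_density x) by lra; ring.
      + assert (K := res_density_mixed r2 r3 x Hx); simpl speed_offset in K; simpl in12 in K.
        rewrite if_coord_same, if_coord_diff by discriminate.
        transitivity ((pder (rc r2) (pder (rc r3) res_density) x + pder (rc r3) res_density x) * exp (- (x (rc r1) - x (rc r2)))); [ring|].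
        replace (pder (rc r2) (pder (rc r3) res_density) x) with (- pder (rc r3) res_density x) by lra; ring.
    - intros c [Hc1 Hc2]; unfold w; rewrite !upd_other; auto. }
  assert (E3 : pder (rc r3) res_density w = 0).
  { apply is_pder_unique.
    apply (is_derive_ext_loc (fun _ => 0)); [|exact (is_derive_const 0 (w (rc r3)))].
    refine (filter_imp _ _ _ (upd_locally w (rc r3) B (HBo w Hw))); intros s Hs; symmetry.
    apply slice_zero; auto; reflexivity. }
  unfold g in E; rewrite E3, Rmult_0_r in E; apply Rmult_integral in E.
  destruct E as [E|E]; [|auto]; assert (Hp := exp_pos (- (z (rc r1) - z (rc r2)))); lra.
Qed.

Definition at12 (a b : R) : jet := upd (upd z0 (rc r1) a) (rc r2) b.
Definition D12 : R * R -> Prop := rectangle (z0 (rc r1)) (z0 (rc r2)) e.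

Lemma box_at12 a b : D12 (a, b) -> B (at12 a b).
Proof. intros [Ha Hb]; apply box_upd; [apply box_upd|]; auto using box_center. Qed.

Lemma D12_box z : B z -> D12 (z (rc r1), z (rc r2)).
Proof. intros Hz; split; [apply (Hz (rc r1))|apply (Hz (rc r2))]; simpl; lia. Qed.

(** A flux is determined only up to an additive function of t; subtracting the value at z0 fixes the
    splitting. *)
Definition t_part (z : jet) : R := res_flux (upd z0 (ind vt) (z (ind vt))) - res_flux z0.

Lemma box_t z : B z -> B (upd z0 (ind vt) (z (ind vt))).
Proof. intros Hz; apply box_upd; [apply box_center|]; apply Hz; simpl; lia. Qed.

Lemma DF_t_part : DF 1 B t_part.
Proof.
  apply DF_minus; [|apply DF_const; auto].
  apply (DF_comp 1 B 1 B res_flux (fun z => upd z0 (ind vt) (z (ind vt)))); auto using DF_res_flux, box_t.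
  intros c Hc; unfold upd; destruct (coord_eq_dec c (ind vt)); [apply DF_coord; auto; simpl; lia|apply DF_const; auto].
Qed.

Lemma t_part_pder c z : c <> ind vt -> pder c t_part z = 0.
Proof.
  intros Hc; apply is_pder_unique.
  apply (is_derive_ext (fun _ => t_part z)); [|exact (is_derive_const (t_part z) (z c))].
  intros s; unfold t_part; rewrite upd_other; auto.
Qed.

Lemma res_density_at12 z : B z -> res_density z = res_density (at12 (z (rc r1)) (z (rc r2))).
Proof.
  intros Hz; apply (box_dep 1 n e z0 res_density (fun c => c = rc r1 \/ c = rc r2)); auto using DF_res_density, box_at12, D12_box; try lia.
  - intros c w Hw Hc; destruct (coord_eq_dec c (rc r3)) as [->|H3]; [apply res_density_r3; auto|].
    apply res_density_other; auto; intros [] ->; auto.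
  - intros c [->| ->]; reflexivity.
Qed.

Lemma res_flux_at12 z : B z -> res_flux z = res_flux (at12 (z (rc r1)) (z (rc r2))) + t_part z.
Proof.
  assert (HG := DF_res_flux); intros Hz.
  assert (Hb : forall w, B w -> B (upd w (ind vt) (z (ind vt)))).
  { intros w Hw; apply box_upd; auto; apply Hz; simpl; lia. }
  assert (Hb0 : forall w, B w -> B (upd w (ind vt) (z0 (ind vt)))).
  { intros w Hw; apply box_upd; auto; rewrite Rminus_diag, Rabs_R0; apply cond_pos. }
  assert (HD : forall s, (forall w, B w -> B (upd w (ind vt) s)) -> DF 1 B (fun w => res_flux (upd w (ind vt) s))).
  { intros s Hs; apply (DF_comp 1 B 1 B res_flux (fun w => upd w (ind vt) s)); auto.
    intros c Hc; unfold upd; destruct (coord_eq_dec c (ind vt)); [apply DF_const|apply DF_coord]; auto. }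
  assert (Hp : forall s c w, c <> ind vt -> pder c (fun w => res_flux (upd w (ind vt) s)) w = pder c res_flux (upd w (ind vt) s)).
  { intros s c w Hc; unfold pder; rewrite upd_other by auto; apply Derive_ext; intros x.
    rewrite upd_comm; auto. }
  (* The increment between the two times is constant in the box, because the t-derivative of
     [res_flux] depends on t alone. *)
  set (F := fun w => res_flux (upd w (ind vt) (z (ind vt))) - res_flux (upd w (ind vt) (z0 (ind vt)))).
  assert (HF : F z = F z0).
  { apply (box_const 1 n e z0 F); auto using box_center; try lia.
    - apply DF_minus; apply HD; auto.
    - intros c w Hw; destruct (coord_eq_dec c (ind vt)) as [->|Hc].
      + apply is_pder_unique.
        apply (is_derive_ext (fun _ => F w)); [|exact (is_derive_const (F w) (w (ind vt)))].
        intros s; unfold F; rewrite !upd_upd; auto.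
      + apply is_pder_unique; eapply is_pder_eq.
        * apply is_pder_minus; [apply (DF_is_pder (HD _ Hb)); auto|apply (DF_is_pder (HD _ Hb0)); auto].
        * rewrite !Hp by auto.
          rewrite !(box_upd_inv 1 n e z0 (pder c res_flux) (ind vt)); auto; try lia; try ring; try df;
          intros; rewrite (pder_swap n e z0) by auto; apply res_flux_t_other; auto. }
  unfold F in HF; rewrite (upd_id z (ind vt)), (upd_id z0 (ind vt)) in HF.
  unfold t_part; rewrite <- HF.
  replace (res_flux (at12 (z (rc r1)) (z (rc r2)))) with (res_flux (upd z (ind vt) (z0 (ind vt)))); [ring|].
  apply (box_dep 1 n e z0 res_flux (fun c => c = ind vt \/ c = rc r1 \/ c = rc r2)); auto using box_at12, D12_box; try lia.
  - intros c w Hw Hc; destruct (coord_eq_dec c (rc r3)) as [->|H3].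
    + rewrite res_flux_r, res_density_r3 by auto; ring.
    + apply res_flux_other; auto; intros [] ->; auto.
  - intros c [->|[->| ->]]; reflexivity.
Qed.

Let hh (a b : R) : R := res_density (at12 a b).
Let gg (a b : R) : R := res_flux (at12 a b).

Lemma smooth2_hh : smooth2 D12 hh.
Proof.
  apply (smooth2_slice 1 B res_density z0 (rc r1) (rc r2)); auto using DF_res_density; [discriminate|apply open_rectangle|apply box_at12].
Qed.

Lemma smooth2_gg : smooth2 D12 gg.
Proof.
  apply (smooth2_slice 1 B res_flux z0 (rc r1) (rc r2)); auto using DF_res_flux; [discriminate|apply open_rectangle|apply box_at12].
Qed.

Lemma is_derive_at12_1 F a b : DF 1 B F -> D12 (a, b) ->
  is_derive (fun s => F (at12 s b)) a (pder (rc r1) F (at12 a b)).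
Proof.
  intros HF Hab; unfold at12; rewrite <- pder_upd2_l by discriminate; apply Derive_correct.
  apply (ex_derive_upd2_l 1 B); auto; [discriminate|apply box_at12; auto].
Qed.

Lemma is_derive_at12_2 F a b : DF 1 B F -> D12 (a, b) ->
  is_derive (fun s => F (at12 a s)) b (pder (rc r2) F (at12 a b)).
Proof.
  intros HF Hab; unfold at12; rewrite <- pder_upd2_r; apply Derive_correct.
  apply (ex_derive_upd2_r 1 B); auto; apply box_at12; auto.
Qed.

(** With [Psi2], the solution of the linear system Psi1 - Psi2 = hh, (a + b) hh + Psi1 + Psi2 = gg
    for the gradient of Psi. *)
Definition Psi1 (a b : R) : R := (gg a b + (1 - (a + b)) * hh a b) / 2.
Definition Psi2 (a b : R) : R := (gg a b + (- 1 - (a + b)) * hh a b) / 2.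

Lemma smooth2_affine x y : smooth2 D12 (fun a b => x + y * (a + b)).
Proof.
  apply (smooth2_slice 0 (fun _ => True) (fun z => x + y * (z (rc r1) + z (rc r2))) z0 (rc r1) (rc r2));
    [discriminate|apply open_rectangle|easy|].
  assert (HT := jet_open_true).
  apply DF_plus; [|apply DF_mult; [|apply DF_plus]]; try (apply DF_const; auto); apply DF_coord; auto.
Qed.

Lemma smooth2_ext D f g : (forall a b, f a b = g a b) -> smooth2 D f -> smooth2 D g.
Proof.
  intros E Hf; replace g with f; auto; extensionality a; extensionality b; auto.
Qed.

Lemma smooth2_Psi1 : smooth2 D12 Psi1.
Proof.
  apply (smooth2_ext _ (fun a b => / 2 * (gg a b + (1 + - 1 * (a + b)) * hh a b))).
  { intros; unfold Psi1; field. }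
  apply smooth2_mult; [apply smooth2_const, open_rectangle|].
  apply smooth2_plus; [apply smooth2_gg|apply smooth2_mult; [apply smooth2_affine|apply smooth2_hh]].
Qed.

Lemma smooth2_Psi2 : smooth2 D12 Psi2.
Proof.
  apply (smooth2_ext _ (fun a b => / 2 * (gg a b + (- 1 + - 1 * (a + b)) * hh a b))).
  { intros; unfold Psi2; field. }
  apply smooth2_mult; [apply smooth2_const, open_rectangle|].
  apply smooth2_plus; [apply smooth2_gg|apply smooth2_mult; [apply smooth2_affine|apply smooth2_hh]].
Qed.

(** [Psi2_1] finds the same value for the a-derivative of [Psi2]. This is at once the closedness
    needed for a potential and, since hh = Psi1 - Psi2, the equation for Psi. *)
Lemma Psi1_2 a b : D12 (a, b) -> is_derive (fun s => Psi1 a s) b (- hh a b / 2).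
Proof.
  intros Hab; assert (Hg := is_derive_at12_2 res_flux a b DF_res_flux Hab); assert (Hh := is_derive_at12_2 res_density a b DF_res_density Hab).
  rewrite res_flux_r in Hg by (apply box_at12; auto); simpl speed_offset in Hg.
  change (at12 a b (rc r1)) with a in Hg; change (at12 a b (rc r2)) with b in Hg.
  set (h2 := pder (rc r2) res_density (at12 a b)) in *.
  unfold Psi1; apply (is_derive_ext (fun s => / 2 * (gg a s + (1 - (a + s)) * hh a s))).
  { intros s; eqR; field. }
  replace (- hh a b / 2) with (/ 2 * ((a + b + -1) * h2 + (- 1 * hh a b + (1 - (a + b)) * h2))) by field.
  apply (is_derive_scal (fun s => gg a s + (1 - (a + s)) * hh a s)).
  apply (is_derive_plus (fun s => gg a s)); [exact Hg|].
  apply (is_derive_mult (fun s => 1 - (a + s))); [auto_derive; auto; ring|exact Hh|apply Rmult_comm].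
Qed.

Lemma Psi2_1 a b : D12 (a, b) -> is_derive (fun s => Psi2 s b) a (- hh a b / 2).
Proof.
  intros Hab; assert (Hg := is_derive_at12_1 res_flux a b DF_res_flux Hab); assert (Hh := is_derive_at12_1 res_density a b DF_res_density Hab).
  rewrite res_flux_r in Hg by (apply box_at12; auto); simpl speed_offset in Hg.
  change (at12 a b (rc r1)) with a in Hg; change (at12 a b (rc r2)) with b in Hg.
  set (h1 := pder (rc r1) res_density (at12 a b)) in *.
  unfold Psi2; apply (is_derive_ext (fun s => / 2 * (gg s b + (- 1 - (s + b)) * hh s b))).
  { intros s; eqR; field. }
  replace (- hh a b / 2) with (/ 2 * ((a + b + 1) * h1 + (- 1 * hh a b + (- 1 - (a + b)) * h1))) by field.
  apply (is_derive_scal (fun s => gg s b + (- 1 - (s + b)) * hh s b)).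
  apply (is_derive_plus (fun s => gg s b) (fun s => (- 1 - (s + b)) * hh s b)); [exact Hg|].
  apply (is_derive_mult (fun s => - 1 - (s + b)) (fun s => hh s b)); [auto_derive; auto; ring|exact Hh|apply Rmult_comm].
Qed.

Lemma residual_EHC : exists Psi, smooth2 D12 Psi /\ Psi_equation D12 Psi /\
  forall z, B z ->
    rho z = (z (pc r1) * P r1 z + z (pc r2) * P r2 z + z (pc r3) * P r3 z) + fst (cur_EHC Psi) z /\
    flux z = ((z (rc r1) + z (rc r2) + 1) * (z (pc r1) * P r1 z) +
      (z (rc r1) + z (rc r2) - 1) * (z (pc r2) * P r2 z) +
      (z (rc r1) + z (rc r2)) * (z (pc r3) * P r3 z)) + snd (cur_EHC Psi) z + t_part z.
Proof.
  set (Psi := potential (z0 (rc r1)) (z0 (rc r2)) Psi1 Psi2).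
  assert (Hcl : forall a b, D12 (a, b) -> Derive (fun s => Psi1 a s) b = Derive (fun s => Psi2 s b) a).
  { intros a b Hab; transitivity (- hh a b / 2); [|symmetry];
      apply is_derive_unique; [apply Psi1_2|apply Psi2_1]; auto. }
  assert (E1 : forall a b, D12 (a, b) -> partial_derive 1 0 Psi a b = Psi1 a b).
  { intros a b Hab; apply (is_derive_unique (fun s => Psi s b)).
    apply (is_derive_potential_1 _ _ e Psi1 Psi2 smooth2_Psi1); auto. }
  assert (E2 : forall a b, D12 (a, b) -> partial_derive 0 1 Psi a b = Psi2 a b).
  { intros a b Hab; apply (is_derive_unique (fun s => Psi a s)).
    apply (is_derive_potential_2 _ _ e Psi1 Psi2 smooth2_Psi1 smooth2_Psi2 Hcl); auto. }
  exists Psi; split; [|split].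
  - exact (smooth2_potential _ _ e Psi1 Psi2 smooth2_Psi1 smooth2_Psi2 Hcl).
  - intros a b Hab; rewrite E1, E2 by auto.
    replace (partial_derive 1 1 Psi a b) with (- hh a b / 2).
    + unfold Psi1, Psi2; field.
    + symmetry; change (Derive (fun s => partial_derive 0 1 Psi s b) a = - hh a b / 2).
      apply is_derive_unique, (is_derive_ext_loc (fun s => Psi2 s b)); [|apply Psi2_1; auto].
      generalize (locally_of_2d _ _ _ (open_locally_2d _ _ _ (open_rectangle _ _ _) Hab)).
      apply filter_imp; intros s Hs; symmetry; apply E2; auto.
  - intros z Hz; unfold cur_EHC, fst, snd, u.
    rewrite E1, E2 by (apply D12_box; auto).
    assert (Eh := res_density_at12 z Hz); assert (EG := res_flux_at12 z Hz).
    fold (hh (z (rc r1)) (z (rc r2))) in Eh; fold (gg (z (rc r1)) (z (rc r2))) in EG.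
    unfold res_density in Eh; unfold res_flux in EG; unfold Psi1, Psi2.
    split; [|]; apply Rminus_diag_uniq.
    + apply Rminus_diag_eq in Eh; refine (eq_trans _ Eh); field.
    + apply Rminus_diag_eq in EG; refine (eq_trans _ EG); field.
Qed.
End Residual.

(** * Equivalence of currents *)

Lemma jet_open_pair (D : R * R -> Prop) F G :
  open D -> (forall z, jcont F z) -> (forall z, jcont G z) -> jet_open (fun z => D (F z, G z)).
Proof.
  intros HD HF HG z Hz; destruct (open_locally_2d D _ _ HD Hz) as [e He].
  refine (jet_locally_mono _ _ _ _ (jet_locally_and z _ _
    (proj1 (jcont_eps F z) (HF z) e) (proj1 (jcont_eps G z) (HG z) e))).
  intros w [H1 H2]; apply He; auto.
Qed.

Lemma jet_open_neq k U F : DF k U F -> jet_open (fun z => U z /\ F z <> 0).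
Proof.
  intros HF; apply (jet_open_preimage (fun x => x <> 0)); [apply (DF_open HF)|apply (DF_cont HF)|].
  intros x Hx; exists (mkposreal _ (Rabs_pos_lt _ Hx)); intros y Hy ->.
  assert (Hy' : Rabs (0 - x) < Rabs x) by exact Hy.
  rewrite Rminus_0_l, Rabs_Ropp in Hy'; lra.
Qed.

Lemma jet_open_C0_domain : jet_open cur_C0_domain.
Proof.
  assert (HT := jet_open_true).
  assert (H : forall i, jet_open (fun z => ux i z <> 0)).
  { intros i z Hz; refine (jet_locally_mono _ _ _ _ (jet_open_neq 1 (fun _ => True) (ux i) _ z (conj I Hz))).
    - intros w [_ Hw]; exact Hw.
    - apply DF_coord; auto. }
  apply jet_open_and; apply H.
Qed.

Lemma jet_open_C1_domain D : open D -> jet_open (cur_C1_domain D).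
Proof.
  intros HD; assert (HT := jet_open_true); apply jet_open_pair; auto.
  - intros z; apply jcont_coord.
  - intros z; refine (DF_cont (k := 1) (U := fun _ => True) _ z I).
    apply DF_mult; [apply DF_coord; auto|apply DF_exp, DF_minus; apply DF_coord; auto].
Qed.

Lemma conserved_C0 : conserved_current cur_C0_domain cur_C0.
Proof.
  replace cur_C0 with (fun z => 1 * fst cur_C0 z, fun z => 1 * snd cur_C0 z).
  - apply normal_pair_conserved, normal_pair_C0; [apply jet_open_C0_domain|right; auto].
  - unfold cur_C0; simpl; f_equal; extensionality z; ring.
Qed.

Lemma conserved_C1 D Omega : smooth2 D Omega -> conserved_current (cur_C1_domain D) (cur_C1 Omega).
Proof.
  intros H; apply (normal_pair_conserved _ (fst (cur_C1 Omega)) (snd (cur_C1 Omega))).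
  apply (normal_pair_C1 _ D); auto; apply jet_open_C1_domain, H.
Qed.

Lemma conserved_EHC D Psi :
  smooth2 D Psi -> Psi_equation D Psi -> conserved_current (cur_EHC_domain D) (cur_EHC Psi).
Proof.
  intros H HE; apply (normal_pair_conserved _ (fst (cur_EHC Psi)) (snd (cur_EHC Psi))).
  apply (normal_pair_EHC _ D); auto; apply (jet_open_two_coords (rc r1) (rc r2)), H.
Qed.

(** Locally this is (D_x phi, - D_t phi) + (0, g(t)) with d phi = b_i dr^i. The potential phi is
    never built, because closedness already cancels the terms of the divergence. *)
Lemma null_divergence_closed_form W (b : dvar -> jet -> R) g :
  (forall i, DF 1 W (b i)) -> DF 1 W g ->
  (forall i c z, W z -> (forall j, c <> rc j) -> pder c (b i) z = 0) ->
  (forall i j z, W z -> pder (rc i) (b j) z = pder (rc j) (b i) z) ->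
  (forall c z, W z -> c <> ind vt -> pder c g z = 0) ->
  null_divergence W
    (fun z => z (pc r1) * b r1 z + z (pc r2) * b r2 z + z (pc r3) * b r3 z,
     fun z => g z - (z (der r1 1 0) * b r1 z + z (der r2 1 0) * b r2 z + z (der r3 1 0) * b r3 z)).
Proof.
  intros Hb Hg Hr Hcl Hgt; assert (HW := DF_open Hg).
  assert (Hc : forall c, (ord c <= 1)%nat -> DF 1 W (fun z => z c)) by (intros; apply DF_coord; auto).
  exists 1%nat; split.
  - split; [|apply DF_minus; auto]; repeat apply DF_plus; apply DF_mult; auto.
  - intros z Hz; assert (B1 := Hb r1); assert (B2 := Hb r2); assert (B3 := Hb r3).
    set (F := fun (q : dvar -> coord) c =>
      ((if coord_eq_dec (q r1) c then 1 else 0) * b r1 z + z (q r1) * pder c (b r1) z) +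
      ((if coord_eq_dec (q r2) c then 1 else 0) * b r2 z + z (q r2) * pder c (b r2) z) +
      ((if coord_eq_dec (q r3) c then 1 else 0) * b r3 z + z (q r3) * pder c (b r3) z)).
    assert (E1 : forall c, pder c
      (fun z => z (pc r1) * b r1 z + z (pc r2) * b r2 z + z (pc r3) * b r3 z) z = F (fun i => pc i) c).
    { intros c; apply is_pder_unique; unfold F; pdb. }
    assert (E2 : forall c, pder c
      (fun z => g z - (z (der r1 1 0) * b r1 z + z (der r2 1 0) * b r2 z + z (der r3 1 0) * b r3 z)) z
      = pder c g z - F (fun i => der i 1 0) c).
    { intros c; apply is_pder_unique; unfold F; pdb. }
    unfold F in E1, E2.
    cbv beta in E1, E2; unfold fst, snd, Dt, Dx, sum_dvar; simpl sum_f_R0; simpl Nat.sub.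
    rewrite !E1, !E2.
    repeat match goal with |- context [coord_eq_dec ?x ?y] =>
      first [rewrite (if_coord_diff x y) by discriminate|rewrite (if_coord_same x)] end.
    rewrite !(fun i => Hr i (pc r1)), !(fun i => Hr i (pc r2)), !(fun i => Hr i (pc r3)),
      !(fun i => Hr i (der r1 1 0)), !(fun i => Hr i (der r2 1 0)), !(fun i => Hr i (der r3 1 0)),
      !(fun i => Hr i (ind vt)), !(fun i => Hr i (ind vx)) by (auto; discriminate).
    rewrite !Hgt by (auto; discriminate).
    rewrite !(Hcl r2 r1), !(Hcl r3 r1), !(Hcl r3 r2) by auto; ring.
Qed.

Lemma null_divergence_zero W : jet_open W -> null_divergence W (fun _ => 0, fun _ => 0).
Proof.
  intros HW; exists 0%nat; split; [split; apply DF_const; auto|].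
  intros z _; unfold fst, snd; rewrite Dt_lsum, Dx_lsum, !lsum_zero; [ring| |];
    intros c _; rewrite (is_pder_unique _ _ _ _ (is_pder_const c 0 z)); ring.
Qed.

(** The condition z c <> proj z c is open and excludes all jets of solutions, so on this
    neighbourhood vanishing on solutions holds vacuously. *)
Lemma trivial_off_equations U rho sigma z0 c :
  conserved_current U (rho, sigma) -> U z0 -> z0 c <> proj z0 c ->
  exists W, jet_open W /\ W z0 /\ (forall z, W z -> U z) /\
    equivalent_currents W (rho, sigma) (combination 0 (fun _ _ => 0) (fun _ _ => 0)).
Proof.
  intros [k [[H1 H2] _]] Hz0 Hc; simpl in H1, H2; assert (HU := DF_open H1).
  assert (HD : DF (ord c) U (fun z => z c - proj z c)).
  { apply DF_minus; [apply DF_coord; auto|apply DF_proj; auto]. }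
  set (W := fun z => U z /\ z c - proj z c <> 0).
  assert (HW : jet_open W) by (apply (jet_open_neq (ord c)); auto).
  assert (HWU : forall z, W z -> U z) by (intros z [Hz _]; exact Hz).
  exists W; split; [exact HW|split; [split; [auto|lra]|split; [exact HWU|]]].
  assert (Hvac : forall F, vanishes_on_solutions W F).
  { intros F O f Hs t x HO [_ Hne]; destruct Hne.
    rewrite <- (prolong_proj O f t x Hs HO); ring. }
  exists (fun _ => 0, fun _ => 0), (rho, sigma); split; [apply null_divergence_zero; auto|split].
  - split; [exists k; split; [apply (DF_sub H1)|apply (DF_sub H2)]; auto|split; apply Hvac].
  - intros z _.
    assert (E : forall a b, partial_derive 1 0 (fun _ _ => 0) a b = 0 /\ partial_derive 0 1 (fun _ _ => 0) a b = 0).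
    { intros a b; split; apply (Derive_const 0). }
    destruct (E (u r1 z) (u r2 z)) as [Ea Eb].
    unfold cur_sub, cur_scal, combination, cur_add, cur_C1, cur_EHC; cbn [fst snd].
    unfold cur_scal; cbn [fst snd]; rewrite Ea, Eb; split; ring.
Qed.

Lemma Psi_equation_zero D : Psi_equation D (fun _ _ => 0).
Proof.
  intros a b _.
  assert (E : forall m n, partial_derive (S m) n (fun _ _ => 0) a b = 0).
  { intros m n; exact (Derive_n_const m (Derive_n (fun _ => 0) n b) a). }
  rewrite !E; unfold partial_derive; simpl; rewrite Derive_const; ring.
Qed.

Theorem proposition25 :
  conserved_current cur_C0_domain cur_C0 /\
  (forall (D : R * R -> Prop) (Omega : R -> R -> R),
     smooth2 D Omega -> conserved_current (cur_C1_domain D) (cur_C1 Omega)) /\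
  (forall (D : R * R -> Prop) (Psi : R -> R -> R),
     smooth2 D Psi -> Psi_equation D Psi ->
     conserved_current (cur_EHC_domain D) (cur_EHC Psi)) /\
  (forall (U : jet -> Prop) (rho sigma : jet -> R),
     conserved_current U (rho, sigma) ->
     first_order_tx_independent U rho ->
     forall z0 : jet, U z0 ->
     exists (W : jet -> Prop) (c : R) (D1 D2 : R * R -> Prop)
            (Omega Psi : R -> R -> R),
       jet_open W /\ W z0 /\ (forall z, W z -> U z) /\
       (c = 0 \/ forall z, W z -> cur_C0_domain z) /\
       smooth2 D1 Omega /\ (forall z, W z -> cur_C1_domain D1 z) /\
       smooth2 D2 Psi /\ Psi_equation D2 Psi /\ (forall z, W z -> cur_EHC_domain D2 z) /\
       equivalent_currents W (rho, sigma) (combination c Omega Psi)).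
Proof.
  split; [exact conserved_C0|split; [exact conserved_C1|split; [exact conserved_EHC|]]].
  intros U rho sigma HC Hdep z0 Hz0.
  destruct (classic (forall c, z0 c = proj z0 c)) as [HE|HE].
  2:{ apply not_all_ex_not in HE; destruct HE as [c Hc].
      destruct (trivial_off_equations U rho sigma z0 c HC Hz0 Hc) as [W [HW [HWz [HWU Heq]]]].
      assert (HS : smooth2 (fun _ => True) (fun _ _ => 0)) by (apply smooth2_const, open_true).
      exists W, 0, (fun _ => True), (fun _ => True), (fun _ _ => 0), (fun _ _ => 0).
      repeat (split; [solve [auto using Psi_equation_zero|intros; exact I]|]); exact Heq. }
  destruct (conserved_normal_pair U rho sigma z0 HC Hdep Hz0 HE) as [n [e [Hn [HB HN]]]].
  destruct (remove_C0 n e z0 _ _ Hn HN) as [c [Hc [HN1 HQ1]]].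
  set (rho1 := fun z => rho z + - c * fst cur_C0 z) in *.
  set (S1 := fun z => sigma (proj z) + - c * snd cur_C0 z) in *.
  (* C_1 is split off on a smaller box: Omega is defined through points transported to the central
     r^1, r^2, and these have to stay in the original box. *)
  destruct (scaled_ball (z0 (pc r3)) e) as [e' [Hee He']].
  set (W := box n e' z0).
  assert (HW : jet_open W) by apply jet_open_box.
  assert (HWB : forall z, W z -> box n e z0 z) by (intros z Hz; exact (box_sub n e z0 e' Hee z Hz)).
  set (Omega := Omega_of z0 rho1).
  assert (HO := smooth2_Omega n e z0 rho1 S1 HN1).
  assert (HD1 := C1_domain_box n e z0 Hn e' Hee He').
  assert (HN2 := normal_pair_remove_C1 n e z0 rho1 S1 Hn HN1 e' Hee He').
  assert (HQ2 := rho_C1_pp n e z0 rho1 S1 Hn HN1 HQ1 e' Hee He').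
  assert (Hs2 := rho_C1_slice n e z0 rho1 S1 Hn HN1 HQ1 e' Hee He').
  set (rho2 := rho_C1 z0 rho1) in *; set (S2 := flux_C1 z0 rho1 S1) in *.
  destruct (residual_EHC n e' z0 rho2 S2 Hn HN2 HQ2 Hs2) as [Psi [HP [HPE Hdec]]].
  exists W, c, (Omega_domain e z0), (D12 e' z0), Omega, Psi.
  assert (HD2 : forall z, W z -> cur_EHC_domain (D12 e' z0) z) by (intros z Hz; exact (D12_box n e' z0 Hn z Hz)).
  assert (HcW : c = 0 \/ forall z, W z -> cur_C0_domain z) by (destruct Hc; auto).
  split; [exact HW|]; split; [apply box_center|]; split; [intros z Hz; apply HB; auto|].
  split; [exact HcW|]; split; [exact HO|]; split; [exact HD1|].
  split; [exact HP|]; split; [exact HPE|]; split; [exact HD2|].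
  set (b := fun i => pder (pc i) rho2).
  set (g := t_part z0 rho2 S2).
  assert (Hb : forall i, DF 1 W (b i)) by (intros i; apply DF_pder, (np_rho _ _ _ HN2)).
  assert (Hg : DF 1 W g) by (apply (DF_t_part n e' z0 rho2 S2 Hn HN2)).
  set (N1 := fun z => z (pc r1) * b r1 z + z (pc r2) * b r2 z + z (pc r3) * b r3 z).
  set (T := fun z => z (der r1 1 0) * b r1 z + z (der r2 1 0) * b r2 z + z (der r3 1 0) * b r3 z).
  (* As a null divergence, the density b_i r^i_x has the flux - b_i r^i_t, while the decomposition
     provides V^i b_i r^i_x; the two agree on solutions. This discrepancy, and that between sigma
     and its composite with [proj], go into the pair vanishing on solutions, whose density is
     zero. *)
  exists (N1, fun z => g z - T z), (fun _ => 0, fun z => sigma z - snd (combination c Omega Psi) z + T z - g z).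
  split; [|split].
  - apply null_divergence_closed_form; auto.
    + intros i c' z; apply (P_other n e' z0 rho2 S2 HN2 HQ2).
    + intros i j z; apply (P_closed n e' z0 rho2 S2 HN2 HQ2).
    + intros c' z _; apply (t_part_pder z0 rho2 S2).
  - destruct HC as [k [[Hr Hs] _]]; simpl in Hr, Hs.
    assert (HT : DF 1 W T).
    { unfold T; repeat apply DF_plus; (apply DF_mult; [apply DF_coord; auto|auto]). }
    assert (Hcomb : DF 1 W (snd (combination c Omega Psi))).
    { apply (DF_plus 1 W (fun z => c * snd cur_C0 z)); [apply (normal_pair_C0 W c HW HcW)|].
      apply DF_plus.
      - apply (normal_pair_C1 W _ Omega HW HO HD1).
      - apply (normal_pair_EHC W _ Psi HW HP HPE HD2). }
    split; [|split].
    + exists (Nat.max k 1); split; [apply DF_const; auto|].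
      assert (Hm : forall F, DF 1 W F -> DF (Nat.max k 1) W F) by (intros F HF; apply (DF_mono HF); lia).
      apply DF_minus; [apply DF_plus; [apply DF_minus|]|]; auto.
      apply (DF_mono (DF_sub Hs W HW (fun z Hz => proj1 (HB z (HWB z Hz))))); lia.
    + intros O f _ t x _ _; reflexivity.
    + intros O f Hsol t x HOtx HWf; cbn [snd].
      set (w := prolong f t x) in *.
      assert (Ew : proj w = w) by (extensionality d; symmetry; exact (prolong_proj O f t x Hsol HOtx d)).
      assert (Et : forall i, w (der i 1 0) = - (V i w * ux i w)) by (intros i; rewrite <- proj_t, Ew; auto).
      destruct (Hdec w HWf) as [_ E].
      unfold T; rewrite !Et, !V_offset; fold g in E.
      unfold S2, flux_C1, S1 in E; rewrite Ew in E; fold Omega in E.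
      unfold combination, cur_add, cur_scal; cbn [fst snd]; unfold ux; simpl speed_offset.
      fold (b r1) (b r2) (b r3) in E.
      apply Rminus_diag_eq in E; refine (eq_trans _ E); ring.
  - intros z Hz; destruct (Hdec z Hz) as [E _].
    unfold cur_sub, cur_add, cur_scal, combination, cur_add, cur_scal; cbn [fst snd]; split; [|ring].
    fold (b r1) (b r2) (b r3) in E; 
    change (rho2 z) with (rho z + - c * fst cur_C0 z + -1 * fst (cur_C1 Omega) z) in E.
    unfold N1; apply Rminus_diag_eq in E; apply Rminus_diag_uniq; refine (eq_trans _ E); ring.
Qed.
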